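(* Let $d\ge 2$, let $D\subset\mathbb{R}^d$ be a Lipschitz domain (bounded or unbounded) and let $u:D\to\mathbb{R}$ be a bounded positive harmonic function. Let $\mathcal{V}^u(\partial D)$ be the set of Bourgain points of $u$, that is, $$\mathcal{V}^u(\partial D)=\Big\{x\in\partial D:\ \exists v\in\mathbb{R}^d \text{ such that } (x,x+v]\subset D \text{ and } \int_0^1\|\nabla u(x+tv)\|\,\mathrm{d}t<\infty\Big\}.$$ Then for every $x\in\partial D$ and every $r>0$ the ball $B(x,r)$ contains a Bourgain point, i.e. $\mathcal{V}^u(\partial D)\cap B(x,r)\neq\emptyset$, and moreover the Hausdorff dimension satisfies $$\dim\big(\mathcal{V}^u(\partial D)\cap B(x,r)\big)>\frac{d-1}{2}.$$
   Context: $B(x,r)$ is the open ball in $\mathbb{R}^d$, $\|\cdot\|$ the Euclidean norm, $\dim$ the Hausdorff dimension, and $(x,x+v]=\{x+tv: 0<t\le 1\}$. A domain $D\subset\mathbb{R}^d$ is a Lipschitz domain if for every $\rho\in\partial D$ there are, after a rigid motion of $\mathbb{R}^d$ taking $\rho$ to the origin, numbers $r,h>0$ and a Lipschitz function $\phi$ on $B^{d-1}(0,r)=\{x\in\mathbb{R}^{d-1}:\|x\|<r\}$ with $|\phi|<h/2$ such that, with the cylinder $\mathcal{C}=\{(x,y)\in\mathbb{R}^{d-1}\times\mathbb{R}:\|x\|<r,\ |y|<h\}$, one has $D\cap\mathcal{C}=\{(x,y):\|x\|<r,\ \phi(x)<y<h\}$ and $\partial D\cap\mathcal{C}=\{(x,\phi(x)):\|x\|<r\}$.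 *)

(* Defs.v *)
From HB Require Import structures.
From mathcomp Require Import all_boot all_order all_algebra.
From mathcomp Require Import all_classical all_reals all_analysis.

Set Implicit Arguments.
Unset Strict Implicit.
Unset Printing Implicit Defensive.

Import Order.TTheory GRing.Theory Num.Theory.
Import numFieldNormedType.Exports.

Local Open Scope classical_set_scope.
Local Open Scope ring_scope.

(* R^d is 'rV[R]_d.  The library norm on matrices is the max norm; it induces
   the usual topology (used for open, closure, continuity and derivatives),
   but all metric notions below use the Euclidean norm [enorm]. *)
Definition enorm (R : realType) (d : nat) (x : 'rV[R]_d) : R :=
  Num.sqrt (\sum_(i < d) x ord0 i ^+ 2).

Definition eball (R : realType) (d : nat) (x : 'rV[R]_d) (r : R) :
    set 'rV[R]_d :=
  [set y | enorm (y - x) < r].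

Definition boundary (T : topologicalType) (A : set T) : set T :=
  closure A `\` interior A.

Definition is_domain (R : realType) (d : nat) (D : set 'rV[R]_d) : Prop :=
  [/\ D !=set0, open D & connected D].

(* The model space R^(d-1) x R is 'rV[R]_(d.-1 + 1): the point (x, y) has
   x = lsubmx w and y = rsubmx w ord0 ord0. *)
Definition base (R : realType) (d : nat) (w : 'rV[R]_(d.-1 + 1)) :
    'rV[R]_d.-1 :=
  lsubmx w.

Definition height (R : realType) (d : nat) (w : 'rV[R]_(d.-1 + 1)) : R :=
  rsubmx w ord0 ord0.

Definition cylinder (R : realType) (d : nat) (r h : R) :
    set 'rV[R]_(d.-1 + 1) :=
  [set w | enorm (base w) < r /\ `|height w| < h].

(* [Q] is orthogonal; the two conditions are equivalent when 0 < d, where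
   d.-1 + 1 = d. *)
Definition orthogonal_mx (R : realType) (d : nat) (Q : 'M[R]_(d, d.-1 + 1)) :
    Prop :=
  Q *m Q^T = 1%:M /\ Q^T *m Q = 1%:M.

Definition rigid_motion (R : realType) (d : nat) (rho : 'rV[R]_d)
    (Q : 'M[R]_(d, d.-1 + 1)) (z : 'rV[R]_d) : 'rV[R]_(d.-1 + 1) :=
  (z - rho) *m Q.

Definition lipschitz_on_ball (R : realType) (m : nat) (r : R)
    (phi : 'rV[R]_m -> R) : Prop :=
  exists L : R, forall x y : 'rV[R]_m, enorm x < r -> enorm y < r ->
    `|phi x - phi y| <= L * enorm (x - y).

Definition lipschitz_domain (R : realType) (d : nat) (D : set 'rV[R]_d) :
    Prop :=
  is_domain D /\
  forall rho : 'rV[R]_d, boundary D rho ->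
    exists (Q : 'M[R]_(d, d.-1 + 1)) (r h : R) (phi : 'rV[R]_d.-1 -> R),
      [/\ orthogonal_mx Q,
          0 < r /\ 0 < h,
          lipschitz_on_ball r phi /\
            (forall x : 'rV[R]_d.-1, enorm x < r -> `|phi x| < h / 2),
          (rigid_motion rho Q @` D) `&` cylinder r h =
            [set w : 'rV[R]_(d.-1 + 1) | enorm (base w) < r /\
               phi (base w) < height w < h]
        & (rigid_motion rho Q @` boundary D) `&` cylinder r h =
            [set w : 'rV[R]_(d.-1 + 1) | enorm (base w) < r /\
               height w = phi (base w)]].

(* Functions D -> R are total functions whose values outside D are irrelevant:
   D is open and all conditions are local at points of D. *)
Definition partial (R : realType) (d : nat) (i : 'I_d) (u : 'rV[R]_d -> R)
    (x : 'rV[R]_d) : R :=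
  derive u x (delta_mx ord0 i).

Definition grad (R : realType) (d : nat) (u : 'rV[R]_d -> R) (x : 'rV[R]_d) :
    'rV[R]_d :=
  \row_(i < d) partial i u x.

Definition laplacian (R : realType) (d : nat) (u : 'rV[R]_d -> R)
    (x : 'rV[R]_d) : R :=
  \sum_(i < d) partial i (partial i u) x.

Definition C2_on (R : realType) (d : nat) (D : set 'rV[R]_d)
    (u : 'rV[R]_d -> R) : Prop :=
  forall x : 'rV[R]_d, D x ->
    [/\ {for x, continuous u},
        forall i : 'I_d, derivable u x (delta_mx ord0 i) /\
          {for x, continuous (partial i u)}
      & forall i j : 'I_d, derivable (partial i u) x (delta_mx ord0 j) /\
          {for x, continuous (partial j (partial i u))}].

Definition harmonic_on (R : realType) (d : nat) (D : set 'rV[R]_d)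
    (u : 'rV[R]_d -> R) : Prop :=
  C2_on D u /\ forall x : 'rV[R]_d, D x -> laplacian u x = 0.

Definition segment (R : realType) (d : nat) (x v : 'rV[R]_d) :
    set 'rV[R]_d :=
  [set x + t *: v | t in `]0, 1] : set R].

(* The integrand is only evaluated for 0 < t <= 1, where x + t v lies in D. *)
Definition bourgain_points (R : realType) (d : nat) (D : set 'rV[R]_d)
    (u : 'rV[R]_d -> R) : set 'rV[R]_d :=
  [set x | boundary D x /\
    exists v : 'rV[R]_d, segment x v `<=` D /\
      (\int[@lebesgue_measure R]_(t in `]0%R, 1%R])
         (enorm (grad u (x + t *: v)))%:E < +oo)%E].

(* Euclidean diameter, equal to -oo on the empty set. *)
Definition ediam (R : realType) (d : nat) (U : set 'rV[R]_d) : \bar R :=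
  ereal_sup [set (enorm (x - y))%:E | x in U & y in U].

(* diam(U)^s, with value 0 on the empty set for every s. *)
Definition ediam_pow (R : realType) (d : nat) (s : R) (U : set 'rV[R]_d) :
    \bar R :=
  if U == set0 then 0%E else poweR (ediam U) s.

Definition hausdorff_premeasure (R : realType) (d : nat) (s delta : R)
    (A : set 'rV[R]_d) : \bar R :=
  ereal_inf [set (\sum_(0 <= k <oo) ediam_pow s (U k))%E |
    U in [set U : nat -> set 'rV[R]_d | A `<=` \bigcup_k U k /\
            forall k, (ediam (U k) <= delta%:E)%E]].

Definition hausdorff_measure (R : realType) (d : nat) (s : R)
    (A : set 'rV[R]_d) : \bar R :=
  ereal_sup [set hausdorff_premeasure s delta A |
    delta in [set delta : R | 0 < delta]].

Definition hausdorff_dim (R : realType) (d : nat) (A : set 'rV[R]_d) :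
    \bar R :=
  ereal_inf [set s%:E | s in [set s : R | 0 <= s /\
    hausdorff_measure s A = 0%E]].

(* Main.v *)
Require Import Defs.
From HB Require Import structures.
From mathcomp Require Import all_boot all_order all_algebra.
From mathcomp Require Import all_classical all_reals all_analysis.
From mathcomp Require Import ring lra zify.

Set Implicit Arguments.
Unset Strict Implicit.
Unset Printing Implicit Defensive.

Import Order.TTheory GRing.Theory Num.Theory.
Import numFieldNormedType.Exports.

Local Open Scope classical_set_scope.
Local Open Scope ring_scope.

(* A deterministic path replaces a random one.  Let [walk f z] be the average of [f] over the ball of radius delta(z)/8 around [z], where delta is the distance to the complement of [D], with a bias [eps] towards the points where [u] is smaller than [u z].  By the mean value property [walk u <= u - (eps/2) osc], with [osc] the mean oscillation of [u] on the ball, so [bpot = sum_m 2^-m walk^m u] is a bounded potential whose decrement at [z] dominates, through Harnack chains, [t |grad u|] at the points of depth [t ~ delta(z)], with polynomial losses in their distance to [z].  To it are added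
   - [tpot], the sum over the dyadic scales [t > delta(z)] of a Lipschitz envelope of [t |grad u|], which under [walk] increases at most by the decrement of [bpot];
   - a barrier [g ~ delta^beta], which satisfies [walk g <= (1 - gd) g];
   - [sum_k rho_k^s w_k] with [w_k >= |z - p_k|^-s], [walk w_k <= w_k] and [s > (d - 1)/2]; such [w_k] exist since every proper circular cone carries a positive superharmonic function of degree [-sigma < -(d - 1)/2].
   The sum [Phi] satisfies [walk Phi <= Phi - K gd g], so near every [z] there is a point where [Phi] is smaller by [K (gd/2) g z].  Moving greedily, the steps are summable because [g >= delta], and the path converges to a boundary point [x].  As [Phi] stays bounded, [x] lies in none of the balls [B(p_k, rho_k)], and the sum over the dyadic pieces of the segment from [x] to [x + ts e] of length times supremum of [|grad u|] is finite.  Taking the balls from a cover of the Bourgain points bounds their Hausdorff dimension from below.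
   Ball averages are taken with a finitely additive translation-invariant mean, an ultrafilter limit of lattice averages, applied one coordinate at a time. *)

(** * Euclidean geometry *)

(** Boundedness of [u] only gives [t |grad u| <= const] at depth [t], a divergent sum over the
    dyadic scales, so each scale has to be paid for by a decrement of one bounded potential. An
    unbiased average reproduces [u] and releases nothing; this is what the bias is for. Its price is
    that a nonnegative superharmonic function may grow under [walk] by the factor [1 + 4 eps]. The
    barrier [g] gains more than that by itself, the poles [w_k] only after a geometric mean with [g]
    has been added to them; hence [eps] is small against the gain of [g] and against [gam * gd]. The
    scale [t] counts only where delta < [t], so [tpot] vanishes at the starting point, and [K] is so
    large that the bounded potential uses at most a third of the initial budget [K mu]. With theta
    the angle to the axis, the exponent (d - 1)/2 comes from (1 + cos theta)^(-(d - 1)/2):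
    |w|^(-sigma) times a constant minus this function is superharmonic for sigma slightly above (d -
    1)/2 if d >= 3. In the plane it comes from |w|^(-1/2) cos (theta/2), harmonic off a ray. *)

Section Euclid.
Context {R : realType} {d : nat}.
Local Notation V := 'rV[R]_d.
Implicit Types (x y z a b : V) (s t r eta e h : R).

Definition dot x y : R := \sum_(i < d) x ord0 i * y ord0 i.

Lemma dotC x y : dot x y = dot y x.
Proof. by apply: eq_bigr => i _; rewrite mulrC. Qed.

Lemma dotDl x y z : dot (x + y) z = dot x z + dot y z.
Proof. by rewrite -big_split /=; apply: eq_bigr => i _; rewrite !mxE mulrDl. Qed.

Lemma dotDr x y z : dot x (y + z) = dot x y + dot x z.
Proof. by rewrite dotC dotDl !(dotC x). Qed.

Lemma dotZl s x y : dot (s *: x) y = s * dot x y.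
Proof. by rewrite mulr_sumr; apply: eq_bigr => i _; rewrite !mxE mulrA. Qed.

Lemma dotZr s x y : dot x (s *: y) = s * dot x y.
Proof. by rewrite dotC dotZl dotC. Qed.

Lemma dotNl x y : dot (- x) y = - dot x y.
Proof. by rewrite -scaleN1r dotZl mulN1r. Qed.

Lemma dotNr x y : dot x (- y) = - dot x y.
Proof. by rewrite dotC dotNl dotC. Qed.

Lemma dotBl x y z : dot (x - y) z = dot x z - dot y z.
Proof. by rewrite dotDl dotNl. Qed.

Lemma dotBr x y z : dot x (y - z) = dot x y - dot x z.
Proof. by rewrite dotDr dotNr. Qed.

Lemma dotxx_ge0 x : 0 <= dot x x.
Proof. by apply: sumr_ge0 => i _; rewrite -expr2 sqr_ge0. Qed.

Lemma enormE x : enorm x = Num.sqrt (dot x x).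
Proof. by []. Qed.

Lemma enorm_ge0 x : 0 <= enorm x.
Proof. exact: sqrtr_ge0. Qed.
Hint Resolve enorm_ge0 : core.

Lemma sqr_enorm x : enorm x ^+ 2 = dot x x.
Proof. by rewrite enormE sqr_sqrtr// dotxx_ge0. Qed.

Lemma enorm0 : enorm (0 : V) = 0.
Proof.
by rewrite enormE /dot big1 ?sqrtr0// => i _; rewrite mxE mul0r.
Qed.

Lemma enormZ s x : enorm (s *: x) = `|s| * enorm x.
Proof.
by rewrite enormE dotZl dotZr mulrA -expr2 sqrtrM ?sqr_ge0// sqrtr_sqr.
Qed.

Lemma enormN x : enorm (- x) = enorm x.
Proof. by rewrite -scaleN1r enormZ normrN1 mul1r. Qed.

Lemma enormB x y : enorm (x - y) = enorm (y - x).
Proof. by rewrite -enormN opprB. Qed.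

Lemma cauchy_schwarz x y : `|dot x y| <= enorm x * enorm y.
Proof.
rewrite -sqrtr_sqr !enormE -sqrtrM ?dotxx_ge0//; apply: ler_wsqrtr.
have [y0|yn0] := eqVneq (dot y y) 0.
  have yi i : y ord0 i = 0.
    have /eqP := y0; rewrite psumr_eq0; last by move=> j _; rewrite -expr2 sqr_ge0.
    by move=> /allP /(_ i (mem_index_enum _)) /=; rewrite mulf_eq0 orbb => /eqP.
  rewrite [dot x y]big1; last by move=> i _; rewrite yi mulr0.
  by rewrite expr0n/= mulr_ge0// dotxx_ge0.
have yy : 0 < dot y y by rewrite lt_def yn0 dotxx_ge0.
have := dotxx_ge0 (dot y y *: x - dot x y *: y).
rewrite dotBl !dotBr !dotZl !dotZr (dotC y x) => h.
rewrite -subr_ge0 -(pmulr_rge0 _ yy); apply: le_trans h _.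
by rewrite le_eqVlt; apply/orP; left; apply/eqP; ring.
Qed.

Lemma dot_le x y : dot x y <= enorm x * enorm y.
Proof. by apply: le_trans (cauchy_schwarz x y); exact: ler_norm. Qed.

Lemma enormD x y : enorm (x + y) <= enorm x + enorm y.
Proof.
rewrite -(ler_pXn2r (n := 2))// ?nnegrE ?addr_ge0// sqr_enorm dotDl !dotDr.
rewrite sqrrD !sqr_enorm (dotC y x) mulr2n.
have := dot_le x y; lra.
Qed.

Lemma enorm_triB x y z : enorm (x - z) <= enorm (x - y) + enorm (y - z).
Proof. by rewrite -[x - z](subrKA y) enormD. Qed.

Lemma le_enormB x y : enorm x - enorm y <= enorm (x - y).
Proof. by rewrite lerBlDr -{1}[x](subrK y) enormD. Qed.

Lemma coord_le_enorm x i : `|x ord0 i| <= enorm x.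
Proof.
rewrite -sqrtr_sqr enormE; apply: ler_wsqrtr.
rewrite /dot (bigD1 i)//= -expr2 lerDl.
by apply: sumr_ge0 => j _; rewrite -expr2 sqr_ge0.
Qed.

Lemma enorm_eq0 x : enorm x = 0 -> x = 0.
Proof.
move=> x0; apply/rowP => i; rewrite mxE; apply/eqP.
by rewrite -normr_le0 -x0 coord_le_enorm.
Qed.

Lemma enorm_gt0 x : x != 0 -> 0 < enorm x.
Proof.
by move=> xn0; rewrite lt_def enorm_ge0 andbT; apply: contra xn0 => /eqP/enorm_eq0/eqP.
Qed.

Lemma enorm_le_sum x : enorm x <= \sum_(i < d) `|x ord0 i|.
Proof.
rewrite -(ler_pXn2r (n := 2))// ?nnegrE ?sumr_ge0// sqr_enorm expr2 mulr_suml.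
apply: ler_sum => i _; apply: le_trans (ler_norm _) _; rewrite normrM.
rewrite ler_wpM2l// (bigD1 i)//= lerDl; exact: sumr_ge0.
Qed.

Lemma mxnorm_le_enorm x : `|x| <= enorm x.
Proof.
rewrite [leLHS]/Num.Def.normr /= mx_normrE; apply/bigmax_leP; split=> //= -[i j] _ /=.
by rewrite ord1 coord_le_enorm.
Qed.

Lemma coord_le_mxnorm x i : `|x ord0 i| <= `|x|.
Proof.
rewrite [leRHS]/Num.Def.normr /= mx_normrE.
by apply/bigmax_geP; right => /=; exists (ord0, i).
Qed.

Lemma enorm_le_mxnorm x : enorm x <= d%:R * `|x|.
Proof.
apply: le_trans (enorm_le_sum x) _.
have -> : d%:R * `|x| = \sum_(i < d) `|x| by rewrite sumr_const card_ord mulr_natl.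
by apply: ler_sum => i _; exact: coord_le_mxnorm.
Qed.

Definition ebase (i : 'I_d) : V := delta_mx ord0 i.

Lemma ebaseE i j : ebase i ord0 j = (i == j)%:R.
Proof. by rewrite mxE eqxx /= eq_sym. Qed.

Lemma dot_ebase x i : dot x (ebase i) = x ord0 i.
Proof.
rewrite /dot (bigD1 i)//= ebaseE eqxx mulr1 big1 ?addr0// => j ji.
by rewrite ebaseE eq_sym (negPf ji) mulr0.
Qed.

Lemma enorm_ebase i : enorm (ebase i) = 1.
Proof. by rewrite enormE dot_ebase ebaseE eqxx sqrtr1. Qed.

Definition cball z r : set V := [set y | enorm (y - z) <= r].

(** Bridge between the max-norm topology of matrices and Euclidean balls, from
    [|x| <= enorm x <= d |x|]; the divisor [d.+1] is positive also for [d = 0]. *)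
Lemma nbhs_enorm z (P : set V) :
  nbhs z P <-> exists2 e : R, 0 < e & forall y, enorm (y - z) < e -> P y.
Proof.
split=> [/nbhs_ballP[e /= e0 zP]|[e e0 zP]].
  exists e => // y ye; apply: zP; rewrite -ball_normE /= distrC.
  exact: le_lt_trans (mxnorm_le_enorm _) ye.
apply/nbhs_ballP; exists (e / d.+1%:R) => /=; first by rewrite divr_gt0.
move=> y; rewrite -ball_normE /= distrC => ye; apply: zP.
apply: le_lt_trans (enorm_le_mxnorm _) _.
rewrite ltr_pdivlMr// in ye; apply: le_lt_trans ye.
by rewrite mulrC ler_wpM2l// ler_nat.
Qed.

Lemma continuous_enormP (phi : V -> R) z : {for z, continuous phi} <->
  forall eta, 0 < eta -> exists2 e : R, 0 < e &
    forall y, enorm (y - z) < e -> `|phi y - phi z| < eta.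
Proof.
split=> [+ eta eta0|h].
  move=> /cvgrPdist_lt /(_ _ eta0) /nbhs_enorm[e e0 h].
  by exists e => // y /h; rewrite /= distrC.
apply/(@cvgrPdist_lt _ _ _ (nbhs z)) => eta eta0; apply/nbhs_enorm.
have [e e0 he] := h _ eta0; exists e => // y /he.
by rewrite distrC.
Qed.

Lemma enorm_lip x y : `|enorm x - enorm y| <= enorm (x - y).
Proof.
rewrite ler_norml le_enormB andbT lerNl opprB; apply: le_trans (le_enormB _ _) _.
by rewrite enormB.
Qed.

Lemma continuous_enorm : continuous (@enorm R d).
Proof.
move=> z; apply/continuous_enormP => eta eta0; exists eta => // y.
exact: le_lt_trans (enorm_lip _ _).
Qed.

Lemma cball_compact z r : compact (cball z r).
Proof.
apply: bounded_closed_compact.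
  exists (enorm z + r); split; first exact: num_real.
  move=> M MB y yB; apply: le_trans (mxnorm_le_enorm _) _.
  apply: le_trans (ltW MB); rewrite -(subrK z y) addrC.
  by rewrite (le_trans (enormD _ _))// lerD2l.
have -> : cball z r = (fun y => enorm (y - z)) @^-1` [set t | t <= r] by [].
apply: (preimage_closed _ (@closed_le R r)) => y _.
apply/continuous_enormP => eta eta0; exists eta => // y'.
apply: le_lt_trans; apply: le_trans (enorm_lip _ _) _.
by rewrite opprB addrA subrK.
Qed.

(** Continuity is meant in the whole space at each point of [K], so the second point [y'] may leave
    [K]; the means below use this near the rim of the ball. *)
Lemma compact_unif_continuous (K : set V) (phi : V -> R) : compact K ->
  (forall y, K y -> {for y, continuous phi}) ->
  forall eta, 0 < eta -> exists2 h : R, 0 < h &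
    forall y y', K y -> enorm (y' - y) < h -> `|phi y' - phi y| < eta.
Proof.
move=> /compact_near_coveringP Kc cphi eta eta0.
have Hn : \forall h \near 0^'+, K `<=` (fun y => forall y', enorm (y' - y) < h -> `|phi y' - phi y| < eta).
  apply: (Kc R (0^'+) (fun h y => forall y', enorm (y' - y) < h -> `|phi y' - phi y| < eta)).
  move=> x Kx; have e2 : 0 < eta / 2 by rewrite divr_gt0.
  have [e e0 he] := (continuous_enormP _ _).1 (cphi _ Kx) _ e2.
  exists ([set y | enorm (y - x) < e / 2], [set h | h < e / 2]) => /=.
    split.
      by apply/nbhs_enorm; exists (e / 2); rewrite ?divr_gt0.
    by apply: nbhs_right_lt; rewrite divr_gt0.
  move=> [y h] /= [ye he'] y' y'h.
  have -> : phi y' - phi y = (phi y' - phi x) - (phi y - phi x) by ring.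
  apply: le_lt_trans (ler_normB _ _) _.
  rewrite [eta]splitr ltrD// he//.
    apply: le_lt_trans (enorm_triB _ y _) _; lra.
  lra.
have [h [Hh h0]] := filter_ex (filterI Hn (nbhs_right_gt 0)).
by exists h => // y y' Ky; exact: Hh.
Qed.

Lemma compact_bounded_fun (K : set V) (phi : V -> R) : compact K ->
  (forall y, K y -> {for y, continuous phi}) ->
  exists2 b : R, 0 < b & forall y, K y -> `|phi y| <= b.
Proof.
move=> /compact_near_coveringP Kc cphi.
pose P (b : R) (y : V) : Prop := `|phi y| <= b.
have Hn : \forall b \near +oo%R, K `<=` P b.
  apply: (Kc R (pinfty_nbhs R) P).
  move=> x Kx.
  have [e e0 he] := (continuous_enormP _ _).1 (cphi _ Kx) 1 ltr01.
  exists ([set y | enorm (y - x) < e], [set b | `|phi x| + 1 <= b]) => /=.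
    split; first by apply/nbhs_enorm; exists e.
    exact: nbhs_pinfty_ge.
  move=> [y b] /= [ye]; apply: le_trans.
  rewrite -[phi y](subrK (phi x)); apply: le_trans (ler_normD _ _) _.
  by have := he _ ye; lra.
have [b [Hb b0]] := filter_ex (filterI Hn (nbhs_pinfty_gt (num_real 0))).
by exists b.
Qed.

End Euclid.
#[global] Hint Extern 0 (is_true (_ <= enorm _)) => exact: enorm_ge0 : core.

(** * A translation-invariant mean *)

Section LineAverage.
Context {R : realType}.
Implicit Types (phi psi : R -> R) (b c r t h eta e k : R).

Lemma free_ultrafilter_exists :
  exists G : set_system nat, UltraFilter G /\ \oo `<=` G.
Proof. exact: ultraFilterLemma. Qed.

Definition free_ultrafilter : set_system nat := sval (cid free_ultrafilter_exists).

Instance free_ultrafilter_ultra : UltraFilter free_ultrafilter.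
Proof. by rewrite /free_ultrafilter; case: cid => G []. Qed.

Instance free_ultrafilter_proper : ProperFilter free_ultrafilter.
Proof. exact: ultra_proper. Qed.

Lemma free_ultrafilter_oo (A : set nat) : \oo A -> free_ultrafilter A.
Proof. by rewrite /free_ultrafilter; case: cid => G [] _ /= + oA; apply. Qed.

(** Compactness gives a cluster point. For a neighbourhood of it, either the preimage or its
    complement belongs to the ultrafilter, and the complement would contradict clustering. *)
Lemma free_ultrafilter_cvg (a : nat -> R) b : (forall n, `|a n| <= b) ->
  a @ free_ultrafilter --> lim (a @ free_ultrafilter).
Proof.
move=> ab; apply/cvg_ex.
have : compact `[- b, b]%classic by exact: segment_compact.
move=> /(_ (a @ free_ultrafilter) _) cK.
have [|p [_ cp]] := cK.
  by rewrite /=; apply: filterE => n; rewrite /= in_itv /= -ler_norml; exact: ab.  exists p => W Wp.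
have [//|aW] := in_ultra_setVsetC (a @^-1` W) free_ultrafilter_ultra.
have [y [/= nWy Wy]] := cp (~` W) W aW Wp.
by [].
Qed.

(** Riemann sum on [-4, 4) with mesh [1 / n.+1], normalised by the mesh and not by the number of
    points. It imitates an integral over a window of length 8, hence the factors 8 in the bounds. *)
Definition line_avg phi (n : nat) : R :=
  n.+1%:R^-1 * \sum_(0 <= j < 8 * n.+1) phi (j%:R / n.+1%:R - 4).

Definition line_mean phi : R := lim (line_avg phi @ free_ultrafilter).

Lemma line_avg_const c n : line_avg (fun=> c) n = 8 * c.
Proof.
rewrite /line_avg sumr_const_nat subn0 -[c *+ _]mulr_natl natrM.
by field; rewrite addrC natr1 pnatr_eq0.
Qed.

Lemma line_avg_le phi psi n : (forall t, phi t <= psi t) ->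
  line_avg phi n <= line_avg psi n.
Proof. by move=> h; rewrite ler_wpM2l// ler_sum. Qed.

Lemma line_avg_norm phi b n : (forall t, `|phi t| <= b) -> `|line_avg phi n| <= 8 * b.
Proof.
move=> pb; rewrite ler_norml -mulrN -!(line_avg_const _ n).
by rewrite !line_avg_le// => t; have := pb t; rewrite ler_norml => /andP[].
Qed.

Lemma line_mean_cvg phi b : (forall t, `|phi t| <= b) ->
  line_avg phi @ free_ultrafilter --> line_mean phi.
Proof. by move=> pb; apply: free_ultrafilter_cvg => n; exact: line_avg_norm pb. Qed.

Lemma line_mean_le phi psi b c : (forall t, `|phi t| <= b) -> (forall t, `|psi t| <= c) ->
  (forall t, phi t <= psi t) -> line_mean phi <= line_mean psi.
Proof.
move=> pb pc h; apply: ler_lim.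
- by apply/cvg_ex; eexists; apply: line_mean_cvg pb.
- by apply/cvg_ex; eexists; apply: line_mean_cvg pc.
- by apply: filterE => n; exact: line_avg_le.
Qed.

Lemma line_meanD phi psi b c : (forall t, `|phi t| <= b) -> (forall t, `|psi t| <= c) ->
  line_mean (fun t => phi t + psi t) = line_mean phi + line_mean psi.
Proof.
move=> pb pc; apply: cvg_lim => //.
have -> : line_avg (fun t => phi t + psi t) = line_avg phi + line_avg psi.
  by apply/funext => n; rewrite /line_avg fctE/= -mulrDr -big_split.
by apply: cvgD; [exact: line_mean_cvg pb|exact: line_mean_cvg pc].
Qed.

Lemma line_meanZ k phi b : (forall t, `|phi t| <= b) ->
  line_mean (fun t => k * phi t) = k * line_mean phi.
Proof.
move=> pb; apply: cvg_lim => //.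
have -> : line_avg (fun t => k * phi t) = (fun n => k * line_avg phi n).
  by apply/funext => n; rewrite /line_avg -mulr_sumr mulrCA.
by apply: cvgM; [exact: cvg_cst|exact: line_mean_cvg pb].
Qed.

Lemma line_mean_norm phi b : (forall t, `|phi t| <= b) -> `|line_mean phi| <= 8 * b.
Proof.
move=> pb; have b0 : 0 <= b by exact: le_trans (pb 0).
have line_mean_const c : line_mean (fun=> c) = 8 * c.
  apply: cvg_lim => //; have -> : line_avg (fun=> c) = fun=> 8 * c.
    by apply/funext => n; rewrite line_avg_const.
  exact: cvg_cst.
rewrite ler_norml -mulrN -!line_mean_const.
by apply/andP; split; [apply: (@line_mean_le _ _ b b)|apply: (@line_mean_le _ _ b b)] => // t;
   rewrite ?normrN ?ger0_norm//; have := pb t; rewrite ler_norml => /andP[].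
Qed.

(* [phi] vanishes outside [-3, 3], so that a shift by at most 1 stays inside the sampling window. *)
Lemma line_mean_shift phi h : 0 <= h <= 1 ->
  (forall t, 3 <= `|t| -> phi t = 0) ->
  (forall eta, 0 < eta -> exists2 e : R, 0 < e &
     forall t t', `|t - t'| < e -> `|phi t - phi t'| <= eta) ->
  (exists b, forall t, `|phi t| <= b) ->
  line_mean (fun t => phi (t + h)) = line_mean phi.
Proof.
move=> /andP[h0 h1] sup uc [b pb].
have dif0 : (fun n => line_avg (fun t => phi (t + h)) n - line_avg phi n) @ free_ultrafilter --> 0.
  apply/cvgr0Pnorm_le => eta eta0.
  apply: free_ultrafilter_oo.
  have [e e0 he] := uc (eta / 8) (divr_gt0 eta0 (ltr0n _ 8)).
  exists (Num.trunc e^-1).+1 => // n /= nN.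
  have n0 : 0 < n.+1%:R :> R by rewrite ltr0n.
  have ne : n.+1%:R^-1 < e.
    rewrite -[e]invrK ltf_pV2 ?posrE ?invr_gt0//.
    apply: lt_trans (truncnS_gt _) _; rewrite ltr_nat ltnS; exact: nN.
  (* Replace the shift by the multiple [k / n.+1] of the mesh. This only reindexes the sum, since
     the terms at the two ends are sampled at most at -3 or at least at 4 and vanish; what remains
     of the shift is at most one mesh and is absorbed by uniform continuity. *)
  pose k := Num.trunc (h * n.+1%:R).
  have hn0 : 0 <= h * n.+1%:R by rewrite mulr_ge0.
  have k1 : k%:R <= h * n.+1%:R by rewrite truncn_le.
  have k2 : h * n.+1%:R < k%:R + 1 by rewrite natr1 truncnS_gt.
  have kn : (k <= n.+1)%N by rewrite -(ler_nat R) (le_trans k1)// ler_piMl.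
  have -> : line_avg phi n = n.+1%:R^-1 * \sum_(0 <= j < 8 * n.+1) phi ((j + k)%:R / n.+1%:R - 4).
    congr (_ * _).
    rewrite -(add0n k).
    transitivity (\sum_(0 + k <= j < 8 * n.+1 + k) phi (j%:R / n.+1%:R - 4)); last first.
      by rewrite big_addn addnK.
    rewrite add0n (@big_cat_nat _ _ _ k 0%N)/=; [|by []|lia].
    rewrite (@big_cat_nat _ _ _ (8 * n.+1)%N k (8 * n.+1 + k)%N)/=; [|lia|lia].
    rewrite [X in X + _]big_nat_cond [X in X + _]big1 ?add0r; last first.
      move=> j /andP[/andP[_ jk] _]; apply: sup.
      have jn : j%:R <= n.+1%:R :> R by rewrite ler_nat; lia.
      have : j%:R / n.+1%:R <= 1 :> R by rewrite ler_pdivrMr// mul1r.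
      by move: (_ / _) => x h2; rewrite ler0_norm; lra.
    rewrite [X in _ = _ + X]big_nat_cond [X in _ = _ + X]big1 ?addr0// => j /andP[/andP[jk _] _].
    apply: sup.
    have : 8 <= j%:R / n.+1%:R :> R by rewrite ler_pdivlMr// -natrM ler_nat.
    by move: (_ / _) => x h2; rewrite ger0_norm; lra.
  rewrite /line_avg -mulrBr normrM ger0_norm ?invr_ge0// -sumrB.
  rewrite mulrC ler_pdivrMr//; apply: le_trans (ler_norm_sum _ _ _) _.
  apply: (@le_trans _ _ (\sum_(0 <= j < 8 * n.+1) (eta / 8))); last first.
    by rewrite sumr_const_nat subn0 -[_ *+ _]mulr_natl natrM; lra.
  apply: ler_sum => j _; apply: he.
  have -> : j%:R / n.+1%:R - 4 + h - ((j + k)%:R / n.+1%:R - 4) = (h * n.+1%:R - k%:R) / n.+1%:R.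
    by rewrite natrD; field; rewrite addrC natr1 pnatr_eq0.
  rewrite normrM [X in _ * X]ger0_norm ?invr_ge0//; apply: le_lt_trans ne.
  by rewrite ler_piMl ?invr_ge0// ler_norml; apply/andP; split; lra.
have c1 := line_mean_cvg pb.
have c2 : line_avg (fun t => phi (t + h)) @ free_ultrafilter --> line_mean (fun t => phi (t + h)).
  by apply: (@line_mean_cvg _ b).
have e2 := cvg_lim (@Rhausdorff R) (cvgB c2 c1).
have e1 := cvg_lim (@Rhausdorff R) dif0.
by apply: subr0_eq; rewrite -e2 -[RHS]e1.
Qed.

Lemma line_mean_gt0 phi b c r : (forall t, `|phi t| <= b) -> (forall t, 0 <= phi t) ->
  0 <= c -> 0 < r <= 1 -> (forall t, `|t| <= r -> c <= phi t) -> c * r <= line_mean phi.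
Proof.
move=> pb p0 c0 /andP[r0 r1] pc; apply: limr_ge.
  by apply/cvg_ex; eexists; apply: line_mean_cvg pb.
apply: filterE => n; rewrite /line_avg.
have n0 : 0 < n.+1%:R :> R by rewrite ltr0n.
rewrite [leRHS]mulrC ler_pdivlMr//.
(* Only the half [0, r] of the interval is counted: it contains [k.+1 > r * n.+1] sample points,
   starting from the index [4 * n.+1] of the point 0. *)
pose k := Num.trunc (r * n.+1%:R).
have k1 : k%:R <= r * n.+1%:R by rewrite truncn_le mulr_ge0// ltW.
have k2 : r * n.+1%:R < k%:R + 1 by rewrite natr1 truncnS_gt.
have kn : (k <= n.+1)%N by rewrite -(ler_nat R) (le_trans k1)// ler_piMl.
rewrite (@big_cat_nat _ _ _ (4 * n.+1)%N 0%N)/=; [|by []|lia].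
rewrite (@big_cat_nat _ _ _ (4 * n.+1 + k.+1)%N (4 * n.+1)%N)/=; [|lia|lia].
rewrite -[leLHS]add0r lerD//; first by apply: sumr_ge0.
rewrite -[leLHS]addr0 lerD//; last by apply: sumr_ge0.
apply: (@le_trans _ _ (\sum_(4 * n.+1 <= j < 4 * n.+1 + k.+1) c)).
  rewrite sumr_const_nat addKn -[c *+ _]mulr_natr -mulrA ler_wpM2l//; rewrite -[k.+1%:R]natr1 ltW//.
apply: ler_sum_nat => j /andP[j1 j2].
apply: pc; have -> : j%:R / n.+1%:R - 4 = (j - 4 * n.+1)%:R / n.+1%:R :> R.
  by rewrite natrB// natrM; field; rewrite addrC natr1 pnatr_eq0.
rewrite ger0_norm ?divr_ge0// ler_pdivrMr//; apply: le_trans k1.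
rewrite ler_nat; lia.
Qed.

End LineAverage.

Section SpaceAverage.
Context {R : realType} {d : nat}.
Local Notation V := 'rV[R]_d.
Implicit Types (f g : V -> R) (x y a : V) (i j : 'I_d) (l : seq 'I_d) (b c r t h eta e k : R).

Fixpoint iter_mean l f : V -> R :=
  if l is i :: l' then fun x => line_mean (fun t => iter_mean l' f (x + t *: ebase i))
  else f.

Definition space_mean f : R := iter_mean (enum 'I_d) f 0.

Definition bounded_by b f : Prop := forall x, `|f x| <= b.

Lemma iter_mean_norm l f b : bounded_by b f -> bounded_by (8 ^+ size l * b) (iter_mean l f).
Proof.
move=> fb; elim: l => [|i l IH] x /=; first by rewrite expr0 mul1r.
by rewrite exprS -mulrA; apply: line_mean_norm => t; exact: IH.
Qed.

Lemma iter_mean_le l f g b c : bounded_by b f -> bounded_by c g ->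
  (forall x, f x <= g x) -> forall x, iter_mean l f x <= iter_mean l g x.
Proof.
move=> fb gc fg; elim: l => [|i l IH] x //=.
apply: (@line_mean_le _ _ _ (8 ^+ size l * b) (8 ^+ size l * c)) => t.
- exact: iter_mean_norm.
- exact: iter_mean_norm.
- exact: IH.
Qed.

Lemma iter_meanD l f g b c : bounded_by b f -> bounded_by c g ->
  forall x, iter_mean l (fun y => f y + g y) x = iter_mean l f x + iter_mean l g x.
Proof.
move=> fb gc; elim: l => [|i l IH] x //=.
rewrite -(@line_meanD _ _ _ (8 ^+ size l * b) (8 ^+ size l * c)).
- by congr line_mean; apply/funext => t; exact: IH.
- by move=> t; exact: iter_mean_norm.
- by move=> t; exact: iter_mean_norm.
Qed.

Lemma iter_meanZ l f b k : bounded_by b f ->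
  forall x, iter_mean l (fun y => k * f y) x = k * iter_mean l f x.
Proof.
move=> fb; elim: l => [|i l IH] x //=.
rewrite -(@line_meanZ _ _ _ (8 ^+ size l * b)).
- by congr line_mean; apply/funext => t; exact: IH.
- by move=> t; exact: iter_mean_norm.
Qed.

Lemma iter_mean_translate l f a x :
  iter_mean l (fun y => f (y + a)) x = iter_mean l f (x + a).
Proof.
elim: l x => [|i l IH] x //=; congr line_mean; apply/funext => t.
by rewrite IH addrAC.
Qed.

Lemma iter_mean_vanish l f j : j \notin l ->
  (forall y, 3 <= `|y ord0 j| -> f y = 0) ->
  forall x, 3 <= `|x ord0 j| -> iter_mean l f x = 0.
Proof.
move=> + f0; elim: l => [|i l IH] jl x xj /=; first exact: f0.
move: jl; rewrite inE negb_or => /andP[ji jl].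
have -> : (fun t => iter_mean l f (x + t *: ebase i)) = fun=> 0.
  apply/funext => t; apply: IH => //.
  by rewrite 3!mxE eqxx /= (negPf ji) mulr0 addr0.
have : `|line_mean (fun=> 0 : R)| <= 8 * 0 by apply: line_mean_norm => t; rewrite normr0.
by rewrite mulr0 normr_le0 => /eqP.
Qed.

Lemma iter_mean_unif l f b e eta : bounded_by b f ->
  (forall x y, enorm (x - y) < e -> `|f x - f y| <= eta) ->
  forall x y, enorm (x - y) < e -> `|iter_mean l f x - iter_mean l f y| <= 8 ^+ size l * eta.
Proof.
move=> fb uf; elim: l => [|i l IH] x y xy /=; first by rewrite expr0 mul1r uf.
have -> : line_mean (fun t => iter_mean l f (x + t *: ebase i)) -
   line_mean (fun t => iter_mean l f (y + t *: ebase i)) =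
   line_mean (fun t => iter_mean l f (x + t *: ebase i) + (-1) * iter_mean l f (y + t *: ebase i)).
  rewrite (@line_meanD _ _ _ (8 ^+ size l * b) (8 ^+ size l * b)).
  - by rewrite (@line_meanZ _ _ _ (8 ^+ size l * b)) ?mulN1r// => t; exact: iter_mean_norm.
  - by move=> t; exact: iter_mean_norm.
  - by move=> t; rewrite mulN1r normrN; exact: iter_mean_norm.
rewrite exprS -mulrA; apply: line_mean_norm => t; rewrite mulN1r; apply: IH.
by rewrite opprD addrACA subrr addr0.
Qed.

Definition unif_cont f : Prop := forall eta, 0 < eta ->
  exists2 e : R, 0 < e & forall x y, enorm (x - y) < e -> `|f x - f y| <= eta.

(** A shift along [i] passes unchanged through the layers of the other coordinates and is absorbed
    at the layer of [i], so the order of the means never has to be interchanged. The condition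
    [x ord0 i = 0] centres that layer, so that the function of [t] vanishes for [3 <= |t|]. *)
Lemma iter_mean_shift l f i h b : 0 <= h <= 1 -> bounded_by b f -> unif_cont f ->
  (forall y, 3 <= `|y ord0 i| -> f y = 0) -> uniq l -> i \in l ->
  forall x, x ord0 i = 0 ->
  iter_mean l (fun y => f (y + h *: ebase i)) x = iter_mean l f x.
Proof.
move=> h01 fb uf f0; elim: l => [|j l IH] //= /andP[jl ul]; rewrite inE.
have [ij|ij] := eqVneq i j; last first.
  move=> /= il x xi; congr line_mean; apply/funext => t; apply: IH => //.
  by rewrite 3!mxE eqxx /= (negPf ij) mulr0 addr0.
move=> _ x xi; rewrite -ij in jl *.
have -> : (fun t => iter_mean l (fun y => f (y + h *: ebase i)) (x + t *: ebase i)) =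
    (fun t => iter_mean l f (x + (t + h) *: ebase i)).
  by apply/funext => t; rewrite iter_mean_translate -addrA -scalerDl.
apply: (@line_mean_shift R (fun t => iter_mean l f (x + t *: ebase i))) => //.
- move=> t t3; apply: (iter_mean_vanish jl f0).
  by rewrite 3!mxE xi add0r !eqxx mulr1.
- move=> eta eta0.
  have p0 : 0 < 8 ^+ size l :> R by rewrite exprn_gt0.
  have [e e0 he] := uf (eta / 8 ^+ size l) (divr_gt0 eta0 p0).
  exists e => // t t' tt'.
  have -> : eta = 8 ^+ size l * (eta / 8 ^+ size l) by rewrite mulrC divfK ?gt_eqF.
  refine (@iter_mean_unif l f b e (eta / 8 ^+ size l) fb he _ _ _).
  by rewrite opprD addrACA subrr add0r -scalerBl enormZ enorm_ebase mulr1.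
- by exists (8 ^+ size l * b) => t; exact: iter_mean_norm.
Qed.

Lemma space_mean_le f g b c : bounded_by b f -> bounded_by c g ->
  (forall x, f x <= g x) -> space_mean f <= space_mean g.
Proof. by move=> fb gc fg; exact: (iter_mean_le _ fb gc fg). Qed.

Lemma space_meanD f g b c : bounded_by b f -> bounded_by c g ->
  space_mean (fun y => f y + g y) = space_mean f + space_mean g.
Proof. by move=> fb gc; exact: (iter_meanD _ fb gc). Qed.

Lemma space_meanZ f b k : bounded_by b f ->
  space_mean (fun y => k * f y) = k * space_mean f.
Proof. by move=> fb; exact: (iter_meanZ _ _ fb). Qed.

Lemma space_mean0 : space_mean (fun=> 0) = 0.
Proof.
have h : bounded_by 0 (fun _ : V => 0) by move=> x; rewrite normr0.
by have := space_meanZ 0 h; under eq_fun do rewrite mul0r; rewrite mul0r.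
Qed.

Lemma space_mean_norm f b : bounded_by b f -> `|space_mean f| <= 8 ^+ d * b.
Proof.
by move=> fb; have := @iter_mean_norm (enum 'I_d) _ _ fb 0; rewrite size_enum_ord.
Qed.

Lemma space_meanB f g b c : bounded_by b f -> bounded_by c g ->
  space_mean (fun y => f y - g y) = space_mean f - space_mean g.
Proof.
move=> fb gc; rewrite -mulN1r -(space_meanZ (-1) gc) -(space_meanD (b := b) (c := c))//.
  by congr space_mean; apply/funext => y; rewrite mulN1r.
by move=> y; rewrite mulN1r normrN.
Qed.

Lemma space_mean_sum n (f : 'I_n -> V -> R) b : (forall m, bounded_by b (f m)) ->
  space_mean (fun y => \sum_(m < n) f m y) = \sum_(m < n) space_mean (f m).
Proof.
elim: n f => [|n IH] f fb.
  by rewrite big_ord0 -[RHS]space_mean0; congr space_mean; apply/funext => y; rewrite big_ord0.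
rewrite big_ord_recl -IH//.
have [b0|b0] := leP 0 b; last first.
  by have := le_lt_trans (fb ord0 0) b0; rewrite normr_lt0.
rewrite -(space_meanD (b := b) (c := n%:R * b))//.
  by congr space_mean; apply/funext => y; rewrite big_ord_recl.
move=> y; apply: le_trans (ler_norm_sum _ _ _) _.
have -> : n%:R * b = \sum_(m < n) b by rewrite sumr_const card_ord mulr_natl.
by apply: ler_sum => m _; exact: fb.
Qed.

Lemma space_mean_shift f i h b : `|h| <= 1 -> bounded_by b f -> unif_cont f ->
  (forall y, 2 <= `|y ord0 i| -> f y = 0) ->
  space_mean (fun y => f (y + h *: ebase i)) = space_mean f.
Proof.
move=> h1 fb uf f0.
have f3 y : 3 <= `|y ord0 i| -> f y = 0.
  by move=> y3; apply: f0; apply: le_trans y3; lra.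
have [h0|h0] := leP 0 h.
  rewrite ger0_norm// in h1; apply: (iter_mean_shift _ fb) => //.
  - by rewrite h0 h1.
  - exact: enum_uniq.
  - by rewrite mem_enum.
  - by rewrite mxE.
rewrite ltr0_norm// in h1.
(* A negative shift of [f] is undone by a positive shift of [g]; the support of [f], within 2 in
   this coordinate, leaves the room for [g] to vanish from 3 on. *)
pose g y := f (y + h *: ebase i).
have fE : (fun y => g (y + (- h) *: ebase i)) = f.
  by apply/funext => y; rewrite /g -addrA -scalerDl addNr scale0r addr0.
rewrite -[in RHS]fE; apply/esym; change (space_mean (fun y => g (y + (- h) *: ebase i)) = space_mean g).
apply: (@iter_mean_shift _ g i (- h) b).
- by rewrite oppr_ge0 ltW//=.
- by move=> y; exact: fb.
- move=> eta eta0; have [e e0 he] := uf _ eta0; exists e => // x y xy; apply: he.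
  by rewrite opprD addrACA subrr addr0.
- move=> y y3; apply: f0; rewrite 3!mxE !eqxx mulr1.
  have := ler_normB (y ord0 i + h) h; rewrite addrK (ltr0_norm h0) => h2; lra.
- exact: enum_uniq.
- by rewrite mem_enum.
- by rewrite mxE.
Qed.

(** One coordinate at a time. The translations already made leave the coordinate now being shifted
    untouched, so the translated function still vanishes where that coordinate is large. *)
Lemma space_mean_translate f a b : enorm a <= 1 -> bounded_by b f -> unif_cont f ->
  (forall y, 1 <= enorm y -> f y = 0) ->
  space_mean (fun y => f (y + a)) = space_mean f.
Proof.
move=> a1 fb uf f0.
have aE : a = \sum_(i <- enum 'I_d) a ord0 i *: ebase i.
  rewrite big_enum /=; apply/rowP => j; rewrite summxE (bigD1 j)//= big1.
    by rewrite addr0 !mxE !eqxx mulr1.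
  by move=> i ij; rewrite !mxE eqxx /= eq_sym (negPf ij) mulr0.
rewrite aE; have := enum_uniq 'I_d; elim: (enum 'I_d) => [_|i l IH /= /andP[il ul]].
  by congr space_mean; apply/funext => y; rewrite big_nil addr0.
rewrite -[RHS]IH//.
under eq_fun => y do rewrite big_cons addrA.
apply: (@space_mean_shift (fun y => f (y + \sum_(j <- l) a ord0 j *: ebase j)) i _ b).
- exact: le_trans (coord_le_enorm _ _) a1.
- by move=> y; exact: fb.
- move=> eta eta0; have [e e0 he] := uf _ eta0; exists e => // x y xy; apply: he.
  by rewrite opprD addrACA subrr addr0.
- move=> y y2; apply: f0; apply: le_trans (coord_le_enorm _ i).
  rewrite mxE summxE big_seq big1 ?addr0; first by lra.
  move=> j jl; rewrite !mxE eqxx /=; case: eqP => [ij|]; last by rewrite mulr0.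
  by rewrite ij jl in il.
Qed.

Lemma iter_mean_gt0 l f b c r : bounded_by b f -> (forall x, 0 <= f x) ->
  0 <= c -> 0 < r <= 1 -> (forall x, (forall j, `|x ord0 j| <= r) -> c <= f x) -> uniq l ->
  forall x, (forall j, j \notin l -> `|x ord0 j| <= r) ->
   (forall j, j \in l -> x ord0 j = 0) -> c * r ^+ size l <= iter_mean l f x.
Proof.
move=> fb f0 c0 r01 fc; elim: l => [|i l IH] /= ul x xr x0.
  by rewrite expr0 mulr1; apply: fc => j; exact: xr.
have /andP[r0 r1] := r01; move: ul => /andP[il ul].
have l0 y : 0 <= iter_mean l f y.
  have [b0|b0] := leP 0 b; last by have := le_lt_trans (fb 0) b0; rewrite normr_lt0.
  have h : bounded_by b (fun _ : V => 0) by move=> z; rewrite normr0.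
  apply: le_trans (iter_mean_le l h fb f0 y).
  have h' : bounded_by 0 (fun _ : V => 0) by move=> z; rewrite normr0.
  have := iter_mean_norm l h' y; rewrite mulr0 normr_le0 => /eqP ->.
  exact: lexx.
rewrite exprSr mulrA; apply: (@line_mean_gt0 _ _ (8 ^+ size l * b)) => //.
- by move=> t; exact: iter_mean_norm.
- by rewrite mulr_ge0// exprn_ge0// ltW.
- move=> t tr; apply: IH => // j.
    move=> jl; rewrite 3!mxE eqxx /=; have [ji|ji] := eqVneq j i.
      by rewrite (x0 j) ?inE ?ji ?eqxx// add0r mulr1.
    by rewrite mulr0 addr0; apply: xr; rewrite inE negb_or ji.
  move=> jl; rewrite 3!mxE eqxx /=.
  have [ji|ji] := eqVneq j i; first by rewrite -ji jl in il.
  by rewrite mulr0 addr0; apply: x0; rewrite inE jl orbT.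
Qed.

Lemma space_mean_gt0 f b c r : bounded_by b f -> (forall x, 0 <= f x) ->
  0 <= c -> 0 < r <= 1 -> (forall x, (forall j, `|x ord0 j| <= r) -> c <= f x) ->
  c * r ^+ d <= space_mean f.
Proof.
move=> fb f0 c0 r01 fc; rewrite -[in r ^+ d](size_enum_ord d).
apply: (iter_mean_gt0 fb) => //; first exact: enum_uniq.
- by move=> j; rewrite mem_enum.
- by move=> j _; rewrite mxE.
Qed.

Lemma space_mean_ge0 f b : bounded_by b f -> (forall x, 0 <= f x) -> 0 <= space_mean f.
Proof.
move=> fb f0.
have h : bounded_by 0 (fun _ : V => 0) by move=> x; rewrite normr0.
by have := space_mean_le h fb f0; rewrite space_mean0.
Qed.

End SpaceAverage.

(** * Mean values of C2 functions *)

Section Calculus.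
Context {R : realType} {d : nat}.
Local Notation V := 'rV[R]_d.
Implicit Types (f phi : V -> R) (x y z w a kk : V) (i j : 'I_d) (b c r s t h eta e k rho m tau : R).

Lemma enorm_le_coord x y : (forall i, `|x ord0 i| <= `|y ord0 i|) -> enorm x <= enorm y.
Proof.
move=> xy; rewrite !enormE; apply: ler_wsqrtr; apply: ler_sum => i _.
rewrite -!expr2 -[x ord0 i ^+ 2]real_normK ?num_real//.
by rewrite -[y ord0 i ^+ 2]real_normK ?num_real// ler_pXn2r ?nnegrE.
Qed.

Lemma is_derive_line phi x v t l : is_derive (x + t *: v) v phi l ->
  is_derive t 1 (fun u : R => phi (x + u *: v)) l.
Proof.
move=> [dphi dl].
have E : (fun h : R => h^-1 *: (((fun u : R => phi (x + u *: v)) \o shift t) (h *: (1 : R)) -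
    phi (x + t *: v))) =
  (fun h => h^-1 *: ((phi \o shift (x + t *: v)) (h *: v) - phi (x + t *: v))).
  by apply/funext => h /=; rewrite [h *: _]mulr1 scalerDl addrCA.
split; first by rewrite /derivable E.
by rewrite -dl /derive E.
Qed.

Lemma ebase_mvt phi (phi' : V -> R) y i h :
  (forall s, `|s| <= `|h| -> is_derive (y + s *: ebase i) (ebase i) phi (phi' (y + s *: ebase i))) ->
  exists2 s : R, `|s| <= `|h| & phi (y + h *: ebase i) - phi y = h * phi' (y + s *: ebase i).
Proof.
move=> dphi; pose g (t : R) := phi (y + t *: ebase i).
have dg t : `|t| <= `|h| -> is_derive t 1 g (phi' (y + t *: ebase i)).
  by move=> th; apply: is_derive_line; exact: dphi.
have g0 : phi y = g 0 by rewrite /g scale0r addr0.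
rewrite g0 -/(g h); have [h0|h0] := leP 0 h.
  rewrite (ger0_norm h0) in dg.
  have [||s sh ->] := @MVT_segment _ g (fun t => phi' (y + t *: ebase i)) 0 h h0.
  - move=> t; rewrite in_itv /= => /andP[t0 t1]; apply: dg.
    by rewrite ger0_norm// ltW.
  - apply: derivable_within_continuous => t; rewrite in_itv /= => /andP[t0 t1].
    by have [] := dg t _ => //; rewrite ger0_norm// ltW.
  exists s; last by rewrite subr0 mulrC.
  by move: sh; rewrite in_itv /= => /andP[t0 t1]; rewrite (ger0_norm h0) ger0_norm.
rewrite (ltr0_norm h0) in dg *.
have [||s sh E] := @MVT_segment _ g (fun t => phi' (y + t *: ebase i)) h 0 (ltW h0).
- move=> t; rewrite in_itv /= => /andP[t0 t1]; apply: dg.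
  by rewrite ltr0_norm// lerN2 ltW.
- apply: derivable_within_continuous => t; rewrite in_itv /= => /andP[t0 t1].
  by have [] := dg t _ => //; rewrite ler0_norm// lerN2.
exists s; last by rewrite -opprB E; ring.
by move: sh; rewrite in_itv /= => /andP[t0 t1]; rewrite ler0_norm// lerN2.
Qed.

(** Add the coordinates of [kk] one by one and use the one-dimensional mean value theorem for each.
    Every intermediate increment is dominated by [kk] coordinatewise, hence stays in the ball where
    the partial derivatives vary by at most [eta]. *)
Lemma first_order f (f1 : 'I_d -> V -> R) y kk eta : 0 <= eta ->
  (forall y' i, enorm (y' - y) <= enorm (kk : V) ->
     is_derive y' (ebase i) f (f1 i y') /\ `|f1 i y' - f1 i y| <= eta) ->
  `|f (y + kk) - f y - \sum_(i < d) kk ord0 i * f1 i y| <= eta * (d%:R * enorm kk).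
Proof.
move=> eta0 H.
have kE : kk = \sum_(i <- enum 'I_d) kk ord0 i *: ebase i.
  rewrite big_enum /=; apply/rowP => j; rewrite summxE (bigD1 j)//= big1.
    by rewrite addr0 !mxE !eqxx mulr1.
  by move=> i ij; rewrite !mxE eqxx /= eq_sym (negPf ij) mulr0.
suff : forall l : seq 'I_d, uniq l ->
   `|f (y + \sum_(i <- l) kk ord0 i *: ebase i) - f y - \sum_(i <- l) kk ord0 i * f1 i y|
     <= eta * ((size l)%:R * enorm kk).
  move=> /(_ _ (enum_uniq 'I_d)); rewrite -kE size_enum_ord.
  by rewrite [X in _ - X]big_enum.
elim=> [_|i l IH /= /andP[il ul]].
  by rewrite !big_nil addr0 subrr subr0 normr0 mul0r mulr0.
set yl := y + \sum_(j <- l) kk ord0 j *: ebase j in IH *.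
have near s : `|s| <= `|kk ord0 i| -> enorm (yl + s *: ebase i - y) <= enorm kk.
  move=> sk; apply: enorm_le_coord => j.
  rewrite /yl addrC addrA addKr mxE summxE !mxE eqxx /=.
  have [ji|ji] := eqVneq j i.
    rewrite big_seq big1; first by rewrite add0r mulr1 ji.
    move=> j' j'l; rewrite !mxE eqxx /=; have -> : (j == j') = false.
      by apply/negP => /eqP jj'; move: il; rewrite -ji jj' j'l.
    by rewrite mulr0.
  rewrite mulr0 addr0.
  have [jl|jl] := boolP (j \in l).
    rewrite (bigD1_seq j)//= big1 ?addr0; first by rewrite !mxE !eqxx mulr1.
    by move=> j' j'j; rewrite !mxE eqxx /= eq_sym (negPf j'j) mulr0.
  rewrite big_seq big1 ?normr0// => j' j'l.
  rewrite !mxE eqxx /=; have -> : (j == j') = false.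
    by apply/negP => /eqP jj'; move: jl; rewrite jj' j'l.
  by rewrite mulr0.
have [s sk E] := @ebase_mvt f (f1 i) yl i (kk ord0 i)
  (fun s sk => (H _ i (near s sk)).1).
have -> : y + \sum_(j <- i :: l) kk ord0 j *: ebase j = yl + kk ord0 i *: ebase i.
  by rewrite big_cons /yl -addrA [_ *: ebase i + _]addrC.
rewrite big_cons.
have -> : f (yl + kk ord0 i *: ebase i) - f y - (kk ord0 i * f1 i y + \sum_(j <- l) kk ord0 j * f1 j y)
  = (f yl - f y - \sum_(j <- l) kk ord0 j * f1 j y) + kk ord0 i * (f1 i (yl + s *: ebase i) - f1 i y).
  by rewrite mulrBr -E; ring.
apply: le_trans (ler_normD _ _) _.
rewrite -natr1 mulrDl mulrDr lerD ?IH// mul1r normrM mulrC ler_pM//.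
  exact: (H _ i (near s sk)).2.
exact: coord_le_enorm.
Qed.

Definition hump s w : R := Num.max 0 (s ^+ 2 - dot w w).

Lemma hump_ge0 s w : 0 <= hump s w.
Proof. by rewrite le_max lexx. Qed.

Lemma hump_le s w : hump s w <= s ^+ 2.
Proof. by rewrite ge_max sqr_ge0 gerBl dotxx_ge0. Qed.

Lemma hump_out s w : 0 <= s -> s <= enorm w -> hump s w = 0.
Proof.
move=> s0 sw; rewrite /hump max_l// subr_le0 -sqr_enorm.
by apply: lerXn2r => //; exact: enorm_ge0.
Qed.

Lemma enorm_shift w i h : enorm w - `|h| <= enorm (w + h *: ebase i) <= enorm w + `|h|.
Proof.
have e : enorm (h *: (ebase i : V)) = `|h| by rewrite enormZ enorm_ebase mulr1.
rewrite -e enormD andbT -[X in _ <= enorm X]opprK enormN.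
rewrite -{1}[w](addrK (h *: ebase i)) lerBlDr.
by apply: le_trans (enormD _ _) _; rewrite !enormN.
Qed.

Lemma hump_lip s w a : enorm w <= 2 -> enorm a <= 2 ->
  `|hump s w - hump s a| <= 4 * enorm (w - a).
Proof.
move=> w2 a2.
have E : dot w w - dot a a = dot (w - a) (w + a).
  by rewrite dotBl !dotDr (dotC a w); ring.
have : `|dot w w - dot a a| <= 4 * enorm (w - a).
  rewrite E mulrC; apply: le_trans (cauchy_schwarz _ _) _.
  rewrite ler_wpM2l//; apply: le_trans (enormD _ _) _; lra.
move=> H; apply: le_trans H; rewrite /hump !maxEle.
case: ifP => h1; case: ifP => h2; rewrite ?subr0 ?sub0r ?normrN.
- have -> : s ^+ 2 - dot w w - (s ^+ 2 - dot a a) = - (dot w w - dot a a) by ring.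
  by rewrite normrN.
- move/negbT: h2; rewrite -ltNge => h2.
  rewrite ger0_norm// ler_normr; lra.
- move/negbT: h1; rewrite -ltNge => h1.
  rewrite ger0_norm// ler_normr; lra.
- by rewrite normr0.
Qed.

(** The primitive that makes integration by parts work: its derivative in the direction [i] is
    [- w_i * hump s w], also across the sphere where [hump] has a kink. *)
Definition hump2 s w : R := hump s w ^+ 2 / 4.

Lemma hump2_ge0 s w : 0 <= hump2 s w.
Proof. by rewrite divr_ge0// sqr_ge0. Qed.

Lemma hump2_expand s w i h : s <= 1 -> 0 <= s -> enorm w <= 5 / 4 -> `|h| <= 4^-1 ->
  `|hump2 s (w + h *: ebase i) - hump2 s w + h * (w ord0 i * hump s w)| <= 3 * h ^+ 2.
Proof.
move=> s1 s0 w54 h4.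
(* Taylor bound for the squared positive part, a C1 function whose derivative is 2-Lipschitz. *)
have sq (p q : R) : `|Num.max 0 q ^+ 2 - Num.max 0 p ^+ 2 - 2 * Num.max 0 p * (q - p)|
    <= (q - p) ^+ 2.
  rewrite ler_norml; have [q0|q0] := leP q 0; have [p0|p0] := leP p 0;
    have h1 := sqr_ge0 (q - p); have h2 := sqr_ge0 q; have h3 := sqr_ge0 p;
    apply/andP; split; try by lra.
  - by have h5 : 0 <= p * - q by [rewrite mulr_ge0 ?oppr_ge0// ltW]; lra.
  - by have h5 : 0 <= q * - p by [rewrite mulr_ge0 ?oppr_ge0// ltW]; lra.
have wi := coord_le_enorm w i.
have b1 : hump s w <= 1 by apply: le_trans (hump_le _ _) _; rewrite exprn_ile1.
have b0 := hump_ge0 s w.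
have := sq (s ^+ 2 - dot w w) (s ^+ 2 - dot (w + h *: ebase i) (w + h *: ebase i)).
rewrite -/(hump s w) -/(hump s (w + h *: ebase i)) /hump2.
have -> : s ^+ 2 - dot (w + h *: ebase i) (w + h *: ebase i) - (s ^+ 2 - dot w w)
   = - (2 * h * w ord0 i + h ^+ 2).
  rewrite dotDl !dotDr !dotZl !dotZr (dotC (ebase i) w) !dot_ebase ebaseE eqxx.
  by rewrite mulr1; ring.
move: (hump s _) (hump s w) (w ord0 i) (enorm w) b0 b1 wi w54 => q p c e p0 p1 ce e54 H.
have ch : `|c * h| <= 5 / 4 * `|h|.
  by rewrite normrM ler_wpM2r// (le_trans ce).
have h2 : `|h| ^+ 2 = h ^+ 2 by rewrite real_normK ?num_real.
have hh : 0 <= `|h| by [].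
have hx : 0 <= h ^+ 2 by exact: sqr_ge0.
have ch2 : (c * h) ^+ 2 <= 25 / 16 * h ^+ 2.
  rewrite -h2 -[(c * h) ^+ 2]real_normK ?num_real//.
  have -> : 25 / 16 * `|h| ^+ 2 = (5 / 4 * `|h|) ^+ 2 by field.
  by rewrite ler_pXn2r ?nnegrE ?mulr_ge0//; lra.
have ch5 : `|c * h| <= 5 / 16 by lra.
have k1 : h ^+ 2 * (c * h) <= h ^+ 2 * (5 / 16).
  by rewrite ler_wpM2l// (le_trans (ler_norm _)).
have k1' : h ^+ 2 * (- (c * h)) <= h ^+ 2 * (5 / 16).
  by rewrite ler_wpM2l// (le_trans (ler_norm _))// normrN.
have k2 : h ^+ 2 * h ^+ 2 <= h ^+ 2 * (1 / 16).
  rewrite ler_wpM2l// -h2; have -> : 1 / 16 = 4^-1 ^+ 2 :> R by field.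
  by rewrite ler_pXn2r ?nnegrE//; lra.
have k3 : h ^+ 2 * p <= h ^+ 2 * 1 by rewrite ler_wpM2l.
have k4 : 0 <= h ^+ 2 * p by rewrite mulr_ge0.
move: H; rewrite !ler_norml => /andP[H1 H2]; apply/andP; split; lra.
Qed.

End Calculus.

Section MeanValue.
Context {R : realType} {d : nat}.
Local Notation V := 'rV[R]_d.
Implicit Types (f phi chi : V -> R) (x y z w a : V) (i j : 'I_d) (b c r s t h eta e k rho m tau : R).

Lemma cutoff_bounded chi phi b : (forall w, `|chi w| <= 1) ->
  (forall w, 1 <= enorm w -> chi w = 0) -> 0 <= b ->
  (forall w, enorm w <= 5 / 4 -> `|phi w| <= b) -> bounded_by b (fun w => chi w * phi w).
Proof.
move=> c1 c0 b0 pb w; have [w1|w1] := leP 1 (enorm w).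
  by rewrite c0// mul0r normr0.
rewrite normrM -[b]mul1r ler_pM//; apply: pb; lra.
Qed.

Lemma cutoff_unif_cont chi phi b c : (forall w, `|chi w| <= 1) ->
  (forall w, 1 <= enorm w -> chi w = 0) -> 0 < c -> 0 < b ->
  (forall w a, enorm w <= 2 -> enorm a <= 2 -> `|chi w - chi a| <= c * enorm (w - a)) ->
  (forall w, enorm w <= 5 / 4 -> `|phi w| <= b) ->
  (forall eta, 0 < eta -> exists2 e : R, 0 < e & forall w a, enorm w <= 5 / 4 ->
     enorm a <= 5 / 4 -> enorm (w - a) < e -> `|phi w - phi a| <= eta) ->
  unif_cont (fun w => chi w * phi w).
Proof.
move=> c1 c0 cp bp cl pb pu eta eta0.
have [e e0 he] := pu (eta / 2) (divr_gt0 eta0 (ltr0n _ 2)).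
exists (Num.min (1 / 4) (Num.min e (eta / (2 * c * b)))).
  rewrite !lt_min e0 /=; apply/andP; split; first by lra.
  by rewrite divr_gt0 ?mulr_gt0.
move=> w a; rewrite !lt_min => /andP[wa1 /andP[wa2 wa3]].
have wl := le_enormB w a; have := le_enormB a w; rewrite enormB => al.
have [w1|w1] := leP 1 (enorm w); have [a1|a1] := leP 1 (enorm a).
- by rewrite !c0// !mul0r subrr normr0 ltW.
- rewrite (c0 w)// mul0r sub0r normrN.
  have -> : chi a * phi a = (chi a - chi w) * phi a by rewrite (c0 w)// subr0.
  rewrite normrM; apply: (@le_trans _ _ (c * enorm (a - w) * b)).
    rewrite ler_pM//; last by apply: pb; lra.
    by apply: cl; lra.
  rewrite ltr_pdivlMr ?mulr_gt0// in wa3; rewrite enormB.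
  move: wa3; have := enorm_ge0 (w - a); nra.
- rewrite (c0 a)// mul0r subr0.
  have -> : chi w * phi w = (chi w - chi a) * phi w by rewrite (c0 a)// subr0.
  rewrite normrM; apply: (@le_trans _ _ (c * enorm (w - a) * b)).
    rewrite ler_pM//; last by apply: pb; lra.
    by apply: cl; lra.
  rewrite ltr_pdivlMr ?mulr_gt0// in wa3.
  move: wa3; have := enorm_ge0 (w - a); nra.
have -> : chi w * phi w - chi a * phi a = (chi w - chi a) * phi w + chi a * (phi w - phi a) by ring.
apply: le_trans (ler_normD _ _) _; rewrite !normrM [eta]splitr; apply: lerD.
  apply: (@le_trans _ _ (c * enorm (w - a) * b)).
    rewrite ler_pM//; last by apply: pb; lra.
    by apply: cl; lra.
  rewrite ltr_pdivlMr ?mulr_gt0// in wa3; rewrite ler_pdivlMr//.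
  by apply: le_trans (ltW wa3); rewrite le_eqVlt; apply/orP; left; apply/eqP; ring.
rewrite -[eta / 2]mul1r ler_pM//; apply: he => //; lra.
Qed.

(** A form of [G' <= 0] in terms of increments: on a partition finer than [tau] the increments add
    up to at most [eta * rho], and [eta] is arbitrary. *)
Lemma small_growth (G : R -> R) rho : 0 < rho ->
  (forall eta, 0 < eta -> exists2 tau : R, 0 < tau &
    forall t t', 0 <= t -> t <= t' -> t' <= rho -> t' - t < tau -> G t' - G t <= eta * (t' - t)) ->
  G rho <= G 0.
Proof.
move=> rho0 H; apply/ler_addgt0Pr => eta eta0.
have [tau tau0 ht] := H (eta / rho) (divr_gt0 eta0 rho0).
pose n := (Num.trunc (rho / tau)).+1.
have n0 : 0 < n%:R :> R by rewrite ltr0n.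
have nt : rho / n%:R < tau.
  rewrite ltr_pdivrMr// mulrC -ltr_pdivrMr//; exact: truncnS_gt.
set q := rho / n%:R in nt.
have nq : n%:R * q = rho by rewrite mulrC divfK// gt_eqF.
have q0 : 0 <= q by rewrite divr_ge0// ltW.
have step (j : nat) : (j <= n)%N -> G (j%:R * q) - G 0 <= eta / rho * (j%:R * q).
  elim: j => [_|j IH jn]; first by rewrite !mul0r subrr mulr0.
  have e1 : j.+1%:R * q = j%:R * q + q by rewrite -natr1 mulrDl mul1r.
  have jr : j.+1%:R * q <= rho by rewrite -nq ler_wpM2r// ler_nat.
  have := IH (ltnW jn).
  have := ht (j%:R * q) (j.+1%:R * q).
  rewrite mulr_ge0// {1 3 5}e1 lerDl q0 jr addrAC subrr add0r nt => /(_ isT isT isT isT).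
  by rewrite e1 mulrDr; lra.
have := step n (leqnn n).
rewrite nq.
by rewrite divfK ?gt_eqF//; lra.
Qed.

End MeanValue.

Section MeanValueInequality.
Context {R : realType} {d : nat}.
Local Notation V := 'rV[R]_d.
Implicit Types (phi chi : V -> R) (x y z w a : V) (i j : 'I_d) (b c s t h eta e k m tau : R).

(** The derivatives are named functions, so that harmonic functions and explicit barriers fit the
    same mean value inequality; only the pure second derivatives enter the Laplacian. *)
Definition C2_with (S : set V) (f : V -> R) (f1 f2 : 'I_d -> V -> R) : Prop :=
  forall y, S y -> {for y, continuous f} /\ forall i,
    [/\ {for y, continuous (f1 i)}, {for y, continuous (f2 i)},
        is_derive y (ebase i) f (f1 i y) & is_derive y (ebase i) (f1 i) (f2 i y)].

Lemma hump_norm s w : 0 <= s <= 1 -> `|hump s w| <= 1.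
Proof.
move=> /andP[s0 s1]; rewrite ger0_norm ?hump_ge0//.
by apply: le_trans (hump_le _ _) _; rewrite exprn_ile1.
Qed.

Lemma hump2_norm s w : 0 <= s <= 1 -> `|hump2 s w| <= 1.
Proof.
move=> s01; have := hump_norm w s01; rewrite /hump2 !ger0_norm ?hump_ge0//; last first.
  by rewrite divr_ge0// sqr_ge0.
by have := hump_ge0 s w; nra.
Qed.

Lemma hump_out1 s w : 0 <= s <= 1 -> 1 <= enorm w -> hump s w = 0.
Proof. by move=> /andP[s0 s1] w1; apply: hump_out => //; exact: le_trans w1. Qed.

Lemma hump2_out1 s w : 0 <= s <= 1 -> 1 <= enorm w -> hump2 s w = 0.
Proof. by move=> s01 w1; rewrite /hump2 hump_out1// expr0n mul0r. Qed.

Lemma hump2_lip s w a : 0 <= s <= 1 -> enorm w <= 2 -> enorm a <= 2 ->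
  `|hump2 s w - hump2 s a| <= 4 * enorm (w - a).
Proof.
move=> s01 w2 a2; have := hump_lip s w2 a2; have := hump_norm w s01; have := hump_norm a s01.
have -> : hump2 s w - hump2 s a = (hump s w - hump s a) * ((hump s w + hump s a) / 4).
  by rewrite /hump2; field.
rewrite !(ger0_norm (hump_ge0 _ _)) normrM => p q; apply: le_trans; rewrite ler_piMr//.
by rewrite ger0_norm ?divr_ge0 ?addr_ge0 ?hump_ge0//; lra.
Qed.

Lemma hump_unif_cont s : 0 <= s <= 1 -> unif_cont (hump s : V -> R).
Proof.
move=> s01 eta eta0.
have /(_ _ eta0)[e e0 he] : unif_cont (fun w : V => hump s w * 1 : R).
  apply: (@cutoff_unif_cont _ _ _ _ 1 4).
  - by move=> w; exact: hump_norm.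
  - by move=> w; exact: hump_out1.
  - by lra.
  - by lra.
  - by move=> w a; exact: hump_lip.
  - by move=> w _; rewrite normr1.
  - by move=> et et0; exists 1 => // w a _ _ _; rewrite subrr normr0 ltW.
by exists e => // x y xy; have := he _ _ xy; rewrite !mulr1.
Qed.

Lemma common_pos (P : 'I_d -> R -> Prop) :
  (forall i e e', e' <= e -> P i e -> P i e') -> (forall i, exists2 e : R, 0 < e & P i e) ->
  exists2 e : R, 0 < e & forall i, P i e.
Proof.
move=> Pm /(_ _)/cid2 Pe; pose E i := sval (Pe i).
have E0 i : 0 < E i by rewrite /E; case: (Pe i).
have EP i : P i (E i) by rewrite /E; case: (Pe i).
have s0 : 0 <= \sum_(i < d) (E i)^-1 by apply: sumr_ge0 => i _; rewrite invr_ge0 ltW.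
exists (1 + \sum_(i < d) (E i)^-1)^-1; first by rewrite invr_gt0 ltr_wpDr.
move=> i; apply: Pm (EP i).
rewrite -[E i]invrK lef_pV2 ?posrE ?invr_gt0 ?ltr_wpDr//.
rewrite (bigD1 i)//= addrCA lerDl addr_ge0//.
by apply: sumr_ge0 => j _; rewrite invr_ge0 ltW.
Qed.

Variables (f : V -> R) (f1 f2 : 'I_d -> V -> R) (z : V) (rho s : R).
Hypotheses (rho0 : 0 < rho) (s01 : 0 <= s <= 1).
Hypothesis C2f : C2_with (cball z (2 * rho)) f f1 f2.

Let pt_in t w : 0 <= t <= rho -> enorm w <= 3 / 2 -> cball z (3 / 2 * rho) (z + t *: w).
Proof.
move=> /andP[t0 tr] w1; rewrite /cball /= addrAC subrr add0r enormZ ger0_norm//.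
by rewrite mulrC ler_pM.
Qed.

Let sub_ball y : cball z (3 / 2 * rho) y -> cball z (2 * rho) y.
Proof. by rewrite /cball /= => h; apply: le_trans h _; rewrite ler_pM2r//; lra. Qed.

Lemma bound_fun phi : (forall y, cball z (2 * rho) y -> {for y, continuous phi}) ->
  exists2 b : R, 0 < b & forall t w, 0 <= t <= rho -> enorm w <= 3 / 2 -> `|phi (z + t *: w)| <= b.
Proof.
move=> cphi; have [b b0 hb] := compact_bounded_fun (@cball_compact _ _ z (2 * rho)) cphi.
by exists b => // t w t01 w1; apply: hb; apply: sub_ball; exact: pt_in.
Qed.

Lemma unif_fun phi : (forall y, cball z (2 * rho) y -> {for y, continuous phi}) ->
  forall eta, 0 < eta -> exists2 e : R, 0 < e &
    forall y y', cball z (2 * rho) y -> enorm (y' - y) < e -> `|phi y' - phi y| <= eta.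
Proof.
move=> cphi eta eta0.
have [e e0 he] := compact_unif_continuous (@cball_compact _ _ z (2 * rho)) cphi eta0.
by exists e => // y y' yB yy'; apply/ltW/he.
Qed.

Let cf : forall y, cball z (2 * rho) y -> {for y, continuous f}.
Proof. by move=> y /C2f[]. Qed.
Let cf1 i : forall y, cball z (2 * rho) y -> {for y, continuous (f1 i)}.
Proof. by move=> y /C2f[_ /(_ i)[]]. Qed.
Let cf2 i : forall y, cball z (2 * rho) y -> {for y, continuous (f2 i)}.
Proof. by move=> y /C2f[_ /(_ i)[]]. Qed.

Lemma cut_bound chi phi : (forall y, cball z (2 * rho) y -> {for y, continuous phi}) ->
  (forall w, `|chi w| <= 1) -> (forall w, 1 <= enorm w -> chi w = 0) ->
  exists b, forall t, 0 <= t <= rho -> bounded_by b (fun w => chi w * phi (z + t *: w)).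
Proof.
move=> cphi c1 c0; have [b b0 hb] := bound_fun cphi.
exists b => t t01; apply: cutoff_bounded => //; first exact: ltW.
by move=> w w1; apply: hb => //; lra.
Qed.

Lemma cut_unif chi phi t : 0 <= t <= rho ->
  (forall y, cball z (2 * rho) y -> {for y, continuous phi}) ->
  (forall w, `|chi w| <= 1) -> (forall w, 1 <= enorm w -> chi w = 0) ->
  (forall w a, enorm w <= 2 -> enorm a <= 2 -> `|chi w - chi a| <= 4 * enorm (w - a)) ->
  unif_cont (fun w => chi w * phi (z + t *: w)).
Proof.
move=> t01 cphi c1 c0 cl; have [b b0 hb] := bound_fun cphi.
apply: (cutoff_unif_cont (b := b) (c := 4)) => //.
  by move=> w w1; apply: hb => //; lra.
move=> eta eta0; have [e e0 he] := unif_fun cphi eta0.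
exists (e / rho); first by rewrite divr_gt0.
move=> w a w1 a1; rewrite ltr_pdivlMr// => wa; apply: he.
  by apply: sub_ball; apply: pt_in => //; lra.
rewrite opprD addrACA subrr add0r -scalerBr enormZ; apply: le_lt_trans wa.
by move: t01 => /andP[t0 t1]; rewrite mulrC ler_wpM2l// ger0_norm.
Qed.

Let chi1 i w : R := w ord0 i * hump s w.

Let chi1_norm i w : `|chi1 i w| <= 1.
Proof.
have [w1|w1] := leP 1 (enorm w).
  by rewrite /chi1 hump_out1// mulr0 normr0.
rewrite normrM -[1]mulr1 ler_pM//; last exact: hump_norm.
exact: le_trans (coord_le_enorm _ _) (ltW w1).
Qed.

Let chi1_out i w : 1 <= enorm w -> chi1 i w = 0.
Proof. by move=> w1; rewrite /chi1 hump_out1// mulr0. Qed.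

(** Integration by parts from translation invariance alone: for [G = hump2 * f1 i] the increment
    [G (w + h e_i) - G w] has mean 0, and divided by [h] it is uniformly close to
    [t hump2 f2 - w_i hump f1], whose mean therefore vanishes. *)
Lemma by_parts i t : 0 <= t <= rho ->
  space_mean (fun w => w ord0 i * hump s w * f1 i (z + t *: w)) =
  t * space_mean (fun w => hump2 s w * f2 i (z + t *: w)).
Proof.
move=> t01; have /andP[t0 tr] := t01.
pose G w := hump2 s w * f1 i (z + t *: w).
have [bA hA] := cut_bound (@cf1 i) (chi1_norm i) (@chi1_out i).
have [bB hB] := cut_bound (@cf2 i) (fun w => hump2_norm w s01) (fun w => hump2_out1 s01 (w := w)).
have [bG hG] := cut_bound (@cf1 i) (fun w => hump2_norm w s01) (fun w => hump2_out1 s01 (w := w)).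
have {}hA := hA t t01; have {}hB := hB t t01; have {}hG := hG t t01.
have uG : unif_cont G.
  apply: cut_unif => //.
  - exact: cf1.
  - by move=> w; exact: hump2_norm.
  - by move=> w; exact: hump2_out1.
  - by move=> w a; exact: hump2_lip.
have [b b0 hb] := bound_fun (@cf1 i).
pose D w := t * (hump2 s w * f2 i (z + t *: w)) + (-1) * (chi1 i w * f1 i (z + t *: w)).
have hB' : bounded_by (t * bB) (fun w => t * (hump2 s w * f2 i (z + t *: w))).
  by move=> w; rewrite normrM (ger0_norm t0) ler_wpM2l.
have hA' : bounded_by bA (fun w => (-1) * (chi1 i w * f1 i (z + t *: w))).
  by move=> w; rewrite mulN1r normrN.
have hD : bounded_by (t * bB + bA) D.
  by move=> w; apply: le_trans (ler_normD _ _) _; exact: lerD (hB' w) (hA' w).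
suff : space_mean D = 0.
  rewrite /D (space_meanD hB' hA') (space_meanZ _ hB) (space_meanZ _ hA) mulN1r.
  by move/subr0_eq.
apply/eqP; rewrite -normr_le0; apply/ler_addgt0Pr => eta' eta'0; rewrite add0r.
(* The error per unit of [h] is [eta * 3 b] from the second-order remainder of [hump2], [eta] from
   the variation of [f1 i] and [eta * rho] from that of [f2 i]; [8 ^+ d] is the mass of the mean. *)
pose eta := eta' / (8 ^+ d * (3 * b + 1 + rho)).
have cpos : 0 < 8 ^+ d * (3 * b + 1 + rho) by rewrite mulr_gt0 ?exprn_gt0// !addr_gt0 ?mulr_gt0.
have eta0 : 0 < eta by rewrite divr_gt0.
have [e1 e10 he1] := unif_fun (@cf1 i) eta0.
have [e2 e20 he2] := unif_fun (@cf2 i) eta0.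
have [h [h0 h4 hr1 hr2 heta]] : exists h, [/\ 0 < h, h <= 4^-1, h * rho < e1, h * rho < e2 & h <= eta].
  exists (Num.min 4^-1 (Num.min (e1 / 2 / rho) (Num.min (e2 / 2 / rho) eta))).
  set h := Num.min _ _.
  have : h <= h by []. rewrite {2}/h !le_min => /and4P[q1 q2 q3 q4].
  rewrite ler_pdivlMr// in q2; rewrite ler_pdivlMr// in q3.
  split=> //; [|lra|lra].
  by rewrite !lt_min eta0 !divr_gt0//= invr_gt0 ltr0n.
have GG : space_mean (fun w => G (w + h *: ebase i)) = space_mean G.
  apply: (@space_mean_shift _ _ _ _ _ bG) => //.
    by rewrite gtr0_norm//; lra.
  move=> y y2; rewrite /G hump2_out1 ?mul0r//.
  by apply: le_trans (coord_le_enorm _ i); lra.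
have hGs : bounded_by bG (fun w => G (w + h *: ebase i)) by move=> w; exact: hG.
have hE : bounded_by (h * (eta * (3 * b + 1 + rho))) (fun w => (G (w + h *: ebase i) - G w) - h * D w).
  move=> w; have [w54|w54] := leP (5 / 4) (enorm w).
    have := enorm_shift w i h; rewrite (gtr0_norm h0) => /andP[w1 w2].
    rewrite /G /D !hump2_out1//; [|lra|lra].
    rewrite chi1_out; last by lra.
    rewrite !(mul0r, mulr0, subr0, addr0) normr0 mulr_ge0 ?(ltW h0)// mulr_ge0 ?(ltW eta0)//.
    by move: b0 rho0; lra.
  have := enorm_shift w i h; rewrite (gtr0_norm h0) => /andP[w1 w2].
  have wB : cball z (3 / 2 * rho) (z + t *: w) by apply: pt_in => //; lra.
  have wsE : z + t *: (w + h *: ebase i) = (z + t *: w) + (t * h) *: ebase i.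
    by rewrite scalerDr scalerA addrA.
  have th0 : 0 <= t * h by rewrite mulr_ge0// ltW.
  have thr : t * h <= h * rho by rewrite mulrC ler_wpM2l// ltW.
  have inB u : `|u| <= `|t * h| -> enorm (z + t *: w + u *: ebase i - (z + t *: w)) <= h * rho.
    move=> uth; rewrite addrAC subrr add0r enormZ enorm_ebase mulr1.
    by apply: le_trans uth _; rewrite ger0_norm.
  have inB2 u : `|u| <= `|t * h| -> cball z (2 * rho) (z + t *: w + u *: ebase i).
    move=> uth; rewrite /cball /=.
    apply: le_trans (enorm_triB _ (z + t *: w) _) _.
    apply: le_trans (lerD (inB _ uth) wB) _.
    have : h * rho <= 4^-1 * rho by rewrite ler_wpM2r// ltW.
    by move: rho0; lra.
  have [u uth E] := @ebase_mvt _ _ (f1 i) (f2 i) (z + t *: w) i (t * h)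
    (fun u uth => let: conj _ H := C2f (inB2 u uth) in let: And4 _ _ _ H' := H i in H').
  have F1 : `|f1 i (z + t *: (w + h *: ebase i)) - f1 i (z + t *: w)| <= eta.
    apply: he1; first exact: sub_ball.
    by rewrite wsE; apply: le_lt_trans (inB _ (lexx _)) hr1.
  have F2 : `|f2 i (z + t *: w + u *: ebase i) - f2 i (z + t *: w)| <= eta.
    apply: he2; first exact: sub_ball.
    by apply: le_lt_trans (inB _ uth) hr2.
  have bex : `|hump2 s (w + h *: ebase i) - hump2 s w + h * (w ord0 i * hump s w)| <= 3 * h ^+ 2.
    move: s01 => /andP[s0 s1]; apply: hump2_expand => //; first by lra.
    by rewrite gtr0_norm.
  have B1 : `|f1 i (z + t *: (w + h *: ebase i))| <= b by apply: hb => //; lra.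
  have -> : G (w + h *: ebase i) - G w - h * D w =
     (hump2 s (w + h *: ebase i) - hump2 s w + h * (w ord0 i * hump s w)) * f1 i (z + t *: (w + h *: ebase i))
     - h * (chi1 i w * (f1 i (z + t *: (w + h *: ebase i)) - f1 i (z + t *: w)))
     + h * (t * (hump2 s w * (f2 i (z + t *: w + u *: ebase i) - f2 i (z + t *: w)))).
    rewrite /G /D /chi1.
    have := E; rewrite -wsE => E'.
    have -> : f1 i (z + t *: (w + h *: ebase i)) = f1 i (z + t *: w) + t * h * f2 i (z + t *: w + u *: ebase i).
      by rewrite -E'; ring.
    by ring.
  apply: le_trans (ler_normD _ _) _; apply: le_trans (lerD (ler_normB _ _) (lexx _)) _.
  have T1 : `|(hump2 s (w + h *: ebase i) - hump2 s w + h * (w ord0 i * hump s w)) * f1 i (z + t *: (w + h *: ebase i))|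
     <= h * (eta * (3 * b)).
    rewrite normrM; apply: (@le_trans _ _ (3 * h ^+ 2 * b)); first exact: ler_pM.
    have : h * h * b <= h * eta * b by rewrite ler_pM2r// ler_pM2l.
    by lra.
  have T2 : `|h * (chi1 i w * (f1 i (z + t *: (w + h *: ebase i)) - f1 i (z + t *: w)))| <= h * (eta * 1).
    rewrite normrM (gtr0_norm h0) ler_pM2l// mulr1 normrM -[eta]mul1r ler_pM//.
  have T3 : `|h * (t * (hump2 s w * (f2 i (z + t *: w + u *: ebase i) - f2 i (z + t *: w))))| <= h * (eta * rho).
    rewrite normrM (gtr0_norm h0) ler_pM2l// normrM (ger0_norm t0) mulrC ler_pM//.
    by rewrite normrM -[eta]mul1r ler_pM//; exact: hump2_norm.
  by lra.
have hdif : bounded_by (bG + bG) (fun w => G (w + h *: ebase i) - G w).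
  by move=> w; apply: le_trans (ler_normB _ _) _; exact: lerD (hGs w) (hG w).
have hhD : bounded_by (h * (t * bB + bA)) (fun w => h * D w).
  by move=> w; rewrite normrM (gtr0_norm h0) ler_pM2l.
have := space_mean_norm hE.
rewrite (space_meanB hdif hhD) (space_meanB hGs hG) GG subrr sub0r normrN (space_meanZ _ hD).
rewrite normrM (gtr0_norm h0) mulrCA ler_pM2l// => H; apply: le_trans H _.
rewrite mulrCA le_eqVlt; apply/orP; left; apply/eqP.
by rewrite /eta divfK// gt_eqF.
Qed.

(** The mean [F t] over the ball of radius [t] has derivative [sum_i] of the mean of
    [w_i hump f1 i], which [by_parts] turns into [t] times the mean of [hump2] against the
    Laplacian, at most [- m MB t]. So [F t + m MB t^2 / 2] does not increase from 0 to [rho]. *)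
Lemma mean_value_le m : (forall y, cball z rho y -> \sum_(i < d) f2 i y <= - m) ->
  space_mean (fun w => hump s w * f (z + rho *: w)) <=
  f z * space_mean (hump s : V -> R) - m * rho ^+ 2 / 2 * space_mean (hump2 s : V -> R).
Proof.
move=> hm.
pose MB := space_mean (hump2 s : V -> R).
pose F t := space_mean (fun w => hump s w * f (z + t *: w)).
pose G t := F t + m * MB * t ^+ 2 / 2.
have b2 : bounded_by 1 (hump2 s : V -> R) by move=> w; exact: hump2_norm.
have MB0 : 0 <= MB by apply: (space_mean_ge0 b2) => w; exact: hump2_ge0.
suff : G rho <= G 0.
  rewrite /G /F expr0n /= mulr0 mul0r addr0.
  have -> : space_mean (fun w => hump s w * f (z + 0 *: w)) = f z * space_mean (hump s : V -> R).
    rewrite -(space_meanZ (b := 1)); last by move=> w; exact: hump_norm.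
    by congr space_mean; apply/funext => w; rewrite scale0r addr0 mulrC.
  by rewrite -/MB; lra.
have [bF hF] := cut_bound cf (fun w => hump_norm w s01) (fun w => hump_out1 s01 (w := w)).
have /choice[bA hA] := fun i => cut_bound (@cf1 i) (chi1_norm i) (@chi1_out i).
have /choice[bB hB] := fun i => cut_bound (@cf2 i) (fun w => hump2_norm w s01) (fun w => hump2_out1 s01 (w := w)).
pose cA := \sum_(i < d) `|bA i|; pose cB := \sum_(i < d) `|bB i|.
have lesum (b : 'I_d -> R) i : b i <= \sum_(j < d) `|b j|.
  rewrite (bigD1 i)//=; apply: le_trans (ler_norm _) _; rewrite lerDl.
  exact: sumr_ge0.
have {}hA i t : 0 <= t <= rho -> bounded_by cA (fun w => chi1 i w * f1 i (z + t *: w)).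
  by move=> t01 w; apply: le_trans (hA i t t01 w) (lesum _ _).
have {}hB i t : 0 <= t <= rho -> bounded_by cB (fun w => hump2 s w * f2 i (z + t *: w)).
  by move=> t01 w; apply: le_trans (hB i t t01 w) (lesum _ _).
have sumB (n : nat) (b : R) (g : 'I_n -> V -> R) : (forall q, bounded_by b (g q)) ->
    bounded_by (n%:R * b) (fun w => \sum_(q < n) g q w).
  move=> hg w; apply: le_trans (ler_norm_sum _ _ _) _.
  have -> : n%:R * b = \sum_(q < n) b by rewrite sumr_const card_ord mulr_natl.
  by apply: ler_sum => q _; exact: hg.
pose J t w := \sum_(i < d) chi1 i w * f1 i (z + t *: w).
have hJ t : 0 <= t <= rho -> bounded_by (d%:R * cA) (J t).
  by move=> t01; apply: sumB => i; exact: hA.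
have Jle t : 0 <= t <= rho -> space_mean (J t) <= - m * MB * t.
  move=> t01; have /andP[t0 tr] := t01.
  rewrite /J (space_mean_sum (fun i => hA i t t01)).
  under eq_bigr => i _ do rewrite by_parts//.
  rewrite -mulr_sumr -(space_mean_sum (fun i => hB i t t01)) mulrC ler_wpM2r//.
  rewrite -(space_meanZ _ b2).
  have b2m : bounded_by `|m| (fun w : V => - m * hump2 s w).
    by move=> w; rewrite normrM normrN -[leRHS]mulr1 ler_pM//; exact: hump2_norm.
  apply: (space_mean_le (sumB _ _ _ (fun i => hB i t t01)) b2m) => w.
  rewrite -mulr_sumr mulrC; have [w1|w1] := leP 1 (enorm w).
    by rewrite hump2_out1// !mulr0.
  apply: ler_wpM2r; first exact: hump2_ge0.
  apply: hm; rewrite /cball /= addrAC subrr add0r enormZ ger0_norm//.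
  by rewrite -[rho]mulr1 ler_pM// ltW.
apply: small_growth => // eta' eta'0.
have c0 : 0 < 8 ^+ d * d%:R + 1 + `|m * MB| :> R.
  by rewrite -addrA ltr_wpDl ?mulr_ge0 ?exprn_ge0// ltr_pwDl.
pose eta := eta' / (8 ^+ d * d%:R + 1 + `|m * MB|).
have eta0 : 0 < eta by rewrite divr_gt0.
have [e e0 he] := @common_pos (fun i e => forall y y', cball z (2 * rho) y ->
   enorm (y' - y) < e -> `|f1 i y' - f1 i y| <= eta)
   (fun i e e' ee H y y' Sy yy => H y y' Sy (lt_le_trans yy ee)) (fun i => unif_fun (@cf1 i) eta0).
exists (Num.min (rho / 2) (Num.min e eta)).
  by rewrite !lt_min e0 eta0 divr_gt0.
move=> t t' t0 tt' tr'; rewrite !lt_min => /and3P[q1 q2 q3].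
have t01 : 0 <= t <= rho by rewrite t0 (le_trans tt').
have t01' : 0 <= t' <= rho by rewrite tr' (le_trans t0).
have dt0 : 0 <= t' - t by rewrite subr_ge0.
have hFd : bounded_by (bF + bF) (fun w => hump s w * f (z + t' *: w) - hump s w * f (z + t *: w)).
  by move=> w; apply: le_trans (ler_normB _ _) _; apply: lerD; exact: hF.
have hJd : bounded_by ((t' - t) * (d%:R * cA)) (fun w => (t' - t) * J t w).
  by move=> w; rewrite normrM (ger0_norm dt0) ler_wpM2l// hJ.
have hE : bounded_by (eta * (d%:R * (t' - t)))
    (fun w => (hump s w * f (z + t' *: w) - hump s w * f (z + t *: w)) - (t' - t) * J t w).
  move=> w; have [w1|w1] := leP 1 (enorm w).
    rewrite /J hump_out1// !mul0r subrr sub0r big1 ?mulr0 ?normrN ?normr0.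
      by rewrite mulr_ge0 ?(ltW eta0)// mulr_ge0.
    by move=> i _; rewrite chi1_out// mul0r.
  have wB : cball z (3 / 2 * rho) (z + t *: w) by apply: pt_in => //; lra.
  have kw : enorm ((t' - t) *: w) <= t' - t.
    by rewrite enormZ (ger0_norm dt0) -[leRHS]mulr1 ler_wpM2l// ltW.
  have := @first_order _ _ f f1 (z + t *: w) ((t' - t) *: w) eta (ltW eta0).
  have -> : z + t *: w + (t' - t) *: w = z + t' *: w by rewrite scalerBl addrAC -addrA subrK.
  move=> FO; have {}FO := FO _.
  have -> : hump s w * f (z + t' *: w) - hump s w * f (z + t *: w) - (t' - t) * J t w =
     hump s w * (f (z + t' *: w) - f (z + t *: w) - \sum_(i < d) ((t' - t) *: w) ord0 i * f1 i (z + t *: w)).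
    rewrite /J !mulr_sumr mulrBr mulrBr; congr (_ - _).
    by rewrite mulr_sumr; apply: eq_bigr => i _; rewrite mxE /chi1; ring.
  rewrite normrM -[leRHS]mul1r; apply: ler_pM => //; first exact: hump_norm.
  apply: (le_trans (FO _)); last by rewrite ler_wpM2l ?(ltW eta0)// ler_wpM2l.
  move=> y i yy; split; last first.
    by apply: he; [exact: sub_ball|apply: le_lt_trans q2; exact: le_trans kw].
  have yB : cball z (2 * rho) y.
    rewrite /cball /=; apply: le_trans (enorm_triB _ (z + t *: w) _) _.
    apply: le_trans (lerD (le_trans yy kw) wB) _; lra.
  by have [_ /(_ i)[]] := C2f yB.
have := space_mean_norm hE.
rewrite (space_meanB hFd hJd) (space_meanB (hF _ t01') (hF _ t01)) (space_meanZ _ (hJ _ t01)).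
rewrite -/(F t) -/(F t') => H; have {}H := le_trans (ler_norm _) H.
have Jt := ler_wpM2l dt0 (Jle _ t01).
have e1 : eta' = eta * (8 ^+ d * d%:R + 1 + `|m * MB|) by rewrite /eta divfK// gt_eqF.
rewrite /G e1.
have q : m * MB * ((t' - t) * (t' - t)) <= `|m * MB| * ((t' - t) * eta).
  apply: le_trans (ler_norm _) _; rewrite normrM ler_wpM2l// ger0_norm ?mulr_ge0//.
  by rewrite ler_wpM2l// ltW.
have q' : 0 <= `|m * MB| * ((t' - t) * eta) by rewrite mulr_ge0// mulr_ge0// ltW.
have q'' : 0 <= eta * (t' - t) by rewrite mulr_ge0// ltW.
have -> : m * MB * t' ^+ 2 / 2 = m * MB * t ^+ 2 / 2 + m * MB * t * (t' - t)
   + m * MB * ((t' - t) * (t' - t)) / 2 by field.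
have E1 : (t' - t) * (- m * MB * t) = - (m * MB * t * (t' - t)) by ring.
rewrite E1 in Jt.
have E2 : eta * (8 ^+ d * d%:R + 1 + `|m * MB|) * (t' - t) = 8 ^+ d * (eta * (d%:R * (t' - t)))
   + eta * (t' - t) + `|m * MB| * ((t' - t) * eta) by ring.
rewrite E2; lra.
Qed.

End MeanValueInequality.

(** * Mean value property of harmonic functions and the gradient estimate *)

Section Harmonic.
Context {R : realType} {d : nat}.
Local Notation V := 'rV[R]_d.
Implicit Types (phi chi : V -> R) (x y z w a : V) (i j : 'I_d) (b c s t h eta e k m tau rho : R).

Lemma derive_bound phi x i l e c : is_derive x (ebase i) phi l -> 0 < e ->
  (forall h, `|h| < e -> `|phi (x + h *: ebase i) - phi x| <= c * `|h|) -> `|l| <= c.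
Proof.
move=> [dphi <-] e0 H; rewrite /derive.
set g := (fun h : R => _).
have cg : g h @[h --> 0^'] --> lim (g h @[h --> 0^']) by exact: dphi.
have cn : `|g h| @[h --> 0^'] --> `|lim (g h @[h --> 0^'])| by exact: cvg_norm.
have <- := cvg_lim (@Rhausdorff R) cn.
apply: limr_le; first by apply/cvg_ex; eexists; exact: cn.
near=> h.
have h0 : h != 0 by near: h; exact: nbhs_dnbhs_neq.
have he : `|h| < e by near: h; exact: dnbhs0_lt.
rewrite /g normrZ normfV ler_pdivrMl ?normr_gt0//= [h *: _ + x]addrC [`|h| * c]mulrC.
exact: H.
Unshelve. all: by end_near. Qed.

Variables (D : set V) (u : V -> R).
Hypothesis hu : harmonic_on D u.

Lemma harmonic_C2_with (S : set V) : S `<=` D ->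
  C2_with S u (fun i => partial i u) (fun i => partial i (partial i u)).
Proof.
move=> SD y /SD Dy; have [/(_ _ Dy)[c0 c1 c2] _] := hu.
split=> // i; have [d1 k1] := c1 i; have [d2 k2] := c2 i i.
by split; [exact: k1|exact: k2|exact: (derivableP d1)|exact: (derivableP d2)].
Qed.

Lemma C2_withN (S : set V) (f : V -> R) (f1 f2 : 'I_d -> V -> R) : C2_with S f f1 f2 ->
  C2_with S (fun y => - f y) (fun i y => - f1 i y) (fun i y => - f2 i y).
Proof.
move=> H y /H[c0 ci]; split; first exact: (cvgN c0).
move=> i; have [c1 c2 d1 d2] := ci i; split.
- exact: (cvgN c1).
- exact: (cvgN c2).
- exact: is_deriveN.
- exact: is_deriveN.
Qed.

(** The mean value inequality with [m = 0], applied to [u] and to [- u]. *)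
Lemma harmonic_mean_value z rho s : 0 < rho -> 0 <= s <= 1 -> cball z (2 * rho) `<=` D ->
  space_mean (fun w => hump s w * u (z + rho *: w)) = u z * space_mean (hump s : V -> R).
Proof.
move=> rho0 s01 zD; have C2u := harmonic_C2_with zD.
have lap0 y : cball z rho y -> \sum_(i < d) partial i (partial i u) y = 0.
  move=> yB; apply: hu.2; apply: zD; apply: le_trans yB _; lra.
apply/eqP; rewrite eq_le; apply/andP; split.
  have := mean_value_le rho0 s01 C2u (m := 0).
  rewrite !mul0r subr0; apply => y yB; have := lap0 y yB => /= ->.
  by rewrite oppr0.
have := mean_value_le rho0 s01 (C2_withN C2u) (m := 0).
rewrite !mul0r subr0 mulNr.
have [b hb] := cut_bound rho0 (fun y (yB : cball z (2 * rho) y) => (C2u y yB).1)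
   (fun w => hump_norm w s01) (fun w => hump_out1 s01 (w := w)).
have -> : (fun w => hump s w * - u (z + rho *: w)) = (fun w => (-1) * (hump s w * u (z + rho *: w))).
  by apply/funext => w; rewrite mulrN mulN1r.
rewrite (space_meanZ (b := b)); last by apply: hb; rewrite lexx ltW.
rewrite mulN1r lerN2; apply => y yB.
by rewrite sumrN lap0// oppr0.
Qed.

Lemma hump_mean_gt0 s : 0 < s <= 1 -> 0 < space_mean (hump s : V -> R).
Proof.
move=> /andP[s0 s1].
(* The cube of half-side [r] lies in the ball of radius [s / 2], where [hump s] is at least
   [s^2 / 2]. *)
pose r := s / (d.+1%:R * 2).
have dd : 0 < d.+1%:R * 2 :> R by rewrite mulr_gt0.
have r0 : 0 < r by rewrite divr_gt0.
have d1 : 1 <= d.+1%:R :> R by rewrite ler1n.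
have r1 : r <= s / 2.
  by rewrite /r ler_pM2l// lef_pV2 ?posrE// ler_peMl.
have s01 : 0 <= s <= 1 by rewrite ltW.
have c0 : 0 < s ^+ 2 / 2 by rewrite divr_gt0// exprn_gt0.
apply: (@lt_le_trans _ _ (s ^+ 2 / 2 * r ^+ d)); first by rewrite mulr_gt0 ?exprn_gt0.
apply: (@space_mean_gt0 _ _ _ 1).
- by move=> w; exact: hump_norm.
- by move=> w; exact: hump_ge0.
- exact: ltW.
- by rewrite r0/=; lra.
move=> w wr; rewrite /hump le_max; apply/orP; right.
suff : dot w w <= s ^+ 2 / 2 by lra.
have : enorm w <= s / 2.
  apply: le_trans (enorm_le_sum w) _.
  apply: (@le_trans _ _ (\sum_(i < d) r)); first by apply: ler_sum.
  rewrite sumr_const card_ord -[r *+ d]mulr_natl /r mulrCA ler_pM2l// ler_pdivrMr//.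
  by rewrite mulrCA mulVf ?pnatr_eq0// mulr1 ler_nat.
rewrite -sqr_enorm => w2.
have : enorm w ^+ 2 <= (s / 2) ^+ 2 by rewrite ler_pXn2r ?nnegrE// divr_ge0// ltW.
by rewrite expr_div_n => h; have := sqr_ge0 s; lra.
Qed.

Definition quarter_mean : R := space_mean (hump 4^-1 : V -> R).

Lemma quarter_mean_gt0 : 0 < quarter_mean.
Proof. by apply: hump_mean_gt0; lra. Qed.

(* Off-centre mean values, all read in the coordinates of the ball at [z], so that both sides are the same functional. *)
Lemma off_centre_mean_value z rho a : 0 < rho -> enorm a <= 4^-1 -> cball z (3 * rho) `<=` D ->
  space_mean (fun w => hump 4^-1 (w - a) * u (z + rho *: w)) = u (z + rho *: a) * quarter_mean.
Proof.
move=> rho0 a4 zD.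
have s01 : 0 <= (4^-1 : R) <= 1 by lra.
have yD : cball (z + rho *: a) (2 * rho) `<=` D.
  move=> y yB; apply: zD; rewrite /cball /=.
  apply: le_trans (enorm_triB _ (z + rho *: a) _) _.
  have e1 : enorm (z + rho *: a - z) <= rho * 1.
    by rewrite addrAC subrr add0r enormZ gtr0_norm// ler_wpM2l ?(ltW rho0)//; lra.
  apply: le_trans (lerD yB e1) _; lra.
rewrite /quarter_mean -(harmonic_mean_value rho0 s01 yD).
have C2u := harmonic_C2_with yD.
have rr : 0 <= rho <= rho by rewrite lexx ltW.
pose P w := hump 4^-1 w * u (z + rho *: a + rho *: w).
have [b hb] := cut_bound rho0 (fun y (yB : cball _ (2 * rho) y) => (C2u y yB).1)
   (fun w => hump_norm w s01) (fun w => hump_out1 s01 (w := w)).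
have uP : unif_cont P.
  apply: (cut_unif rho0 rr) => //.
  - by move=> y /C2u[].
  - by move=> w; exact: hump_norm.
  - by move=> w; exact: hump_out1.
  - by move=> w a'; exact: hump_lip.
rewrite -[RHS](@space_mean_translate _ _ P (- a) b) //.
- congr space_mean; apply/funext => w; rewrite /P; congr (_ * u _).
  by rewrite scalerBr [rho *: w - _]addrC addrA addrK.
- by rewrite enormN; lra.
- exact: hb.
- by move=> y y1; rewrite /P hump_out1// mul0r.
Qed.

End Harmonic.

Section Kernel.
Context {R : realType} {d : nat}.
Local Notation V := 'rV[R]_d.
Local Notation qmean := (@quarter_mean R d).
Implicit Types (f g phi chi : V -> R) (x y z w a p : V) (i j : 'I_d) (b c s t h eta e k m tau rho r : R).

Variables (D : set V) (u : V -> R).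
Hypothesis hu : harmonic_on D u.

Definition ball_osc z rho : R := space_mean (fun w => hump 1 w * `|u (z + rho *: w) - u z|).

Lemma in_cball z rho w : 0 <= rho -> enorm w <= 1 -> cball z rho (z + rho *: w).
Proof.
by move=> r0 w1; rewrite /cball /= addrAC subrr add0r enormZ ger0_norm// ler_piMr.
Qed.

Lemma harmonic_bounded z rho : 0 < rho -> cball z rho `<=` D ->
  exists2 b : R, 0 < b & forall y, cball z rho y -> `|u y| <= b.
Proof.
move=> rho0 zD; apply: compact_bounded_fun; first exact: cball_compact.
by move=> y /zD /(hu.1 _)[].
Qed.

Lemma hump1_norm w : `|hump 1 w| <= 1 :> R.
Proof. by apply: hump_norm; rewrite ler01 lexx. Qed.

Lemma hump1_out w : 1 <= enorm w -> hump 1 w = 0 :> R.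
Proof. by apply: hump_out1; rewrite ler01 lexx. Qed.

Lemma hump1_bounded z rho f b : 0 <= rho -> 0 <= b ->
  (forall y, cball z rho y -> `|f y| <= b) ->
  bounded_by b (fun w => hump 1 w * f (z + rho *: w)).
Proof.
move=> r0 b0 fb w; have [w1|w1] := leP 1 (enorm w).
  by rewrite hump1_out// mul0r normr0.
rewrite normrM -[b]mul1r ler_pM//; first exact: hump1_norm.
by apply: fb; apply: in_cball => //; exact: ltW.
Qed.

(** Both values are means against translated bumps of the same mass, so [u z] may be subtracted
    first. The bumps live in [enorm w < 1/2], where [hump 1 >= 3/4], and differ by at most
    [4 |a - a'|]; the constant 6 exceeds [4 / (3/4)]. *)
Lemma osc_lip z rho a a' : 0 < rho -> enorm a <= 4^-1 -> enorm a' <= 4^-1 ->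
  cball z (3 * rho) `<=` D ->
  `|u (z + rho *: a) - u (z + rho *: a')| * qmean <= 6 * enorm (a - a') * ball_osc z rho.
Proof.
move=> rho0 a4 a'4 zD.
have s01 : 0 <= (4^-1 : R) <= 1 by lra.
have zD1 : cball z rho `<=` D.
  by move=> y yB; apply: zD; apply: le_trans yB _; lra.
have [b b0 hb] := harmonic_bounded rho0 zD1.
have hq (c : V) : enorm c <= 4^-1 -> bounded_by b (fun w => hump 4^-1 (w - c) * u (z + rho *: w)).
  move=> c4 w; have [w1|w1] := leP 1 (enorm w).
    have -> : hump 4^-1 (w - c) = 0 :> R.
      by apply: hump_out; [lra|have := le_enormB w c; lra].
    by rewrite mul0r normr0 ltW.
  rewrite normrM -[b]mul1r ler_pM//; first exact: hump_norm.
  by apply: hb; apply: in_cball; exact: ltW.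
have hc (c : V) (v : R) : bounded_by `|v| (fun w : V => hump 4^-1 (w - c) * v).
  by move=> w; rewrite normrM ler_piMl//; exact: hump_norm.
have h4 (c : V) : enorm c <= 4^-1 -> space_mean (fun w : V => hump 4^-1 (w - c) * u z) = u z * qmean.
  move=> c4; rewrite /quarter_mean.
  have h41 : bounded_by 1 (hump 4^-1 : V -> R) by move=> w; exact: hump_norm.
  have <- : space_mean (fun w : V => hump 4^-1 (w - c) : R) = space_mean (hump 4^-1 : V -> R).
    apply: (space_mean_translate (b := 1)) => //.
    - by rewrite enormN; lra.
    - exact: hump_unif_cont.
    - by move=> y y1; rewrite hump_out1.
  have h41c : bounded_by 1 (fun w : V => hump 4^-1 (w - c) : R).
    by move=> w; exact: hump_norm.
  rewrite -(space_meanZ _ h41c).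
  by congr space_mean; apply/funext => w; rewrite mulrC.
have key (c : V) : enorm c <= 4^-1 -> (u (z + rho *: c) - u z) * qmean =
    space_mean (fun w => hump 4^-1 (w - c) * (u (z + rho *: w) - u z)).
  move=> c4; rewrite mulrBl -(off_centre_mean_value hu rho0 c4 zD) -(h4 c c4).
  rewrite -(space_meanB (hq _ c4) (hc c (u z))).
  by congr space_mean; apply/funext => w; rewrite mulrBr.
have hk (c : V) : enorm c <= 4^-1 ->
    bounded_by (b + `|u z|) (fun w => hump 4^-1 (w - c) * (u (z + rho *: w) - u z)).
  move=> c4 w; rewrite mulrBr; apply: le_trans (ler_normB _ _) _.
  by apply: lerD; [exact: hq|exact: hc].
rewrite -[qmean]ger0_norm; last exact/ltW/quarter_mean_gt0.
rewrite -normrM.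
have -> : (u (z + rho *: a) - u (z + rho *: a')) * qmean =
   (u (z + rho *: a) - u z) * qmean - (u (z + rho *: a') - u z) * qmean by ring.
rewrite !key// -(space_meanB (hk _ a4) (hk _ a'4)).
set q := 6 * enorm (a - a').
have q0 : 0 <= q by rewrite mulr_ge0.
pose A w := hump 1 w * `|u (z + rho *: w) - u z|.
have uz : `|u z| <= b by apply: hb; rewrite /cball /= subrr enorm0 ltW.
have hA : bounded_by (b + b) A.
  apply: (hump1_bounded (f := fun y => `|u y - u z|)) => //; [exact: ltW|by rewrite addr_ge0 ?ltW|].
  move=> y yB; rewrite normr_id; apply: le_trans (ler_normB _ _) _.
  by apply: lerD => //; exact: hb.
rewrite -/A /ball_osc -/A.
have bd w : `|hump 4^-1 (w - a) * (u (z + rho *: w) - u z) - hump 4^-1 (w - a') * (u (z + rho *: w) - u z)|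
    <= q * A w.
  rewrite -mulrBl normrM /A mulrA ler_wpM2r//.
  have [w1|w1] := leP (1 / 2) (enorm w).
    have -> : hump 4^-1 (w - a) = 0 :> R.
      by apply: hump_out; [lra|have := le_enormB w a; lra].
    have -> : hump 4^-1 (w - a') = 0 :> R.
      by apply: hump_out; [lra|have := le_enormB w a'; lra].
    by rewrite subrr normr0 mulr_ge0// hump_ge0.
  have h1 : 3 / 4 <= hump 1 w.
    rewrite /hump le_max; apply/orP; right; rewrite expr1n -sqr_enorm.
    have := enorm_ge0 w; nra.
  have l1 : enorm (w - a) <= 2 by apply: le_trans (enormD _ _) _; rewrite enormN; lra.
  have l2 : enorm (w - a') <= 2 by apply: le_trans (enormD _ _) _; rewrite enormN; lra.
  have := hump_lip 4^-1 l1 l2.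
  have -> : w - a - (w - a') = - (a - a') by rewrite opprB addrAC addrCA subrr addr0 opprB addrC.
  rewrite enormN => H; apply: le_trans H _; rewrite /q.
  have := enorm_ge0 (a - a'); nra.
have hqA : bounded_by (q * (b + b)) (fun w => q * A w).
  by move=> w; rewrite normrM (ger0_norm q0) ler_wpM2l.
have hd : bounded_by (b + `|u z| + (b + `|u z|)) (fun w => hump 4^-1 (w - a) * (u (z + rho *: w) - u z) -
    hump 4^-1 (w - a') * (u (z + rho *: w) - u z)).
  by move=> w; apply: le_trans (ler_normB _ _) _; apply: lerD; exact: hk.
have hqAN : bounded_by (q * (b + b)) (fun w => (- q) * A w).
  by move=> w; rewrite mulNr normrN.
rewrite ler_norml -mulNr -!(space_meanZ _ hA); apply/andP; split.
  apply: (space_mean_le hqAN hd) => w; have := bd w; rewrite ler_norml => /andP[+ _].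
  by rewrite mulNr.
by apply: (space_mean_le hd hqA) => w; have := bd w; rewrite ler_norml => /andP[].
Qed.

(** Allowing [y] off the centre makes one gradient a lower bound for the oscillation around every
    nearby [z], which is the open condition that Harnack chains start from. *)
Lemma grad_le_osc z rho y : 0 < rho -> cball z (3 * rho) `<=` D -> enorm (y - z) < rho / 4 ->
  enorm (grad u y) * rho <= d%:R * (6 / qmean) * ball_osc z rho.
Proof.
move=> rho0 zD yz; have q0 := @quarter_mean_gt0 R d.
pose a := rho^-1 *: (y - z).
have aE : z + rho *: a = y by rewrite /a scalerA divff ?gt_eqF// scale1r addrC subrK.
have a4 : enorm a < 4^-1.
  by rewrite /a enormZ ger0_norm ?invr_ge0 ?ltW// mulrC ltr_pdivrMr// mulrC.
have Dy : D y.
  by apply: zD; rewrite /cball /=; lra.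
have part i : `|partial i u y| <= 6 / qmean * ball_osc z rho / rho.
  have [_ cpart _] := hu.1 _ Dy; have [dp _] := cpart i.
  apply: (@derive_bound _ _ u y i _ ((4^-1 - enorm a) * rho) _ (derivableP dp)).
    by rewrite mulr_gt0// subr_gt0.
  move=> h hh.
  have hE : z + rho *: (a + (h / rho) *: ebase i) = y + h *: ebase i.
    by rewrite scalerDr addrA aE scalerA mulrCA divff ?gt_eqF// mulr1.
  have nh : enorm ((h / rho) *: (ebase i : V)) = `|h| / rho.
    by rewrite enormZ enorm_ebase mulr1 normrM normfV (gtr0_norm rho0).
  have := @osc_lip z rho (a + (h / rho) *: ebase i) a rho0 _ (ltW a4) zD.
  rewrite hE aE addrAC subrr add0r nh -ler_pdivlMr// => H.
  have -> : 6 / qmean * ball_osc z rho / rho * `|h| =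
    6 * (`|h| / rho) * ball_osc z rho / qmean by ring.
  apply: H; apply: le_trans (enormD _ _) _; rewrite nh.
  by rewrite -ltr_pdivrMr// in hh; lra.
rewrite -ler_pdivlMr//; apply: le_trans (enorm_le_sum _) _.
apply: (@le_trans _ _ (\sum_(i < d) (6 / qmean * ball_osc z rho / rho))).
  by apply: ler_sum => i _; rewrite mxE; exact: part.
by rewrite sumr_const card_ord -[_ *+ d]mulr_natl !mulrA.
Qed.

End Kernel.

(** * The biased walk *)

Section BoundaryDistance.
Context {R : realType} {d : nat}.
Local Notation V := 'rV[R]_d.
Implicit Types (x y z w a p : V) (c e r eta : R).
Variables (D : set V).
Hypotheses (oD : open D) (nD : exists p, ~ D p).

Definition bdist z : R := inf [set enorm (z - p) | p in ~` D].

Lemma bdist_has_inf z : has_inf [set enorm (z - p) | p in ~` D].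
Proof.
split; first by have [p np] := nD; exists (enorm (z - p)), p.
by exists 0 => _ [p _ <-].
Qed.

Lemma bdist_le z p : ~ D p -> bdist z <= enorm (z - p).
Proof. by move=> np; apply: ge_inf; [exact: (bdist_has_inf z).2|exists p]. Qed.

Lemma bdist_ge z c : (forall p, ~ D p -> c <= enorm (z - p)) -> c <= bdist z.
Proof.
move=> h; apply: lb_le_inf; first exact: (bdist_has_inf z).1.
by move=> _ [p np <-]; exact: h.
Qed.

Lemma bdist_ge0 z : 0 <= bdist z.
Proof. exact: bdist_ge. Qed.

Lemma bdist_adherent z eta : 0 < eta -> exists2 p, ~ D p & enorm (z - p) < bdist z + eta.
Proof.
move=> eta0; have [_ [p np <-] h] := inf_adherent eta0 (bdist_has_inf z).
by exists p.
Qed.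

Lemma bdist_lip z y : bdist z <= bdist y + enorm (z - y).
Proof.
rewrite -lerBlDr; apply: bdist_ge => p np; rewrite lerBlDr.
by apply: le_trans (bdist_le z np) _; rewrite [leRHS]addrC; exact: enorm_triB.
Qed.

Lemma bdist_gt0 z : D z -> 0 < bdist z.
Proof.
move=> Dz; have /nbhs_enorm[e e0 he] : nbhs z D by exact: open_nbhs_nbhs.
apply: lt_le_trans e0 _; apply: bdist_ge => p np; rewrite leNgt; apply/negP => pz.
by apply: np; apply: he; rewrite enormB.
Qed.

Lemma bdist_sub z y : enorm (y - z) < bdist z -> D y.
Proof.
move=> yz; apply: contrapT => ny.
by have := lt_le_trans yz (bdist_le z ny); rewrite enormB ltxx.
Qed.

Lemma bdist_out z : ~ D z -> bdist z = 0.
Proof.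
move=> nz; apply/eqP; rewrite eq_le bdist_ge0 andbT.
by have := bdist_le z nz; rewrite subrr enorm0.
Qed.

End BoundaryDistance.

Section MarkovOperator.
Context {R : realType} {d : nat}.
Local Notation V := 'rV[R]_d.
Implicit Types (f g phi chi : V -> R) (x y z w a p : V) (i j : 'I_d) (b c s t h eta e k m tau rho r : R).

Variables (D : set V) (u : V -> R) (eps : R).
Hypotheses (oD : open D) (nD : exists p, ~ D p) (hu : harmonic_on D u).
Hypothesis eps01 : 0 < eps <= 2^-1.

Definition irad z : R := bdist D z / 8.
(** The sign turns the deviation [u - u z] into minus [eps] times its absolute value. The finitely
    additive mean accepts this discontinuous weight, and later infima and suprema, because it is
    defined for every bounded function. *)
Definition wgt z w : R := hump 1 w * (1 - eps * Num.sg (u (z + irad z *: w) - u z)).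
Definition hmean : R := space_mean (hump 1 : V -> R).
Definition walk f z : R := space_mean (fun w => wgt z w * f (z + irad z *: w)) / space_mean (wgt z).
Definition mean0 f z : R := space_mean (fun w => hump 1 w * f (z + irad z *: w)) / hmean.
Definition osc z : R := ball_osc u z (irad z) / hmean.

Definition loc_bounded f z : Prop := exists2 b : R, 0 <= b & forall y, cball z (irad z) y -> `|f y| <= b.

Lemma hmean_gt0 : 0 < hmean.
Proof. by apply: hump_mean_gt0; rewrite ltr01 lexx. Qed.

Lemma iradE z : irad z = bdist D z / 8. Proof. by []. Qed.

Lemma oscE z : osc z = ball_osc u z (irad z) / hmean. Proof. by []. Qed.

Lemma irad_ge0 z : 0 <= irad z.
Proof. by rewrite divr_ge0// bdist_ge0. Qed.

Lemma irad_gt0 z : D z -> 0 < irad z.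
Proof. by move=> Dz; rewrite divr_gt0// bdist_gt0. Qed.

Lemma irad_sub z : D z -> cball z (3 * irad z) `<=` D.
Proof.
move=> Dz y yB; apply: (bdist_sub nD (z := z)); apply: le_lt_trans yB _.
by have := bdist_gt0 oD nD Dz; rewrite /irad; lra.
Qed.

Lemma irad_sub1 z : D z -> cball z (irad z) `<=` D.
Proof.
by move=> Dz y yB; apply: (irad_sub Dz); apply: le_trans yB _; have := irad_gt0 Dz; lra.
Qed.

Lemma wgt_bounds z w : (1 - eps) * hump 1 w <= wgt z w <= (1 + eps) * hump 1 w.
Proof.
rewrite /wgt; move/andP: eps01 => [e0 e1].
have : -1 <= Num.sg (u (z + irad z *: w) - u z) <= 1 by rewrite -ler_norml normr_sg lern1 leq_b1.
move: (Num.sg _) (hump 1 w) (@hump_ge0 R d 1 w) => q k k0 /andP[q1 q2].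
have es : eps * (-1) <= eps * q by rewrite ler_wpM2l// ltW.
have es' : eps * q <= eps * 1 by rewrite ler_wpM2l// ltW.
by rewrite ![_ * k]mulrC !ler_wpM2l//; lra.
Qed.

Lemma wgt_ge0 z w : 0 <= wgt z w.
Proof.
have /andP[+ _] := wgt_bounds z w; apply: le_trans.
by rewrite mulr_ge0 ?hump_ge0//; move/andP: eps01 => [e0 e1]; lra.
Qed.

Lemma wgt_norm z w : `|wgt z w| <= 2 * hump 1 w.
Proof.
rewrite ger0_norm ?wgt_ge0//; have /andP[_] := wgt_bounds z w => /le_trans; apply.
by rewrite ler_wpM2r ?hump_ge0//; move/andP: eps01 => [e0 e1]; lra.
Qed.

Lemma hump1_le1 w : hump 1 w <= 1 :> R.
Proof. by apply: le_trans (hump_le _ _) _; rewrite expr1n. Qed.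

Lemma wgt_bounded z f b : 0 <= b -> (forall y, cball z (irad z) y -> `|f y| <= b) ->
  bounded_by (2 * b) (fun w => wgt z w * f (z + irad z *: w)).
Proof.
move=> b0 fb w; have [w1|w1] := leP 1 (enorm w).
  by have := wgt_norm z w; rewrite hump1_out// mulr0 normr_le0 => /eqP ->; rewrite mul0r normr0 mulr_ge0.
rewrite normrM ler_pM//; first by apply: le_trans (wgt_norm _ _) _; have := hump1_le1 w; lra.
by apply: fb; apply: in_cball; [exact: irad_ge0|exact: ltW].
Qed.

Lemma wgt1_bounded z : bounded_by 2 (wgt z).
Proof. by move=> w; apply: le_trans (wgt_norm _ _) _; have := hump1_le1 w; lra. Qed.

Lemma wgt_mean_bounds z : (1 - eps) * hmean <= space_mean (wgt z) <= (1 + eps) * hmean.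
Proof.
have h1 : bounded_by 1 (hump 1 : V -> R) by move=> w; exact: hump1_norm.
have hb k : bounded_by (`|k|) (fun w : V => k * hump 1 w).
  by move=> w; rewrite normrM ler_piMr//; exact: hump1_norm.
rewrite /hmean -!(space_meanZ _ h1); apply/andP; split.
  by apply: (space_mean_le (hb _) (wgt1_bounded z)) => w; have /andP[] := wgt_bounds z w.
by apply: (space_mean_le (wgt1_bounded z) (hb _)) => w; have /andP[] := wgt_bounds z w.
Qed.

Lemma wgt_mean_gt0 z : 0 < space_mean (wgt z).
Proof.
have /andP[+ _] := wgt_mean_bounds z; apply: lt_le_trans.
by rewrite mulr_gt0 ?hmean_gt0//; move/andP: eps01 => [e0 e1]; lra.
Qed.

Lemma walk_le f g z : loc_bounded f z -> loc_bounded g z ->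
  (forall y, cball z (irad z) y -> f y <= g y) -> walk f z <= walk g z.
Proof.
move=> [b b0 fb] [c c0 gc] fg; rewrite /walk ler_pM2r ?invr_gt0 ?wgt_mean_gt0//.
apply: (space_mean_le (wgt_bounded b0 fb) (wgt_bounded c0 gc)) => w.
have [w1|w1] := leP 1 (enorm w).
  by have := wgt_norm z w; rewrite hump1_out// mulr0 normr_le0 => /eqP ->; rewrite !mul0r.
by rewrite ler_wpM2l ?wgt_ge0//; apply: fg; apply: in_cball; [exact: irad_ge0|exact: ltW].
Qed.

Lemma walkD f g z : loc_bounded f z -> loc_bounded g z ->
  walk (fun y => f y + g y) z = walk f z + walk g z.
Proof.
move=> [b b0 fb] [c c0 gc]; rewrite /walk -mulrDl.
rewrite -(space_meanD (wgt_bounded b0 fb) (wgt_bounded c0 gc)).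
by congr (space_mean _ / _); apply/funext => w; rewrite mulrDr.
Qed.

Lemma walkZ k f z : loc_bounded f z -> walk (fun y => k * f y) z = k * walk f z.
Proof.
move=> [b b0 fb]; rewrite /walk mulrA -(space_meanZ _ (wgt_bounded b0 fb)).
by congr (space_mean _ / _); apply/funext => w; rewrite mulrCA.
Qed.

Lemma walk_const k z : walk (fun=> k) z = k.
Proof.
rewrite /walk; have -> : (fun w => wgt z w * k) = (fun w => k * wgt z w).
  by apply/funext => w; rewrite mulrC.
by rewrite (space_meanZ _ (wgt1_bounded z)) mulfK// gt_eqF// wgt_mean_gt0.
Qed.

Lemma loc_bounded_const k z : loc_bounded (fun=> k) z.
Proof. by exists `|k|. Qed.

Lemma loc_boundedD f g z : loc_bounded f z -> loc_bounded g z -> loc_bounded (fun y => f y + g y) z.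
Proof.
move=> [b b0 fb] [c c0 gc]; exists (b + c); first exact: addr_ge0.
by move=> y yB; apply: le_trans (ler_normD _ _) _; apply: lerD; [exact: fb|exact: gc].
Qed.

Lemma loc_boundedZ k f z : loc_bounded f z -> loc_bounded (fun y => k * f y) z.
Proof.
move=> [b b0 fb]; exists (`|k| * b); first exact: mulr_ge0.
by move=> y yB; rewrite normrM ler_wpM2l// fb.
Qed.

Lemma loc_boundedM f g z : loc_bounded f z -> loc_bounded g z -> loc_bounded (fun y => f y * g y) z.
Proof.
move=> [b b0 fb] [c c0 gc]; exists (b * c); first exact: mulr_ge0.
by move=> y yB; rewrite normrM ler_pM//; [exact: fb|exact: gc].
Qed.

Lemma walk_ge_const f z c : loc_bounded f z -> (forall y, cball z (irad z) y -> c <= f y) ->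
  c <= walk f z.
Proof.
by move=> fb fc; rewrite -[leLHS](walk_const c z); apply: walk_le => //; exact: loc_bounded_const.
Qed.

Lemma walk_le_const f z c : loc_bounded f z -> (forall y, cball z (irad z) y -> f y <= c) ->
  walk f z <= c.
Proof.
by move=> fb fc; rewrite -[leRHS](walk_const c z); apply: walk_le => //; exact: loc_bounded_const.
Qed.

Lemma walk_exists f z c : loc_bounded f z -> walk f z < c ->
  exists2 y, cball z (irad z) y & f y < c.
Proof.
move=> fb fc; apply: contrapT => H; have : c <= walk f z.
  apply: walk_ge_const => // y yB; rewrite leNgt; apply/negP => fy.
  by apply: H; exists y.
by rewrite leNgt fc.
Qed.

(** The price of the bias: numerator and normalisation are each off by at most a factor [1 + eps] or
    [1 - eps], and [(1 + eps) / (1 - eps) <= 1 + 4 eps] for [eps <= 1/2]. *)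
Lemma walk_le_mean0 f z : loc_bounded f z -> (forall y, cball z (irad z) y -> 0 <= f y) ->
  walk f z <= (1 + 4 * eps) * mean0 f z.
Proof.
move=> [b b0 fb] f0; have /andP[e0 e1] := eps01.
pose F w := hump 1 w * f (z + irad z *: w).
have hF : bounded_by b F by apply: hump1_bounded; rewrite ?irad_ge0.
have F0 w : 0 <= F w.
  have [w1|w1] := leP 1 (enorm w); first by rewrite /F hump1_out// mul0r.
  by rewrite mulr_ge0 ?hump_ge0//; apply: f0; apply: in_cball; [exact: irad_ge0|exact: ltW].
have hFe : bounded_by (`|1 + eps| * b) (fun w => (1 + eps) * F w).
  by move=> w; rewrite normrM ler_wpM2l.
have S1 : space_mean (fun w => wgt z w * f (z + irad z *: w)) <= (1 + eps) * space_mean F.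
  rewrite -(space_meanZ _ hF); apply: (space_mean_le (wgt_bounded b0 fb) hFe) => w.
  have [w1|w1] := leP 1 (enorm w).
    by have := wgt_norm z w; rewrite hump1_out// mulr0 normr_le0 => /eqP ->; rewrite /F hump1_out// !mul0r mulr0.
  rewrite /F mulrA ler_wpM2r//; last by have /andP[] := wgt_bounds z w.
  by apply: f0; apply: in_cball; [exact: irad_ge0|exact: ltW].
have SF0 : 0 <= space_mean F by exact: (space_mean_ge0 hF).
have H0 := hmean_gt0; have W0 := wgt_mean_gt0 z; have /andP[W1 _] := wgt_mean_bounds z.
rewrite /walk ler_pdivrMr//; apply: le_trans S1 _; rewrite /mean0 -/F.
have -> : (1 + 4 * eps) * (space_mean F / hmean) * space_mean (wgt z) =
  space_mean F * ((1 + 4 * eps) * (space_mean (wgt z) / hmean)) by ring.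
rewrite mulrC ler_wpM2l//; have : 1 - eps <= space_mean (wgt z) / hmean by rewrite ler_pdivlMr.
by move: (_ / _) => q; nra.
Qed.

Definition walk_lower_const : R := (1 - eps) / 2 * space_mean (hump (32^-1) : V -> R) / ((1 + eps) * hmean).

Lemma walk_lower_const_gt0 : 0 < walk_lower_const.
Proof.
have /andP[e0 e1] := eps01; have h := hmean_gt0.
have k : 0 < space_mean (hump (32^-1) : V -> R) by apply: hump_mean_gt0; lra.
rewrite /walk_lower_const divr_gt0//; first by rewrite mulr_gt0// divr_gt0//; lra.
by rewrite mulr_gt0//; lra.
Qed.

(** One step of a Harnack chain. The weight dominates a small bump centred at [y]; by translation
    invariance the mass of that bump does not depend on its position, so the constant is uniform. *)
Lemma walk_lower f z y c : D z -> loc_bounded f z -> (forall y', cball z (irad z) y' -> 0 <= f y') ->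
  0 <= c -> enorm (y - z) <= irad z / 4 ->
  (forall y', enorm (y' - y) < irad z / 32 -> c <= f y') ->
  walk_lower_const * c <= walk f z.
Proof.
move=> Dz [b b0 fb] f0 c0 yz fc; have /andP[e0 e1] := eps01.
have r0 := irad_gt0 Dz.
pose a := (irad z)^-1 *: (y - z).
have aE : z + irad z *: a = y by rewrite /a scalerA divff ?gt_eqF// scale1r addrC subrK.
have a4 : enorm a <= 4^-1.
  by rewrite /a enormZ ger0_norm ?invr_ge0 ?(ltW r0)// mulrC ler_pdivrMr// mulrC.
have s01 : 0 <= (32^-1 : R) <= 1 by lra.
have T : space_mean (fun w : V => hump 32^-1 (w - a) : R) = space_mean (hump 32^-1 : V -> R).
  apply: (space_mean_translate (b := 1)).
  - by rewrite enormN; lra.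
  - by move=> w; exact: hump_norm.
  - exact: hump_unif_cont.
  - by move=> w w1; rewrite hump_out1.
have hT : bounded_by 1 (fun w : V => hump 32^-1 (w - a) : R) by move=> w; exact: hump_norm.
have hTc : bounded_by ((1 - eps) / 2 * c) (fun w : V => (1 - eps) / 2 * c * hump 32^-1 (w - a)).
  move=> w; rewrite normrM ger0_norm; last by rewrite mulr_ge0//; lra.
  by rewrite ler_piMr// ?hump_norm// mulr_ge0//; lra.
have S : (1 - eps) / 2 * c * space_mean (hump 32^-1 : V -> R) <=
     space_mean (fun w => wgt z w * f (z + irad z *: w)).
  rewrite -T -(space_meanZ _ hT); apply: (space_mean_le hTc (wgt_bounded b0 fb)) => w.
  have [w1|w1] := leP (32^-1) (enorm (w - a)).
    have -> : hump 32^-1 (w - a) = 0 :> R by apply: hump_out => //; lra.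
    rewrite mulr0.
    have [w2|w2] := leP 1 (enorm w).
      by have := wgt_norm z w; rewrite hump1_out// mulr0 normr_le0 => /eqP ->; rewrite mul0r.
    by rewrite mulr_ge0 ?wgt_ge0//; apply: f0; apply: in_cball; [exact: irad_ge0|exact: ltW].
  have w2 : enorm w < 1 / 2 by have := le_enormB w a; lra.
  have h1 : 3 / 4 <= hump 1 w.
    rewrite /hump le_max; apply/orP; right; rewrite expr1n -sqr_enorm.
    have := enorm_ge0 w; nra.
  have cf : c <= f (z + irad z *: w).
    apply: fc; rewrite -aE opprD addrACA subrr add0r -scalerBr enormZ gtr0_norm//.
    by rewrite ltr_pM2l.
  have /andP[wl _] := wgt_bounds z w.
  apply: (@le_trans _ _ ((1 - eps) / 2 * c)).
    by rewrite ler_piMr// ?mulr_ge0//; [lra|have := hump_norm (w - a) s01; rewrite ger0_norm ?hump_ge0].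
  by apply: ler_pM => //; [lra|nra].
have H0 := hmean_gt0; have W0 := wgt_mean_gt0 z; have /andP[_ W1] := wgt_mean_bounds z.
rewrite /walk ler_pdivlMr//; apply: le_trans S.
have K0 : 0 <= space_mean (hump 32^-1 : V -> R).
  by apply: (space_mean_ge0 (b := 1)) => w; [exact: hump_norm|exact: hump_ge0].
rewrite /walk_lower_const.
have e1h : 0 < (1 + eps) * hmean by rewrite mulr_gt0//; lra.
move: (space_mean (hump 32^-1)) (space_mean (wgt z)) (hmean) K0 W0 W1 H0 e1h => SK W H K0 W0 W1 H0 e1h.
have -> : (1 - eps) / 2 * SK / ((1 + eps) * H) * c * W =
   ((1 - eps) / 2 * c * SK) * W / ((1 + eps) * H) by ring.
rewrite ler_pdivrMr//.
by rewrite ler_wpM2l// !mulr_ge0//; lra.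
Qed.

Lemma harmonic_loc_bounded z : D z -> loc_bounded u z.
Proof.
move=> Dz; have [b b0 hb] := harmonic_bounded hu (irad_gt0 Dz) (irad_sub1 Dz).
by exists b => //; exact: ltW.
Qed.

(** The mean value property cancels the unbiased part and [x sg x = |x|] leaves exactly
    [- eps * ball_osc]. The factor 1/2 bounds the normalisation, since the total weight is at most
    [2 * hmean]. *)
Lemma walk_harmonic z : D z -> walk u z <= u z - eps / 2 * osc z.
Proof.
move=> Dz; have /andP[e0 e1] := eps01.
have r0 := irad_gt0 Dz; have [b b0 hb] := harmonic_loc_bounded Dz.
have hu1 : bounded_by b (fun w => hump 1 w * u (z + irad z *: w)) by apply: hump1_bounded; rewrite ?irad_ge0.
have hu2 : bounded_by (b + b) (fun w => hump 1 w * `|u (z + irad z *: w) - u z|).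
  apply: (hump1_bounded (f := fun y => `|u y - u z|)); rewrite ?irad_ge0 ?addr_ge0// => y yB.
  rewrite normr_id; apply: le_trans (ler_normB _ _) _; apply: lerD; first exact: hb.
  by apply: hb; rewrite /cball /= subrr enorm0 ltW.
have h1 : bounded_by 1 (hump 1 : V -> R) by move=> w; exact: hump1_norm.
have hw := wgt1_bounded z.
have hwu : bounded_by (2 * b) (fun w => wgt z w * u (z + irad z *: w)) by exact: wgt_bounded.
have hwz : bounded_by (`|u z| * 2) (fun w => u z * wgt z w).
  by move=> w; rewrite normrM ler_wpM2l.
have huz : bounded_by (`|u z| * 1) (fun w => u z * hump 1 w).
  by move=> w; rewrite normrM ler_wpM2l//; exact: hump1_norm.
have hue : bounded_by (eps * (b + b)) (fun w => eps * (hump 1 w * `|u (z + irad z *: w) - u z|)).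
  by move=> w; rewrite normrM (gtr0_norm e0) ler_wpM2l// ltW.
have hud : bounded_by (b + `|u z| * 1) (fun w => hump 1 w * u (z + irad z *: w) - u z * hump 1 w).
  by move=> w; apply: le_trans (ler_normB _ _) _; exact: lerD.
have E : space_mean (fun w => wgt z w * u (z + irad z *: w)) - u z * space_mean (wgt z) =
   - eps * ball_osc u z (irad z).
  rewrite -(space_meanZ _ hw) -(space_meanB hwu hwz).
  have -> : (fun w => wgt z w * u (z + irad z *: w) - u z * wgt z w) =
    (fun w => (hump 1 w * u (z + irad z *: w) - u z * hump 1 w) -
      eps * (hump 1 w * `|u (z + irad z *: w) - u z|)).
    by apply/funext => w; rewrite normrEsg /wgt; ring.
  rewrite (space_meanB hud hue) (space_meanB hu1 huz) !(space_meanZ _ h1) (space_meanZ _ hu2).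
  rewrite (harmonic_mean_value hu r0 (s := 1)); first by rewrite subrr sub0r mulNr.
    by rewrite ler01 lexx.
  by move=> y yB; apply: (irad_sub Dz); apply: le_trans yB _; lra.
have W0 := wgt_mean_gt0 z; have /andP[_ W1] := wgt_mean_bounds z; have H0 := hmean_gt0.
have B0 : 0 <= ball_osc u z (irad z).
  by apply: (space_mean_ge0 hu2) => w; rewrite mulr_ge0 ?hump_ge0.
rewrite /walk ler_pdivrMr// mulrBl /osc.
move/eqP: E; rewrite subr_eq => /eqP ->; rewrite addrC lerD2l mulNr lerN2.
have -> : eps / 2 * (ball_osc u z (irad z) / hmean) * space_mean (wgt z) =
  eps * ball_osc u z (irad z) * (space_mean (wgt z) / hmean / 2) by ring.
rewrite ler_piMr ?mulr_ge0 ?(ltW e0)// ler_pdivrMr// mul1r ler_pdivrMr//.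
by apply: le_trans W1 _; rewrite ler_wpM2r ?(ltW H0)//; lra.
Qed.

End MarkovOperator.

(** * Barriers in a cone *)

Section PowerFunctions.
Context {R : realType} {d : nat}.
Local Notation V := 'rV[R]_d.
Implicit Types (f g phi : V -> R) (x y z w v : V) (i j : 'I_d) (a b c s t h k m q r : R).

Lemma is_derive_of_line phi x v (l : R) :
  is_derive (0 : R) 1 (fun t : R => phi (x + t *: v)) l -> is_derive x v phi l.
Proof.
move=> [dg dl].
have E : (fun h : R => h^-1 *: ((phi \o shift x) (h *: v) - phi x)) =
  (fun h : R => h^-1 *: (((fun t : R => phi (x + t *: v)) \o shift 0) (h *: (1 : R)) -
    phi (x + 0 *: v))).
  by apply/funext => h /=; rewrite [h *: 1]mulr1 addr0 scale0r addr0 [h *: v + x]addrC.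
by split; [rewrite /derivable E|rewrite -dl /derive E].
Qed.

Lemma is_derive_comp1 (g : R -> R) f x v (k l : R) : is_derive (f x) 1 g k -> is_derive x v f l ->
  is_derive x v (fun y => g (f y)) (k * l).
Proof.
move=> dg df; apply: is_derive_of_line.
apply: (@is_derive1_comp _ g (fun t : R => f (x + t *: v))); last first.
  by apply: is_derive_line; rewrite scale0r addr0.
by rewrite scale0r addr0.
Qed.

Lemma is_derive_unique x v f (l l' : R) : is_derive x v f l -> l = l' -> is_derive x v f l'.
Proof. by move=> H <-. Qed.

Lemma is_derive_dotr w v e : is_derive w v (fun y => dot y e) (dot v e).
Proof.
apply: is_derive_of_line.
have -> : (fun t : R => dot (w + t *: v) e) = (fun t : R => dot w e + t * dot v e).
  by apply/funext => t; rewrite dotDl dotZl.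
apply: is_derive_eq; rewrite add0r /GRing.scale /=; ring.
Qed.

Lemma is_derive_dotxx w v : is_derive w v (fun y => dot y y) (2 * dot w v).
Proof.
apply: is_derive_of_line.
have -> : (fun t : R => dot (w + t *: v) (w + t *: v)) =
   (fun t : R => dot w w + t * (2 * dot w v) + t * (t * dot v v)).
  by apply/funext => t; rewrite dotDl !dotDr !dotZl !dotZr (dotC v w); ring.
apply: is_derive_eq; rewrite add0r /GRing.scale /=; ring.
Qed.

Lemma is_derive_enorm w i : w != 0 -> is_derive w (ebase i) (@enorm R d) (w ord0 i / enorm w).
Proof.
move=> w0; have w1 := enorm_gt0 w0.
have dd : 0 < dot w w by rewrite -sqr_enorm exprn_gt0.
have := @is_derive_comp1 Num.sqrt (fun y => dot y y) _ _ _ _ (is_derive1_sqrt dd) (is_derive_dotxx w (ebase i)).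
move/is_derive_unique; apply; rewrite dot_ebase -enormE.
by field; rewrite gt_eqF.
Qed.

Variable e : V.
Hypothesis e1 : dot e e = 1.

Definition tilt w : R := enorm w + dot w e.

Lemma tilt_gt0_neq0 w : 0 < tilt w -> w != 0.
Proof.
apply: contraL => /eqP ->; rewrite /tilt enorm0 add0r -[0 : V](scale0r 0) dotZl mul0r.
by rewrite ltxx.
Qed.

Lemma tilt_le w : tilt w <= 2 * enorm w.
Proof.
have := dot_le w e; rewrite [enorm e]enormE e1 sqrtr1 mulr1 /tilt; lra.
Qed.

(** Combinations of these with coordinates as coefficients are closed under differentiation, and
    their Laplacians are again combinations of such powers. This gives functions of the angle,
    [tilt w = |w| (1 + cos theta)], without spherical coordinates. *)
Definition rx m a w : R := enorm w `^ m * tilt w `^ a.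

Definition drx m a i w : R :=
  w ord0 i * (m * rx (m - 2) a w + a * rx (m - 1) (a - 1) w) + a * e ord0 i * rx m (a - 1) w.

Definition d2rx m a i w : R :=
  (m * rx (m - 2) a w + a * rx (m - 1) (a - 1) w)
  + w ord0 i * (m * drx (m - 2) a i w + a * drx (m - 1) (a - 1) i w)
  + a * e ord0 i * drx m (a - 1) i w.

Lemma powR_pred t m : 0 < t -> t `^ m = t `^ (m - 1) * t.
Proof.
move=> t0; have h : (m - 1 + 1 == 0) ==> (t != 0) by apply/implyP => _; rewrite gt_eqF.
by rewrite -{1}[m](subrK 1) (powRD h) powRr1// ltW.
Qed.

Lemma is_derive_rx m a i w : 0 < tilt w -> is_derive w (ebase i) (rx m a) (drx m a i w).
Proof.
move=> t0; have w0 := tilt_gt0_neq0 t0; have n0 := enorm_gt0 w0.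
have dn := is_derive_enorm i w0.
have dt : is_derive w (ebase i) tilt (w ord0 i / enorm w + e ord0 i).
  have := is_deriveD dn (is_derive_dotr w (ebase i) e).
  by move/is_derive_unique; apply; rewrite (dotC (ebase i)) dot_ebase.
have d1 := is_derive_comp1 (is_derive1_powR m n0) dn.
have d2 := is_derive_comp1 (is_derive1_powR a t0) dt.
have := is_deriveM d1 d2; move/is_derive_unique; apply.
rewrite /drx /rx /GRing.scale /=.
rewrite (powR_pred m n0) (powR_pred (m - 1) n0) (powR_pred a t0).
have -> : m - 1 - 1 = m - 2 by ring.
by field; rewrite gt_eqF.
Qed.

Lemma is_derive_coord w i j : is_derive w (ebase i) (fun y => y ord0 j) ((i == j)%:R).
Proof.
have -> : (fun y : V => y ord0 j) = (fun y => dot y (ebase j)) by apply/funext => y; rewrite dot_ebase.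
by have := is_derive_dotr w (ebase i) (ebase j); rewrite dot_ebase ebaseE.
Qed.

Lemma is_derive_drx m a i w : 0 < tilt w -> is_derive w (ebase i) (drx m a i) (d2rx m a i w).
Proof.
move=> t0.
have D1 := is_deriveM (is_derive_coord w i i)
  (is_deriveD (is_deriveZ m (is_derive_rx (m - 2) a i t0)) (is_deriveZ a (is_derive_rx (m - 1) (a - 1) i t0))).
have D2 := is_deriveZ (a * e ord0 i) (is_derive_rx m (a - 1) i t0).
have := is_deriveD D1 D2; move/is_derive_unique; apply.
rewrite eqxx; transitivity (w ord0 i * (m * drx (m - 2) a i w + a * drx (m - 1) (a - 1) i w) +
  (m * rx (m - 2) a w + a * rx (m - 1) (a - 1) w) * 1 + a * e ord0 i * drx m (a - 1) i w) => //.
by rewrite /d2rx; ring.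
Qed.

Lemma continuous_dotr : continuous (fun w : V => dot w e).
Proof.
move=> w; apply/continuous_enormP => eta eta0.
have k : 0 < enorm e + 1 by rewrite ltr_wpDl.
exists (eta / (enorm e + 1)); first by rewrite divr_gt0.
move=> y; rewrite ltr_pdivlMr// -dotBl; apply: le_lt_trans.
by apply: le_trans (cauchy_schwarz _ _) _; rewrite ler_wpM2l// lerDl.
Qed.

Lemma continuous_rx m a w : 0 < tilt w -> {for w, continuous (rx m a)}.
Proof.
move=> t0; have n0 := enorm_gt0 (tilt_gt0_neq0 t0).
have cp b (s : R) : 0 < s -> {for s, continuous (fun t : R => t `^ b)}.
  move=> s0; apply: differentiable_continuous; apply/derivable1_diffP.
  by have [] := is_derive1_powR b s0.
have cn : {for w, continuous (fun y => enorm y `^ m)}.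
  by apply: (@continuous_comp _ _ _ (@enorm R d) (fun t : R => t `^ m)); [exact: continuous_enorm|exact: cp].
have ct : {for w, continuous (fun y => tilt y `^ a)}.
  apply: (@continuous_comp _ _ _ tilt (fun t : R => t `^ a)); last exact: cp.
  exact: (cvgD (@continuous_enorm R d w) (@continuous_dotr w)).
exact: (cvgM cn ct).
Qed.

Lemma continuous_coord i w : {for w, continuous (fun y : V => y ord0 i)}.
Proof.
apply/continuous_enormP => eta eta0; exists eta => // y; apply: le_lt_trans.
by have := coord_le_enorm (y - w) i; rewrite !mxE.
Qed.

Lemma continuous_drx m a i w : 0 < tilt w -> {for w, continuous (drx m a i)}.
Proof.
move=> t0; have A := @continuous_rx (m - 2) a w t0.
have B := @continuous_rx (m - 1) (a - 1) w t0; have C := @continuous_rx m (a - 1) w t0.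
exact: (cvgD (cvgM (@continuous_coord i w) (cvgD (cvgM (cvg_cst m) A) (cvgM (cvg_cst a) B)))
  (cvgM (cvg_cst _) C)).
Qed.

Lemma continuous_d2rx m a i w : 0 < tilt w -> {for w, continuous (d2rx m a i)}.
Proof.
move=> t0; have A := @continuous_rx (m - 2) a w t0.
have B := @continuous_rx (m - 1) (a - 1) w t0; have A' := @continuous_drx (m - 2) a i w t0.
have B' := @continuous_drx (m - 1) (a - 1) i w t0; have C := @continuous_drx m (a - 1) i w t0.
exact: (cvgD (cvgD (cvgD (cvgM (cvg_cst m) A) (cvgM (cvg_cst a) B))
  (cvgM (@continuous_coord i w) (cvgD (cvgM (cvg_cst m) A') (cvgM (cvg_cst a) B'))))
  (cvgM (cvg_cst _) C)).
Qed.

Lemma C2_with_rx m a (S : set V) : (forall w, S w -> 0 < tilt w) ->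
  C2_with S (rx m a) (drx m a) (d2rx m a).
Proof.
move=> St w /St t0; split; first exact: continuous_rx.
move=> i; split; [exact: continuous_drx|exact: continuous_d2rx|exact: is_derive_rx|exact: is_derive_drx].
Qed.

Lemma sum_coord_drx m a w : 0 < tilt w ->
  \sum_(i < d) w ord0 i * drx m a i w = (m + a) * rx m a w.
Proof.
move=> t0; have n0 := enorm_gt0 (tilt_gt0_neq0 t0).
have -> : \sum_(i < d) w ord0 i * drx m a i w =
  dot w w * (m * rx (m - 2) a w + a * rx (m - 1) (a - 1) w) + a * dot w e * rx m (a - 1) w.
  have -> : a * dot w e * rx m (a - 1) w = \sum_(i < d) a * (w ord0 i * e ord0 i) * rx m (a - 1) w.
    by rewrite /dot mulr_sumr mulr_suml.
  rewrite {1}/dot mulr_suml -big_split /=; apply: eq_bigr => i _.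
  by rewrite /drx; ring.
have -> : dot w e = tilt w - enorm w by rewrite /tilt addrC addKr.
rewrite -sqr_enorm /rx.
rewrite (powR_pred m n0) (powR_pred (m - 1) n0) (powR_pred a t0).
have -> : m - 1 - 1 = m - 2 by ring.
by ring.
Qed.

Lemma sum_dir_drx m a w : \sum_(i < d) e ord0 i * drx m a i w =
  (tilt w - enorm w) * (m * rx (m - 2) a w + a * rx (m - 1) (a - 1) w) + a * rx m (a - 1) w.
Proof.
have -> : tilt w - enorm w = dot w e by rewrite /tilt addrC addKr.
have -> : a * rx m (a - 1) w = \sum_(i < d) (e ord0 i * e ord0 i) * (a * rx m (a - 1) w).
  by rewrite -mulr_suml -/(dot e e) e1 mul1r.
rewrite /dot mulr_suml -big_split /=; apply: eq_bigr => i _.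
by rewrite /drx; ring.
Qed.

Lemma laplacian_rx m a w : 0 < tilt w ->
  \sum_(i < d) d2rx m a i w = m * (m + d%:R - 2 + 2 * a) * rx (m - 2) a w
     + a * (d%:R - 3 + 2 * a) * rx (m - 1) (a - 1) w.
Proof.
move=> t0; have n0 := enorm_gt0 (tilt_gt0_neq0 t0).
have -> : \sum_(i < d) d2rx m a i w =
  d%:R * (m * rx (m - 2) a w + a * rx (m - 1) (a - 1) w)
  + m * (\sum_(i < d) w ord0 i * drx (m - 2) a i w)
  + a * (\sum_(i < d) w ord0 i * drx (m - 1) (a - 1) i w)
  + a * (\sum_(i < d) e ord0 i * drx m (a - 1) i w).
  have -> : d%:R * (m * rx (m - 2) a w + a * rx (m - 1) (a - 1) w) =
     \sum_(i < d) (m * rx (m - 2) a w + a * rx (m - 1) (a - 1) w).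
    by rewrite sumr_const card_ord mulr_natl.
  rewrite !mulr_sumr -!big_split /=; apply: eq_bigr => i _; rewrite /d2rx; ring.
rewrite !sum_coord_drx// sum_dir_drx /rx.
rewrite (powR_pred m n0) (powR_pred (m - 1) n0) (powR_pred a t0) (powR_pred (a - 1) t0).
have -> : m - 1 - 1 = m - 2 by ring.
by ring.
Qed.

End PowerFunctions.

Section Barriers.
Context {R : realType} {d : nat}.
Local Notation V := 'rV[R]_d.
Implicit Types (f g phi : V -> R) (x y z w v : V) (i j : 'I_d) (a b c s t h k m q r eta tau beta sigma : R).
Variable e : V.
Hypothesis e1 : dot e e = 1.

Lemma rx_ratio m a w : 0 < tilt e w ->
  rx e m a w = enorm w `^ (m + a) * (tilt e w / enorm w) `^ a.
Proof.
move=> t0; have n0 := enorm_gt0 (tilt_gt0_neq0 t0).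
have h : (m + a == 0) ==> (enorm w != 0) by apply/implyP => _; rewrite gt_eqF.
rewrite /rx (powRD h) powRM ?invr_ge0 ?ltW// -mulrA; congr (_ * _).
rewrite mulrCA -[(enorm w)^-1]powR_inv1 ?ltW// -powRrM mulN1r powRN.
by rewrite divff ?mulr1// gt_eqF// powR_gt0.
Qed.

(** Homogeneous of degree [q]: it equals [|w|^q (k + b r^a)] with [r = 1 + cos theta], which runs
    through [[c, 2]] in the cone. *)
Definition barrier k b q a w : R := k * rx e q 0 w + b * rx e (q - a) a w.
Definition dbarrier k b q a i w : R := k * drx e q 0 i w + b * drx e (q - a) a i w.
Definition d2barrier k b q a i w : R := k * d2rx e q 0 i w + b * d2rx e (q - a) a i w.

Lemma C2_with_barrier k b q a (S : set V) : (forall w, S w -> 0 < tilt e w) ->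
  C2_with S (barrier k b q a) (dbarrier k b q a) (d2barrier k b q a).
Proof.
move=> St w Sw.
have [A Ai] := C2_with_rx q 0 St Sw; have [B Bi] := C2_with_rx (q - a) a St Sw.
split; first exact: (cvgD (cvgM (cvg_cst k) A) (cvgM (cvg_cst b) B)).
move=> i; have [a1 a2 a3 a4] := Ai i; have [b1 b2 b3 b4] := Bi i; split.
- exact: (cvgD (cvgM (cvg_cst k) a1) (cvgM (cvg_cst b) b1)).
- exact: (cvgD (cvgM (cvg_cst k) a2) (cvgM (cvg_cst b) b2)).
- exact: (is_deriveD (is_deriveZ k a3) (is_deriveZ b b3)).
- exact: (is_deriveD (is_deriveZ k a4) (is_deriveZ b b4)).
Qed.

Lemma barrierE k b q a w : 0 < tilt e w ->
  barrier k b q a w = enorm w `^ q * (k + b * (tilt e w / enorm w) `^ a).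
Proof.
move=> t0; rewrite /barrier (rx_ratio _ _ t0) (rx_ratio (q - a) a t0) addr0 powRr0 subrK mulr1.
by ring.
Qed.

Lemma laplacian_barrier k b q a w : 0 < tilt e w ->
  \sum_(i < d) d2barrier k b q a i w = enorm w `^ (q - 2) * (k * (q * (q + d%:R - 2))
    + b * (tilt e w / enorm w) `^ a * ((q - a) * (q + a + d%:R - 2)
       + a * (d%:R - 3 + 2 * a) / (tilt e w / enorm w))).
Proof.
move=> t0; have n0 := enorm_gt0 (tilt_gt0_neq0 t0).
have r0 : 0 < tilt e w / enorm w by rewrite divr_gt0.
rewrite /d2barrier big_split /= -!mulr_sumr !laplacian_rx//.
rewrite (rx_ratio (q - 2) 0 t0) (rx_ratio (q - a - 2) a t0) (rx_ratio (q - a - 1) (a - 1) t0).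
rewrite (powR_pred a r0) addr0 powRr0.
have -> : q - a - 2 + a = q - 2 by ring.
have -> : q - a - 1 + (a - 1) = q - 2 by ring.
move: (tilt e w / enorm w) r0 => r r0.
by field; rewrite gt_eqF.
Qed.

Variable c : R.
Hypothesis c01 : 0 < c <= 1.

Definition in_cone w : Prop := 0 < enorm w /\ c * enorm w <= tilt e w.

Lemma in_cone_tilt w : in_cone w -> 0 < tilt e w.
Proof. by move=> [w0 h]; apply: lt_le_trans h; rewrite mulr_gt0//; case/andP: c01. Qed.

Lemma in_cone_ratio w : in_cone w -> c <= tilt e w / enorm w <= 2.
Proof.
by move=> [w0 h]; rewrite ler_pdivlMr// h/= ler_pdivrMr// tilt_le.
Qed.

Lemma powRN_bounds b r : 0 <= b -> c <= r <= 2 -> 2 `^ (- b) <= r `^ (- b) <= c `^ (- b).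
Proof.
move=> b0 /andP[cr r2]; case/andP: c01 => c0 c1.
have r0 : 0 < r by exact: lt_le_trans cr.
rewrite !powRN !lef_pV2 ?posrE ?powR_gt0//.
by rewrite !ge0_ler_powR ?nnegrE// ltW.
Qed.

(** Take [|w|^beta (A - r^(-b))] with [b = (d - 1)/2]. Up to the factor [|w|^(beta - 2)], the
    Laplacian of the second term is [- r^(-b)] times [(beta + b)(beta + b - 1) + 2 b / r], a bracket
    that is at least 1/4 because [x (x - 1) >= -1/4] and [2 b / r >= b >= 1/2]. The radial term is
    only of order [beta]. *)
Lemma subharmonic_power_barrier : (1 < d)%N ->
  exists beta A k (G : V -> R) (G1 G2 : 'I_d -> V -> R),
  [/\ 0 < beta <= 2^-1, 0 < k,
      C2_with [set w | in_cone w] G G1 G2,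
      forall w, in_cone w -> enorm w `^ beta <= G w <= A * enorm w `^ beta &
      forall w, in_cone w -> \sum_(i < d) G2 i w <= - (k * enorm w `^ (beta - 2))].
Proof.
move=> d2; have d2' : 2 <= d%:R :> R by rewrite ler_nat.
case/andP: (c01) => c0 c1.
pose b : R := (d%:R - 1) / 2.
have b1 : 1 / 2 <= b by rewrite /b; lra.
have dE : d%:R = 2 * b + 1 by rewrite /b; field.
pose A := c `^ (- b) + 1.
have p0 : 0 < c `^ (- b) by rewrite powR_gt0.
have A1 : 1 <= A by rewrite /A; lra.
pose t := 2 `^ (- b) : R.
have t0 : 0 < t by rewrite powR_gt0.
have Ad : 0 < 8 * A * (2 * b) by rewrite !mulr_gt0//; lra.
(* Makes the radial term at most [t / 8], half of the gain [t / 4] of the angular term. *)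
pose beta := Num.min 2^-1 (t / (8 * A * (2 * b))).
have beta0 : 0 < beta by rewrite lt_min invr_gt0 ltr0n/= divr_gt0.
have beta1 : beta <= 2^-1 by rewrite ge_min lexx.
have betat : beta * (8 * A * (2 * b)) <= t.
  by rewrite -ler_pdivlMr// ge_min lexx orbT.
exists beta, A, (t / 8), (barrier A (-1) beta (- b)), (dbarrier A (-1) beta (- b)), (d2barrier A (-1) beta (- b)).
have wb w : in_cone w -> t <= (tilt e w / enorm w) `^ (- b) <= c `^ (- b).
  by move=> wc; apply: powRN_bounds; [lra|exact: in_cone_ratio].
split.
- by rewrite beta0.
- by rewrite divr_gt0.
- by apply: C2_with_barrier => w; exact: in_cone_tilt.
- move=> w wc; rewrite barrierE ?in_cone_tilt//; have /andP[w1 w2] := wb w wc.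
  rewrite mulrC [A * _]mulrC mulN1r; apply/andP; split.
    by rewrite mulrC ler_peMr ?powR_ge0//; rewrite /A; lra.
  by rewrite mulrC ler_wpM2l ?powR_ge0//; lra.
move=> w wc; rewrite laplacian_barrier ?in_cone_tilt//; have /andP[w1 w2] := wb w wc.
have /andP[r1 r2] := in_cone_ratio wc.
move: (tilt e w / enorm w) (enorm w `^ (beta - 2)) (powR_ge0 (enorm w) (beta - 2)) w1 w2 r1 r2.
move=> r p pp; move: (r `^ (- b)) => P P1 P2 r1 r2.
have -> : - (t / 8 * p) = p * (- (t / 8)) by ring.
rewrite ler_wpM2l//.
have r0 : 0 < r by exact: lt_le_trans r1.
have -> : - b * (d%:R - 3 + 2 * - b) = 2 * b by rewrite dE; ring.
have -> : beta + - b + d%:R - 2 = beta + b - 1 by rewrite dE; ring.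
have -> : beta + d%:R - 2 = beta + 2 * b - 1 by rewrite dE; ring.
rewrite opprK.
have h1 : b <= 2 * b / r by rewrite ler_pdivlMr//; nra.
have h2 : 4^-1 <= (beta + b) * (beta + b - 1) + 2 * b / r.
  have := sqr_ge0 (beta + b - 2^-1); nra.
have h3 : t / 4 <= P * ((beta + b) * (beta + b - 1) + 2 * b / r).
  by rewrite ler_pM//; lra.
have h4 : A * (beta * (beta + 2 * b - 1)) <= A * (beta * (2 * b)).
  by rewrite ler_wpM2l ?(le_trans ler01)// ler_wpM2l ?(ltW beta0)//; lra.
by move: h3 h4 betat; rewrite mulN1r mulNr; move: (P * _) => X; lra.
Qed.

Lemma superharmonic_power_barrier : (1 < d)%N ->
  exists sigma k1 k2 (G : V -> R) (G1 G2 : 'I_d -> V -> R),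
  [/\ (d%:R - 1) / 2 < sigma, 0 < k1,
      C2_with [set w | in_cone w] G G1 G2,
      forall w, in_cone w -> k1 * enorm w `^ (- sigma) <= G w <= k2 * enorm w `^ (- sigma) &
      forall w, in_cone w -> \sum_(i < d) G2 i w <= 0].
Proof.
move=> d2; case/andP: (c01) => c0 c1.
have [d3|] := boolP (2 < d)%N; last first.
  (* In the plane [r^(1/2)] is a multiple of [cos (theta / 2)], and [|w|^(-1/2) r^(1/2)] is harmonic
     off the ray opposite to [e]. Raising the decay by [tau] costs at most [4 tau = eta / 4];
     subtracting [eta |w|^(-sigma)] gains [eta sigma^2 >= eta / 4], and since [r^(1/2) >= 2 eta] the
     function stays positive. *)
  rewrite -leqNgt => d2'; have dE : d%:R = 2 :> R by congr _%:R; apply/eqP; rewrite eqn_leq d2'.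
  pose s := c `^ (2^-1).
  have s0 : 0 < s by rewrite powR_gt0.
  have s1 : s <= 1.
    have := @ge0_ler_powR R 2^-1 _ c 1; rewrite powR1; apply; rewrite ?nnegrE ?invr_ge0//; exact: ltW.
  pose eta := s / 2; pose tau := eta / 16; pose sigma := 2^-1 + tau.
  exists sigma, eta, 2, (barrier (- eta) 1 (- sigma) (2^-1)), (dbarrier (- eta) 1 (- sigma) (2^-1)),
    (d2barrier (- eta) 1 (- sigma) (2^-1)).
  have wb w : in_cone w -> s <= (tilt e w / enorm w) `^ (2^-1) <= 2.
    move=> wc; have /andP[r1 r2] := in_cone_ratio wc; apply/andP; split.
      by apply: ge0_ler_powR; rewrite ?nnegrE ?invr_ge0//; [exact: ltW|apply: le_trans r1; exact: ltW].
    apply: (@le_trans _ _ (2 `^ (2^-1))).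
      by apply: ge0_ler_powR; rewrite ?nnegrE ?invr_ge0//; apply: le_trans r1; exact: ltW.
    by apply: ler1_powR; lra.
  split.
  - by rewrite dE /sigma /tau /eta; lra.
  - by rewrite divr_gt0.
  - by apply: C2_with_barrier => w; exact: in_cone_tilt.
  - move=> w wc; rewrite barrierE ?in_cone_tilt//; have /andP[w1 w2] := wb w wc.
    by rewrite [_ * (- eta + _)]mulrC !ler_wpM2r ?powR_ge0//; rewrite /eta; lra.
  move=> w wc; rewrite laplacian_barrier ?in_cone_tilt//; have /andP[w1 w2] := wb w wc.
  rewrite mulr_ge0_le0 ?powR_ge0//; move: (_ `^ 2^-1) w1 w2 => P w1 w2.
  rewrite dE.
  have -> : 2^-1 * (2 - 3 + 2 * 2^-1) = 0 :> R by field.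
  have -> : - sigma * (- sigma + 2 - 2) = sigma * sigma by ring.
  have -> : (- sigma - 2^-1) * (- sigma + 2^-1 + 2 - 2) = tau * (1 + tau).
    by rewrite /sigma; field.
  rewrite mul0r addr0 mul1r.
  have t0 : 0 <= tau by rewrite /tau /eta; lra.
  have t1 : tau <= 1 by rewrite /tau /eta; lra.
  have h1 : P * (tau * (1 + tau)) <= 2 * (tau * 2).
    apply: ler_pM => //; [lra|by rewrite mulr_ge0//; lra|by rewrite ler_wpM2l//; lra].
  have h2 : 4^-1 <= sigma * sigma by rewrite /sigma; nra.
  have h3 : eta * 4^-1 <= eta * (sigma * sigma) by rewrite ler_wpM2l// /eta; lra.
  by move: h1 h3; rewrite /tau mulNr; lra.
(* For [d >= 3] the function is [|w|^(-sigma) (A - r^(-b))]. The angular term gains at least [t b];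
   the radial term [A sigma (sigma - d + 2)] is at most [A (b + 1) tau] because [b >= 1], and [tau]
   is chosen to keep this below the gain. *)
have d3' : 3 <= d%:R :> R by rewrite ler_nat.
pose b : R := (d%:R - 1) / 2.
have b1 : 1 <= b by rewrite /b; lra.
have dE : d%:R = 2 * b + 1 by rewrite /b; field.
pose A := c `^ (- b) + 1.
have p0 : 0 < c `^ (- b) by rewrite powR_gt0.
have A1 : 1 <= A by rewrite /A; lra.
pose t := 2 `^ (- b) : R.
have t0 : 0 < t by rewrite powR_gt0.
have Ad : 0 < A * (b + 1) by rewrite !mulr_gt0//; lra.
pose tau := Num.min 1 (t * b / (A * (b + 1))).
have tau0 : 0 < tau by rewrite lt_min ltr01/= divr_gt0// mulr_gt0//; lra.
have tau1 : tau <= 1 by rewrite ge_min lexx.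
have taut : tau * (A * (b + 1)) <= t * b.
  by rewrite -ler_pdivlMr// ge_min lexx orbT.
pose sigma := b + tau.
exists sigma, 1, A, (barrier A (-1) (- sigma) (- b)), (dbarrier A (-1) (- sigma) (- b)),
  (d2barrier A (-1) (- sigma) (- b)).
have wb w : in_cone w -> t <= (tilt e w / enorm w) `^ (- b) <= c `^ (- b).
  by move=> wc; apply: powRN_bounds; [lra|exact: in_cone_ratio].
split=> //.
- by rewrite -/b /sigma; lra.
- by apply: C2_with_barrier => w; exact: in_cone_tilt.
- move=> w wc; rewrite barrierE ?in_cone_tilt//; have /andP[w1 w2] := wb w wc.
  by rewrite [_ * (A + _)]mulrC !ler_wpM2r ?powR_ge0//; rewrite /A; lra.
move=> w wc; rewrite laplacian_barrier ?in_cone_tilt//; have /andP[w1 w2] := wb w wc.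
have /andP[r1 r2] := in_cone_ratio wc.
rewrite mulr_ge0_le0 ?powR_ge0//.
move: (tilt e w / enorm w) w1 w2 r1 r2.
move=> r; move: (r `^ (- b)) => P P1 P2 r1 r2.
have r0 : 0 < r by exact: lt_le_trans r1.
have -> : - b * (d%:R - 3 + 2 * - b) = 2 * b by rewrite dE; ring.
have -> : - sigma * (- sigma + d%:R - 2) = (b + tau) * (tau - (b - 1)) by rewrite dE /sigma; ring.
have -> : (- sigma - - b) * (- sigma + - b + d%:R - 2) = tau * (tau + 1).
  by rewrite dE /sigma; ring.
have h1 : b <= 2 * b / r by rewrite ler_pdivlMr//; nra.
have h2 : b <= tau * (tau + 1) + 2 * b / r by nra.
have h3 : t * b <= P * (tau * (tau + 1) + 2 * b / r) by rewrite ler_pM//; lra.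
have h4 : (b + tau) * (tau - (b - 1)) <= (b + 1) * tau by nra.
have h5 : A * ((b + tau) * (tau - (b - 1))) <= A * ((b + 1) * tau) by rewrite ler_wpM2l//; lra.
by move: h3 h5 taut; rewrite mulN1r mulNr; move: (P * _) => X; lra.
Qed.

End Barriers.

(** * Potentials built from the barriers, and the decay of [g] *)

Section ConePotentials.
Context {R : realType} {d : nat}.
Local Notation V := 'rV[R]_d.
Implicit Types (f phi : V -> R) (x y z w p : V) (i j : 'I_d) (b s t h m q r eta tau : R).

Definition hump2_ratio : R := space_mean (hump2 1 : V -> R) / @hmean R d.

Lemma hump2_ratio_gt0 : 0 < hump2_ratio.
Proof.
rewrite divr_gt0 ?hmean_gt0//.
have H := @hump_mean_gt0 R d (2^-1) _.
have h0 : 0 < space_mean (hump 2^-1 : V -> R) by apply: H; lra.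
have hb : bounded_by 1 (hump 2^-1 : V -> R) by move=> w; apply: hump_norm; lra.
have hb' : bounded_by (8^-1 * 1) (fun w : V => 8^-1 * hump 2^-1 w : R).
  by move=> w; rewrite normrM ger0_norm ?invr_ge0// ler_wpM2l ?invr_ge0.
apply: (@lt_le_trans _ _ (8^-1 * space_mean (hump 2^-1 : V -> R))).
  by rewrite mulr_gt0// invr_gt0.
rewrite -(space_meanZ _ hb); apply: (@space_mean_le _ _ _ _ _ 1 hb').
  by move=> w; apply: hump2_norm; rewrite ler01 lexx.
move=> w; rewrite /hump2.
have [w1|w1] := leP 2^-1 (enorm w).
  have -> : hump 2^-1 w = 0 :> R by apply: hump_out => //; lra.
  by rewrite mulr0 divr_ge0// sqr_ge0.
have h1 : 3 / 4 <= hump 1 w.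
  rewrite /hump le_max; apply/orP; right; rewrite expr1n -sqr_enorm.
  have := enorm_ge0 w; nra.
have h2 : hump 2^-1 w <= 4^-1 :> R.
  by apply: le_trans (hump_le _ _) _; rewrite expr2; lra.
by move: (hump 1 w) h1 (hump 2^-1 w) h2 => p h1 q h2; nra.
Qed.

Variables (D : set V) (u : V -> R) (eps : R).
Hypotheses (oD : open D) (hu : harmonic_on D u) (eps01 : 0 < eps <= 2^-1).
Variables (x0 e : V) (c r1 : R).
Hypotheses (e1 : dot e e = 1) (c01 : 0 < c <= 1) (r10 : 0 < r1) (r11 : r1 <= 4^-1) (x0D : ~ D x0).
Hypothesis Hcone : forall p z, ~ D p -> enorm (p - x0) < 10 * r1 -> D z ->
  enorm (z - x0) < 10 * r1 -> in_cone e c (z - p).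

Local Notation bdist := (bdist D).
Local Notation irad := (irad D).
Local Notation walk := (walk D u eps).
Local Notation mean0 := (mean0 D).

Let nD : exists p, ~ D p. Proof. by exists x0. Qed.

(** First of three nested radii: since [irad z < r1 / 4] here, one step of the walk ends within
    [3 r1]; the radius [10 r1] is where the cone condition holds, for poles and for doubled
    balls. *)
Definition inside z : Prop := D z /\ enorm (z - x0) < 2 * r1.

Lemma inside_bdist z : inside z -> bdist z < 2 * r1.
Proof. by move=> [_ zx]; apply: le_lt_trans zx; apply: bdist_le. Qed.

Lemma inside_ball z y : inside z -> cball z (irad z) y -> D y /\ enorm (y - x0) < 3 * r1.
Proof.
move=> [Dz zx] yB; split; first exact: (irad_sub1 oD nD Dz).
apply: le_lt_trans (enorm_triB _ z _) _.
have := bdist_le nD z x0D; have := bdist_ge0 nD z; move: yB; rewrite /cball /= /irad; lra.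
Qed.

Lemma inside_ball2 z y : inside z -> cball z (2 * irad z) y -> D y /\ enorm (y - x0) < 10 * r1.
Proof.
move=> [Dz zx] yB; split.
  by apply: (irad_sub oD nD Dz); apply: le_trans yB _; have := irad_ge0 nD z; lra.
apply: le_lt_trans (enorm_triB _ z _) _.
have := bdist_le nD z x0D; have := bdist_ge0 nD z; move: yB; rewrite /cball /= /irad; lra.
Qed.

Lemma bdist_ball z y : cball z (irad z) y -> 7 / 8 * bdist z <= bdist y <= 9 / 8 * bdist z.
Proof.
move=> yB; have := bdist_lip nD z y; have := bdist_lip nD y z.
by rewrite (enormB z); move: yB; rewrite /cball /= /irad; lra.
Qed.

Lemma mean0_le f g z : loc_bounded D f z -> loc_bounded D g z ->
  (forall y, cball z (irad z) y -> f y <= g y) -> mean0 f z <= mean0 g z.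
Proof.
move=> [b b0 fb] [b' b'0 gb] fg; rewrite /mean0 ler_pM2r ?invr_gt0 ?hmean_gt0//.
have rz := irad_ge0 nD z.
apply: (space_mean_le (hump1_bounded rz b0 fb) (hump1_bounded rz b'0 gb)) => w.
have [w1|w1] := leP 1 (enorm w); first by rewrite hump1_out// !mul0r.
by rewrite ler_wpM2l ?hump_ge0//; apply: fg; apply: in_cball => //; exact: ltW.
Qed.

Section WithBarrier.
Variables (G : V -> R) (G1 G2 : 'I_d -> V -> R).
Hypothesis GC2 : C2_with [set w | in_cone e c w] G G1 G2.

Lemma barrier_loc_bounded z p : inside z -> ~ D p -> enorm (p - x0) < 10 * r1 ->
  loc_bounded D (fun y => G (y - p)) z.
Proof.
move=> nz np px.
have [b b0 hb] : exists2 b : R, 0 < b & forall y, cball (z - p) (irad z) y -> `|G y| <= b.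
  apply: compact_bounded_fun; first exact: cball_compact.
  move=> y yB; have yB' : cball z (2 * irad z) (y + p).
    move: yB; rewrite /cball /= opprB addrA => /le_trans; apply.
    by have := irad_ge0 nD z; lra.
  have [Dy yx] := inside_ball2 nz yB'.
  have := Hcone np px Dy yx; rewrite addrK => yc.
  by have [] := GC2 yc.
exists b; first exact: ltW.
by move=> y yB; apply: hb; move: yB; rewrite /cball /= opprB addrA subrK.
Qed.

Lemma mean0_barrier z p m : inside z -> ~ D p -> enorm (p - x0) < 10 * r1 ->
  (forall w, in_cone e c w -> cball (z - p) (irad z) w -> \sum_(i < d) G2 i w <= - m) ->
  mean0 (fun y => G (y - p)) z <= G (z - p) - m * irad z ^+ 2 / 2 * hump2_ratio.
Proof.
move=> nz np px hm; have rz := irad_gt0 oD nD nz.1.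
have inC w : cball (z - p) (2 * irad z) w -> in_cone e c w.
  move=> yB; have yB' : cball z (2 * irad z) (w + p).
    by move: yB; rewrite /cball /= opprB addrA.
  have [Dy yx] := inside_ball2 nz yB'.
  by have := Hcone np px Dy yx; rewrite addrK.
have C2 : C2_with (cball (z - p) (2 * irad z)) G G1 G2.
  by move=> w /inC wc; exact: GC2.
have s01 : 0 <= (1 : R) <= 1 by rewrite ler01 lexx.
have := mean_value_le rz s01 C2 (m := m) _.
move=> H; have {}H := H (fun y yB => hm y (inC y (le_trans yB (ler_peMl (ltW rz) (ler1n _ 2)))) yB).
rewrite /mean0 ler_pdivrMr ?hmean_gt0//.
have -> : (fun w => hump 1 w * G (z + irad z *: w - p)) = (fun w => hump 1 w * G (z - p + irad z *: w)).
  by apply/funext => w; rewrite addrAC.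
apply: le_trans H _; rewrite le_eqVlt; apply/orP; left; apply/eqP.
rewrite /hump2_ratio; have := @hmean_gt0 R d; rewrite /hmean => hm0.
by field; rewrite gt_eqF.
Qed.

Lemma walk_superharmonic z p : inside z -> ~ D p -> enorm (p - x0) < 10 * r1 ->
  (forall w, in_cone e c w -> 0 <= G w) ->
  (forall w, in_cone e c w -> \sum_(i < d) G2 i w <= 0) ->
  walk (fun y => G (y - p)) z <= (1 + 4 * eps) * G (z - p).
Proof.
move=> nz np px G0 GL0; have [ep0 ep1] := andP eps01.
apply: le_trans (walk_le_mean0 u nD eps01 (barrier_loc_bounded nz np px) _) _.
  move=> y yB; have [Dy yx] := inside_ball nz yB; apply: G0; apply: Hcone => //.
  by have r1p := r10; lra.
apply: ler_wpM2l; first by lra.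
have := @mean0_barrier z p 0 nz np px; rewrite !mul0r subr0; apply => w wc _.
by rewrite oppr0; exact: GL0.
Qed.

End WithBarrier.

Variables (beta A k : R) (G : V -> R) (G1 G2 : 'I_d -> V -> R).
Hypotheses (beta01 : 0 < beta <= 2^-1) (k0 : 0 < k).
Hypothesis GC2 : C2_with [set w | in_cone e c w] G G1 G2.
Hypothesis Gb : forall w, in_cone e c w -> enorm w `^ beta <= G w <= A * enorm w `^ beta.
Hypothesis GL : forall w, in_cone e c w -> \sum_(i < d) G2 i w <= - (k * enorm w `^ (beta - 2)).

Let outer p : Prop := ~ D p /\ enorm (p - x0) < 10 * r1.

(** An infimum of superharmonic functions is superharmonic. Letting the vertex run over all nearby
    exterior points makes the result comparable with [bdist z ^ beta], which no single vertex
    does. *)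
Definition gpot z : R := inf [set G (z - p) | p in outer].

Lemma bdist_pow_le_G z p : D z -> enorm (z - x0) < 10 * r1 -> outer p ->
  bdist z `^ beta <= G (z - p).
Proof.
move=> Dz zx [np px]; have [b0 b1] := andP beta01.
have zc := Hcone np px Dz zx; have /andP[+ _] := Gb zc; apply: le_trans.
by apply: ge0_ler_powR; rewrite ?nnegrE ?(ltW b0) ?bdist_ge0//; exact: bdist_le.
Qed.

Lemma gpot_has_inf z : D z -> enorm (z - x0) < 10 * r1 -> has_inf [set G (z - p) | p in outer].
Proof.
move=> Dz zx; split.
  by exists (G (z - x0)), x0 => //; split=> //; rewrite subrr enorm0 mulr_gt0.
by exists (bdist z `^ beta) => _ [p op <-]; exact: bdist_pow_le_G.
Qed.

Lemma gpot_ge z : D z -> enorm (z - x0) < 10 * r1 -> bdist z `^ beta <= gpot z.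
Proof.
move=> Dz zx; apply: lb_le_inf; first exact: (gpot_has_inf Dz zx).1.
by move=> _ [p op <-]; exact: bdist_pow_le_G.
Qed.

Lemma gpot_gt0 z : D z -> enorm (z - x0) < 10 * r1 -> 0 < gpot z.
Proof.
by move=> Dz zx; apply: lt_le_trans (gpot_ge Dz zx); rewrite powR_gt0// bdist_gt0.
Qed.

Lemma gpot_le_G z p : D z -> enorm (z - x0) < 10 * r1 -> outer p -> gpot z <= G (z - p).
Proof. by move=> Dz zx op; apply: ge_inf; [exact: (gpot_has_inf Dz zx).2|exists p]. Qed.

Lemma powR2_le2 : 2 `^ beta <= 2 :> R.
Proof. by have [b0 b1] := andP beta01; apply: ler1_powR; lra. Qed.

Lemma A_ge1 : 1 <= A.
Proof.
pose z : V := e.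
have c1 := andP c01.
have ec : in_cone e c e.
  have en : enorm e = 1 by rewrite enormE e1 sqrtr1.
  by split; rewrite /tilt en ?ltr01// e1; case: c1; lra.
have := Gb ec; have -> : enorm e = 1 by rewrite enormE e1 sqrtr1.
by rewrite powR1 mulr1 => /andP[]; lra.
Qed.

Lemma gpot_le z : D z -> enorm (z - x0) < 3 * r1 -> gpot z <= 2 * A * bdist z `^ beta.
Proof.
move=> Dz zx; have [b0 b1] := andP beta01.
have d0 := bdist_gt0 oD nD Dz; have A1 := A_ge1.
have [p np pz] := bdist_adherent nD z d0.
have dz := bdist_le nD z x0D.
have op : outer p.
  split=> //; apply: le_lt_trans (enorm_triB _ z _) _; rewrite enormB; lra.
have zx' : enorm (z - x0) < 10 * r1 by lra.
apply: le_trans (gpot_le_G Dz zx' op) _.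
have /andP[_ h] := Gb (Hcone np op.2 Dz zx'); apply: le_trans h _.
rewrite [2 * A]mulrC -mulrA ler_wpM2l ?(le_trans ler01)//.
apply: (@le_trans _ _ ((2 * bdist z) `^ beta)).
  by apply: ge0_ler_powR; rewrite ?nnegrE ?(ltW b0) ?mulr_ge0 ?(ltW d0)//; lra.
by rewrite powRM ?(ltW d0)// ler_wpM2r ?powR_ge0// powR2_le2.
Qed.

Lemma gpot_loc_bounded z : inside z -> loc_bounded D gpot z.
Proof.
move=> nz; have ox : outer x0 by split=> //; rewrite subrr enorm0 mulr_gt0.
have [b b0 hb] := barrier_loc_bounded GC2 nz ox.1 ox.2.
exists b => // y yB; have [Dy yx] := inside_ball nz yB.
have yx' : enorm (y - x0) < 10 * r1 by have r1p := r10; lra.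
rewrite ger0_norm ?(ltW (gpot_gt0 Dy yx'))//.
by apply: le_trans (gpot_le_G Dy yx' ox) _; apply: le_trans (ler_norm _) (hb _ yB).
Qed.

(** A nearly optimal vertex lies within [(3 A)^(1/beta) * bdist z] of [z], which bounds the
    Laplacian from above by a negative multiple of [bdist z ^ (beta - 2)]. In 512, a factor 128 is
    from [irad z ^ 2 / 2], a 2 from [gpot <= 2 A bdist^beta], and the last 2 reserves half of the
    gain for the bias. *)
Definition gdecay : R :=
  k * hump2_ratio * ((3 * A) `^ (beta^-1) + 1) `^ (beta - 2) / (512 * A).

Lemma gdecay_gt0 : 0 < gdecay.
Proof.
have A1 := A_ge1; have h := hump2_ratio_gt0; apply: divr_gt0; last by lra.
by apply: mulr_gt0; [exact: mulr_gt0|rewrite powR_gt0// ltr_wpDl ?powR_ge0].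
Qed.

Hypothesis eps_small : eps <= gdecay / 4.

(** At [z] replace the infimum by a nearly optimal vertex; elsewhere in the ball the same vertex
    still gives an upper bound. The unbiased mean loses a fraction [2 gdecay], and the bias gives
    back at most [4 eps <= gdecay]. *)
Lemma gpot_decay z : inside z -> walk gpot z <= (1 - gdecay) * gpot z.
Proof.
move=> nz; have [b0 b1] := andP beta01; have A1 := A_ge1; have [Dz zx] := nz.
have d0 := bdist_gt0 oD nD Dz; have r0 := irad_gt0 oD nD Dz.
have r1p := r10.
have zx10 : enorm (z - x0) < 10 * r1 by lra.
have zx3 : enorm (z - x0) < 3 * r1 by lra.
have g0 := gpot_gt0 Dz zx10; have gl := gpot_le Dz zx3.
have [ep0 ep1] := andP eps01; have dec0 := gdecay_gt0.
have gb := gpot_loc_bounded nz.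
have g0B y : cball z (irad z) y -> 0 <= gpot y.
  by move=> yB; have [Dy yx] := inside_ball nz yB; apply/ltW/gpot_gt0 => //; lra.
apply: le_trans (walk_le_mean0 u nD eps01 gb g0B) _.
suff H : mean0 gpot z <= (1 - 2 * gdecay) * gpot z.
  have ep4 : 0 <= 1 + 4 * eps by move: ep0; lra.
  apply: le_trans (ler_wpM2l ep4 H) _.
  rewrite mulrA ler_wpM2r ?(ltW g0)//; have es := eps_small.
  have : 0 <= eps * gdecay by rewrite mulr_ge0// ltW.
  by move: es; lra.
apply/ler_addgt0Pr => eta' eta'0.
set dz := bdist z in d0 gl *.
have dp : 0 < dz `^ beta by rewrite powR_gt0.
pose eta := Num.min eta' (A * dz `^ beta).
have eta0 : 0 < eta by rewrite lt_min eta'0/= mulr_gt0//; lra.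
have etaA : eta <= A * dz `^ beta by rewrite ge_min lexx orbT.
have etae : eta <= eta' by rewrite ge_min lexx.
have [_ [p op <-] Gp] := inf_adherent eta0 (gpot_has_inf Dz zx10).
rewrite -/(gpot z) in Gp.
have zc := Hcone op.1 op.2 Dz zx10; have /andP[Gl _] := Gb zc.
pose K := (3 * A) `^ (beta^-1).
have zpK : enorm (z - p) <= K * dz.
  have h : enorm (z - p) `^ beta <= 3 * A * dz `^ beta by lra.
  have := @ge0_ler_powR R beta^-1 _ _ _ _ _ h; rewrite -powRrM mulfV ?gt_eqF// powRr1//.
  rewrite powRM ?powR_ge0//; last by lra.
  rewrite -powRrM mulfV ?gt_eqF// powRr1 ?(ltW d0)//; apply; rewrite ?nnegrE ?invr_ge0 ?powR_ge0 ?(ltW b0)//.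
  by rewrite mulr_ge0 ?powR_ge0//; lra.
have K0 : 0 <= K by rewrite powR_ge0.
pose m := k * ((K + 1) * dz) `^ (beta - 2).
have HM := @mean0_barrier G G1 G2 GC2 z p m nz op.1 op.2 _.
have mean_le : mean0 gpot z <= mean0 (fun y => G (y - p)) z.
  apply: mean0_le => //; first exact: (barrier_loc_bounded GC2 nz op.1 op.2).
  move=> y yB; have [Dy yx] := inside_ball nz yB.
  by apply: gpot_le_G => //; lra.
apply: (le_trans mean_le); apply: (le_trans (HM _)).
  move=> w wc wB; apply: le_trans (GL wc) _; rewrite lerN2 /m ler_wpM2l ?(ltW k0)//.
  have w1 : enorm w <= (K + 1) * dz.
    rewrite -[w](subrK (z - p)); apply: le_trans (enormD _ _) _.
    move: wB zpK; rewrite /cball /= /irad -/dz; lra.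
  have [w0 _] := wc.
  have -> : beta - 2 = - (2 - beta) by ring.
  rewrite !powRN lef_pV2 ?posrE ?powR_gt0//; last by rewrite mulr_gt0//; lra.
  have t2 : 0 <= 2 - beta by lra.
  have Kd : 0 <= (K + 1) * dz by rewrite mulr_ge0 ?(ltW d0)//; lra.
  by apply: ge0_ler_powR => //; rewrite nnegrE.
have E : m * irad z ^+ 2 / 2 * hump2_ratio = 2 * gdecay * (2 * A * dz `^ beta).
  rewrite /m /gdecay /irad -/dz -/K powRM; [|lra|exact: ltW].
  have -> : dz `^ beta = dz `^ (beta - 2) * dz ^+ 2.
    by rewrite (powR_pred beta d0) (powR_pred (beta - 1) d0) -mulrA expr2; congr (_ `^ _ * _); ring.
  by field; lra.
rewrite E mulrBl mul1r.
have : 2 * gdecay * gpot z <= 2 * gdecay * (2 * A * dz `^ beta) by rewrite ler_wpM2l//; lra.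
lra.
Qed.

End ConePotentials.

(** * A supermartingale with a pole at an exterior point *)

Section FrostmanPotential.
Context {R : realType} {d : nat}.
Local Notation V := 'rV[R]_d.
Implicit Types (f phi : V -> R) (x y z w p : V) (b s t h m q r eta tau : R) (n : nat).

Lemma expD1_le n t : 0 <= t <= 1 -> (1 + t) ^+ n <= 1 + 2 ^+ n * t.
Proof.
move=> /andP[t0 t1]; suff : (1 + t) ^+ n <= 1 + (2 ^+ n - 1) * t by lra.
elim: n => [|n IH]; first by rewrite !expr0 subrr mul0r addr0.
rewrite !exprS; apply: le_trans (ler_wpM2l _ IH) _; first by lra.
have p1 : 1 <= 2 ^+ n :> R by rewrite exprn_ege1// ler1n.
have : (2 ^+ n - 1) * t * t <= (2 ^+ n - 1) * t by rewrite ler_piMr// mulr_ge0//; lra.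
lra.
Qed.

Lemma powR_young s t gam : 0 <= s -> 0 <= t -> 0 <= gam <= 1 ->
  s `^ (1 - gam) * t `^ gam <= (1 - gam) * s + gam * t.
Proof.
move=> s0 t0 /andP[g0 g1].
have [->|g0'] := eqVneq gam 0; first by rewrite subr0 powRr1// powRr0 mulr1 mul1r mul0r addr0.
have [->|g1'] := eqVneq gam 1; first by rewrite subrr powRr0 mul1r powRr1// mul0r add0r mul1r.
have gp : 0 < gam by rewrite lt_def g0'.
have gp1 : 0 < 1 - gam by rewrite subr_gt0 lt_def eq_sym g1'.
have := @conjugate_powR R (s `^ (1 - gam)) (t `^ gam) (1 - gam)^-1 gam^-1.
rewrite !powR_ge0 !invr_gt0 gp gp1 !invrK subrK => /(_ isT isT isT isT erefl).
by rewrite -!powRrM !divff ?gt_eqF// !powRr1// [s * _]mulrC [t * _]mulrC.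
Qed.

Variables (D : set V) (u : V -> R) (eps : R).
Hypotheses (oD : open D) (nD : exists p, ~ D p) (hu : harmonic_on D u) (eps01 : 0 < eps <= 2^-1).
Local Notation bdist := (bdist D).
Local Notation irad := (irad D).
Local Notation walk := (walk D u eps).

(* The potential [|z - p|^-s + k V(z - p)^(1-gam) g^gam]: the second term has a strict gain near the boundary that pays for the first-order loss of the first one. *)
Variables (g v : V -> R) (p z : V) (beta gam gd s sigma L A k1 k2 : R).
Hypotheses (Dz : D z) (np : ~ D p).
Hypotheses (beta01 : 0 < beta <= 2^-1) (gam01 : 0 < gam <= 1) (gd0 : 0 < gd <= 1).
Hypotheses (s0 : 0 < s) (sE : s = sigma * (1 - gam) - beta * gam).
Hypotheses (k10 : 0 < k1).
Hypothesis g_ge : forall y, cball z (irad z) y -> bdist y `^ beta <= g y.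
Hypothesis g_bdd : loc_bounded D g z.
Hypothesis g_decay : walk g z <= (1 - gd) * g z.
Hypothesis v_ge : forall y, cball z (irad z) y -> k1 * enorm (y - p) `^ (- sigma) <= v y.
Hypothesis v_bdd : loc_bounded D v z.
Hypothesis v_decay : walk v z <= (1 + 4 * eps) * v z.
Hypothesis eps_small : 4 * eps <= gam * gd / 2.

(** Chosen so that the gain [gam gd / 2] of the mixed term, times its lower constant [k1^(1 - gam)],
    equals the loss constant [2^(n + 1) / 8] of the pole. *)
Definition frostman_const n : R := 2 ^+ n.+1 / (4 * gam * gd * k1 `^ (1 - gam)).

Definition frostman_pot (C : R) y : R :=
  enorm (y - p) `^ (- s) + C * (v y `^ (1 - gam) * g y `^ gam).

Let zz : cball z (irad z) z. Proof. by rewrite /cball /= subrr enorm0 irad_ge0. Qed.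
Let dz0 : 0 < bdist z. Proof. exact: bdist_gt0. Qed.
Let zp0 : 0 < enorm (z - p). Proof. by apply: lt_le_trans dz0 _; exact: bdist_le. Qed.
Let g0 y : cball z (irad z) y -> 0 < g y.
Proof.
move=> yB; apply: lt_le_trans (g_ge yB); rewrite powR_gt0//.
by apply: bdist_gt0 => //; exact: (irad_sub1 oD nD Dz).
Qed.
Let yp_ge y : cball z (irad z) y -> 7 / 8 * enorm (z - p) <= enorm (y - p).
Proof.
move=> yB; have := enorm_triB z y p; have := bdist_le nD z np; rewrite (enormB z y).
by move: yB; rewrite /cball /= iradE; lra.
Qed.
Let v0 y : cball z (irad z) y -> 0 < v y.
Proof.
move=> yB; apply: lt_le_trans (v_ge yB); rewrite mulr_gt0// powR_gt0//.
by apply: lt_le_trans (yp_ge yB); rewrite mulr_gt0.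
Qed.

Let mix y := v y `^ (1 - gam) * g y `^ gam.

(** Weighted arithmetic-geometric mean inequality, normalised to be an equality at [y = z]: it
    linearises the mixed term so that the walk can be applied to [v] and [g] separately. *)
Let mix_young y : cball z (irad z) y -> mix y <= mix z * ((1 - gam) / v z * v y + gam / g z * g y).
Proof.
move=> yB; have [gm0 gm1] := andP gam01.
have vz := v0 zz; have gz := g0 zz; have vy := v0 yB; have gy := g0 yB.
have -> : mix y = mix z * ((v y / v z) `^ (1 - gam) * (g y / g z) `^ gam).
  rewrite /mix mulrACA -!powRM ?divr_ge0 ?(ltW vz) ?(ltW gz) ?(ltW vy) ?(ltW gy)//.
  by rewrite ![_ z * (_ / _)]mulrC !divfK// gt_eqF.
rewrite ler_wpM2l ?mulr_ge0 ?powR_ge0//.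
apply: le_trans (powR_young _ _ _) _; rewrite ?divr_ge0 ?(ltW vz) ?(ltW gz) ?(ltW vy) ?(ltW gy)//.
  by rewrite gm1 ltW.
by rewrite -!mulrA ![(_ z)^-1 * _]mulrC.
Qed.

Let mix_bdd : loc_bounded D mix z.
Proof.
have [gm0 gm1] := andP gam01; have vz := v0 zz; have gz := g0 zz.
have [b b0 hb] := loc_boundedZ (mix z) (loc_boundedD (loc_boundedZ ((1 - gam) / v z) v_bdd)
  (loc_boundedZ (gam / g z) g_bdd)).
exists b => // y yB; rewrite ger0_norm ?mulr_ge0 ?powR_ge0//.
by apply: le_trans (mix_young yB) _; apply: le_trans (ler_norm _) (hb _ yB).
Qed.

Let mix_decay : walk mix z <= (1 - gam * gd / 2) * mix z.
Proof.
have [gm0 gm1] := andP gam01; have vz := v0 zz; have gz := g0 zz; have [ep0 ep1] := andP eps01.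
have B1 := loc_boundedZ ((1 - gam) / v z) v_bdd; have B2 := loc_boundedZ (gam / g z) g_bdd.
apply: le_trans (walk_le u nD eps01 mix_bdd (loc_boundedZ (mix z) (loc_boundedD B1 B2)) mix_young) _.
rewrite (walkZ u nD eps01 _ (loc_boundedD B1 B2)) (walkD u nD eps01 B1 B2).
rewrite (walkZ u nD eps01 _ v_bdd) (walkZ u nD eps01 _ g_bdd).
rewrite mulrC ler_wpM2r ?mulr_ge0 ?powR_ge0//.
have h1 : (1 - gam) / v z * walk v z <= (1 - gam) * (1 + 4 * eps).
  rewrite mulrAC ler_pdivrMr// -mulrA ler_wpM2l//; lra.
have h2 : gam / g z * walk g z <= gam * (1 - gd).
  by rewrite mulrAC ler_pdivrMr// -mulrA ler_wpM2l// ltW.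
have h3 : 0 <= gam * eps by rewrite mulr_ge0// ltW.
have es := eps_small.
by apply: le_trans (lerD h1 h2) _; nra.
Qed.

(** With [t = irad z / |z - p| <= 1/8] one has [|y - p| >= (1 - t) |z - p|],
    [1 / (1 - t) <= 1 + 2 t], and the [n]-th power of the latter is at most [1 + 2^n * 2 t]. *)
Let pole_bound n y : s <= n%:R -> cball z (irad z) y ->
  enorm (y - p) `^ (- s) <= enorm (z - p) `^ (- s) * (1 + 2 ^+ n.+1 / 8 * (bdist z / enorm (z - p))).
Proof.
move=> sn yB; have dzp := bdist_le nD z np.
pose t := irad z / enorm (z - p).
have tE : t = bdist z / enorm (z - p) / 8 by rewrite /t iradE mulrAC.
have r1' : bdist z / enorm (z - p) <= 1 by rewrite ler_pdivrMr// mul1r.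
have r0' : 0 <= bdist z / enorm (z - p) by rewrite divr_ge0 ?(ltW dz0).
have t8 : t <= 8^-1 by rewrite tE; lra.
have t0 : 0 <= t by rewrite tE; lra.
have yl : enorm (z - p) * (1 - t) <= enorm (y - p).
  have := enorm_triB z y p; rewrite (enormB z y) mulrBr mulr1 mulrC divfK ?gt_eqF// => h.
  by move: yB; rewrite /cball /=; lra.
have t1 : 0 < 1 - t by lra.
have yp : 0 < enorm (y - p) by apply: lt_le_trans yl; rewrite mulr_gt0.
apply: (@le_trans _ _ ((enorm (z - p) * (1 - t)) `^ (- s))).
  rewrite !powRN lef_pV2 ?posrE ?powR_gt0 ?mulr_gt0//.
  by apply: ge0_ler_powR; rewrite ?nnegrE ?(ltW s0) ?mulr_ge0 ?(ltW t1).
rewrite powRM ?(ltW t1)// ler_wpM2l ?powR_ge0//.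
apply: (@le_trans _ _ ((1 + 2 * t) ^+ n)).
  have e1 : (1 - t)^-1 <= 1 + 2 * t.
    rewrite -[leLHS]mul1r ler_pdivrMr//; nra.
  have e2 : 1 <= (1 - t)^-1 by rewrite invf_ge1//; lra.
  have -> : (1 - t) `^ (- s) = ((1 - t)^-1) `^ s.
    by rewrite -[(1 - t)^-1]powR_inv1 ?(ltW t1)// -powRrM mulN1r.
  apply: le_trans (ler_powR e2 sn) _; rewrite powR_mulrn ?invr_ge0 ?(ltW t1)//.
  by apply: lerXn2r => //; rewrite nnegrE ?invr_ge0 ?(ltW t1)//; lra.
apply: le_trans (expD1_le n (t := 2 * t) _) _; first by lra.
by rewrite lerD2l tE exprS le_eqVlt; apply/orP; left; apply/eqP; ring.
Qed.

Lemma frostman_pot_bdd n : s <= n%:R -> loc_bounded D (frostman_pot (frostman_const n)) z.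
Proof.
move=> sn; apply: loc_boundedD; last exact: loc_boundedZ.
eexists; last first.
  by move=> y yB; rewrite ger0_norm ?powR_ge0//; exact: (pole_bound sn yB).
by rewrite mulr_ge0 ?powR_ge0// addr_ge0// mulr_ge0 ?divr_ge0 ?exprn_ge0 ?(ltW dz0).
Qed.

(** Put [rho = bdist z / |z - p| <= 1]. The pole loses at most a multiple of [|z - p|^(-s) rho]. The
    relation [sE] between the exponents makes the mixed term at least
    [k1^(1 - gam) |z - p|^(-s) rho^(beta gam)], and [rho <= rho^(beta gam)]. *)
Lemma frostman_pot_decay n : s <= n%:R ->
  walk (frostman_pot (frostman_const n)) z <= frostman_pot (frostman_const n) z.
Proof.
move=> sn; have [gm0 gm1] := andP gam01; have [gd1 gd2] := andP gd0.
have kp : 0 < k1 `^ (1 - gam) by rewrite powR_gt0.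
have cp : 0 < 4 * gam * gd * k1 `^ (1 - gam) by rewrite !mulr_gt0.
have C0 : 0 <= frostman_const n by rewrite divr_ge0 ?exprn_ge0 ?(ltW cp).
pose rho := bdist z / enorm (z - p).
have rho0 : 0 < rho by rewrite divr_gt0.
have rho1 : rho <= 1 by rewrite ler_pdivrMr// mul1r; exact: bdist_le.
have P1 : loc_bounded D (fun y => enorm (y - p) `^ (- s)) z.
  eexists; last first.
    by move=> y yB; rewrite ger0_norm ?powR_ge0//; exact: (pole_bound sn yB).
  by rewrite mulr_ge0 ?powR_ge0// addr_ge0// mulr_ge0 ?divr_ge0 ?exprn_ge0 ?(ltW dz0).
rewrite /frostman_pot (walkD u nD eps01 P1 (loc_boundedZ _ mix_bdd)) (walkZ u nD eps01 _ mix_bdd).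
have W1 := walk_le_const u nD eps01 P1 (fun y yB => pole_bound sn yB).
have W2 := ler_wpM2l C0 mix_decay.
apply: le_trans (lerD W1 W2) _.
have M : k1 `^ (1 - gam) * (enorm (z - p) `^ (- s) * rho) <= mix z.
  apply: (@le_trans _ _ ((k1 * enorm (z - p) `^ (- sigma)) `^ (1 - gam) * (bdist z `^ beta) `^ gam)).
    rewrite powRM ?powR_ge0 ?(ltW k10)// -mulrA ler_wpM2l ?(ltW kp)// -!powRrM.
    have [b0 b1] := andP beta01.
    have bg : beta * gam <= 1 by nra.
    have h : rho <= rho `^ (beta * gam).
      rewrite -{1}[rho]powRr1 ?(ltW rho0)//; apply: ger_powR => //; by rewrite rho0.
    apply: (@le_trans _ _ (enorm (z - p) `^ (- s) * rho `^ (beta * gam))).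
      by rewrite ler_wpM2l ?powR_ge0.
    rewrite /rho powRM ?invr_ge0 ?(ltW dz0)//.
    have -> : enorm (z - p) `^ (- s) * (bdist z `^ (beta * gam) * (enorm (z - p))^-1 `^ (beta * gam)) =
      enorm (z - p) `^ (- s) * (enorm (z - p))^-1 `^ (beta * gam) * bdist z `^ (beta * gam) by ring.
    rewrite -[(enorm (z - p))^-1]powR_inv1// -powRrM mulN1r -powRD; last by apply/implyP => _; rewrite gt_eqF.
    by have -> : - s + - (beta * gam) = - sigma * (1 - gam) by rewrite sE; ring.
  apply: ler_pM; rewrite ?powR_ge0//.
    apply: ge0_ler_powR; rewrite ?nnegrE ?mulr_ge0 ?powR_ge0 ?(ltW k10) ?(ltW (v0 zz)) ?subr_ge0//.
    exact: v_ge.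
  apply: ge0_ler_powR; rewrite ?nnegrE ?powR_ge0 ?(ltW gm0) ?(ltW (g0 zz))//.
  exact: g_ge.
have F : 2 ^+ n.+1 / 8 * (enorm (z - p) `^ (- s) * rho) <= frostman_const n * (gam * gd / 2 * mix z).
  apply: (@le_trans _ _ (frostman_const n * (gam * gd / 2 * (k1 `^ (1 - gam) * (enorm (z - p) `^ (- s) * rho))))).
    rewrite /frostman_const le_eqVlt; apply/orP; left; apply/eqP.
    by field; rewrite !gt_eqF.
  by rewrite ler_wpM2l// ler_wpM2l// divr_ge0// mulr_ge0// ltW.
by move: F; rewrite -/(mix z) -/rho; move: (frostman_const n) => C; nra.
Qed.

End FrostmanPotential.

(** * Gradient potentials *)

Section HarnackChain.
Context {R : realType} {d : nat}.
Local Notation V := 'rV[R]_d.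
Implicit Types (f phi h : V -> R) (x y z w p : V) (a b s t m q r eta tau : R) (n : nat).

Variables (D : set V) (u : V -> R) (eps M : R).
Hypotheses (oD : open D) (nD : exists p, ~ D p) (hu : harmonic_on D u) (eps01 : 0 < eps <= 2^-1).
Hypotheses (uM : forall y, D y -> `|u y| <= M) (u0 : forall y, D y -> 0 <= u y) (d0 : (0 < d)%N) (M0 : 0 <= M).
Local Notation bdist := (bdist D).
Local Notation irad := (irad D).
Local Notation walk := (walk D u eps).
Local Notation osc := (osc D u).
Local Notation lam := (@walk_lower_const R d eps).

Definition bounded_on b f : Prop := forall y, D y -> `|f y| <= b.
Definition nonneg_on f : Prop := forall y, D y -> 0 <= f y.

Lemma bounded_on_loc b f z : 0 <= b -> bounded_on b f -> D z -> loc_bounded D f z.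
Proof. by move=> b0 fb Dz; exists b => // y yB; apply: fb; exact: (irad_sub1 oD nD Dz). Qed.

Lemma walk_bounded_on b f : 0 <= b -> bounded_on b f -> bounded_on b (walk f).
Proof.
move=> b0 fb z Dz; have fl := bounded_on_loc b0 fb Dz.
rewrite ler_norml; apply/andP; split.
  apply: (walk_ge_const u nD eps01 fl) => y yB.
  by have := fb y (irad_sub1 oD nD Dz yB); rewrite ler_norml => /andP[].
apply: (walk_le_const u nD eps01 fl) => y yB.
by have := fb y (irad_sub1 oD nD Dz yB); rewrite ler_norml => /andP[].
Qed.

Lemma walk_nonneg_on b f : 0 <= b -> bounded_on b f -> nonneg_on f -> nonneg_on (walk f).
Proof.
move=> b0 fb f0 z Dz; apply: (walk_ge_const u nD eps01 (bounded_on_loc b0 fb Dz)) => y yB.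
by apply: f0; exact: (irad_sub1 oD nD Dz).
Qed.

Lemma iter_bounded_on b f n : 0 <= b -> bounded_on b f -> bounded_on b (iter n walk f).
Proof. by move=> b0 fb; elim: n => [//|n IH]; exact: walk_bounded_on. Qed.

Lemma iter_nonneg_on b f n : 0 <= b -> bounded_on b f -> nonneg_on f -> nonneg_on (iter n walk f).
Proof.
move=> b0 fb f0; elim: n => [//|n IH]; apply: (walk_nonneg_on b0) => //.
exact: iter_bounded_on.
Qed.

Lemma osc_bounds z : D z -> 0 <= osc z <= 2 * M.
Proof.
move=> Dz; have h0 := @hmean_gt0 R d; have r0 := irad_ge0 nD z.
have zu : `|u z| <= M by exact: uM.
have hb : bounded_by (M + M) (fun w => hump 1 w * `|u (z + irad z *: w) - u z|).
  apply: (hump1_bounded (f := fun y => `|u y - u z|)); rewrite ?addr_ge0// => y yB.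
  rewrite normr_id; apply: le_trans (ler_normB _ _) _; apply: lerD => //.
  by apply: uM; exact: (irad_sub1 oD nD Dz).
rewrite /osc divr_ge0 ?(ltW h0)//=; last first.
  by apply: (space_mean_ge0 hb) => w; rewrite mulr_ge0 ?hump_ge0.
rewrite ler_pdivrMr// /hmean.
have h1 : bounded_by 1 (hump 1 : V -> R) by move=> w; exact: hump1_norm.
have h2 : bounded_by (2 * M) (fun w : V => 2 * M * hump 1 w).
  by move=> w; rewrite normrM ger0_norm ?mulr_ge0// ler_piMr ?mulr_ge0//; exact: hump1_norm.
rewrite -(space_meanZ _ h1); apply: (space_mean_le hb h2) => w.
have [w1|w1] := leP 1 (enorm w); first by rewrite hump1_out// mul0r mulr0.
rewrite mulrC ler_wpM2r ?hump_ge0//; apply: le_trans (ler_normB _ _) _.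
rewrite mulr2n mulrDl mul1r lerD//; apply: uM; apply: (irad_sub1 oD nD Dz).
by apply: in_cball => //; exact: ltW.
Qed.

Lemma osc_bounded_on : bounded_on (2 * M) osc.
Proof. by move=> z Dz; have /andP[p0 p1] := osc_bounds Dz; rewrite ger0_norm. Qed.

Lemma osc_nonneg_on : nonneg_on osc.
Proof. by move=> z Dz; have /andP[] := osc_bounds Dz. Qed.

(** A lower bound on a small ball instead of at a point, because a single value carries no weight in
    a mean. *)
Definition reach f y a : Prop := forall z', enorm (z' - y) < bdist y / 128 -> a <= f z'.

Lemma reach_self f y a : D y -> reach f y a -> a <= f y.
Proof. by move=> Dy; apply; rewrite subrr enorm0 divr_gt0// bdist_gt0. Qed.

(** The radius 1/128 reproduces itself: for [z'] in the ball around [z], the point [y] lies within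
    [irad z' / 4] of [z'], and the ball of radius [irad z' / 32] around [y] lies in the one where
    [f] is known to be at least [a]. *)
Lemma reach_step b f z y a : 0 <= b -> bounded_on b f -> nonneg_on f -> D z -> 0 <= a ->
  enorm (y - z) <= bdist z / 128 -> reach f y a -> reach (walk f) z (lam * a).
Proof.
move=> b0 fb f0 Dz a0 yz rf z' z'z.
have dz := bdist_gt0 oD nD Dz.
have Dz' : D z' by apply: (bdist_sub nD (z := z)); lra.
have l1 := bdist_lip nD z z'; have l2 := bdist_lip nD z' z; have l3 := bdist_lip nD z y.
rewrite (enormB z z') in l1; rewrite (enormB z y) in l3.
apply: (walk_lower u oD nD eps01 (y := y)) => //.
- exact: bounded_on_loc fb Dz'.
- by move=> y' yB; apply: f0; exact: (irad_sub1 oD nD Dz').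
- have := enorm_triB y z z'; rewrite (enormB z z') iradE; lra.
- by move=> y' yB; apply: rf; move: yB; rewrite iradE; lra.
Qed.

Definition chain_start_const : R := (16 * (d%:R * (6 / @quarter_mean R d)) * @hmean R d)^-1.

Lemma grad_const_gt0 : 0 < d%:R * (6 / @quarter_mean R d) :> R.
Proof. by rewrite mulr_gt0 ?ltr0n// divr_gt0// quarter_mean_gt0. Qed.

Lemma chain_start_const_gt0 : 0 < chain_start_const.
Proof.
by rewrite invr_gt0 mulr_gt0 ?hmean_gt0// mulr_gt0// grad_const_gt0.
Qed.

Lemma reach_osc y : D y -> reach osc y (chain_start_const * (bdist y * enorm (grad u y))).
Proof.
move=> Dy z' z'y.
have dy := bdist_gt0 oD nD Dy.
have l1 := bdist_lip nD y z'; rewrite enormB in l1.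
have Dz' : D z' by apply: (bdist_sub nD (z := y)); lra.
have r0 := irad_gt0 oD nD Dz'.
have yz : enorm (y - z') < irad z' / 4 by rewrite enormB iradE; lra.
have H := grad_le_osc hu r0 (irad_sub oD nD Dz') yz.
have h0 := @hmean_gt0 R d; have g0 := grad_const_gt0.
have hpos : 0 < 16 * (d%:R * (6 / @quarter_mean R d)) * @hmean R d.
  by apply: mulr_gt0 => //; apply: mulr_gt0.
rewrite /chain_start_const mulrC ler_pdivrMr//.
have -> : osc z' * (16 * (d%:R * (6 / @quarter_mean R d)) * @hmean R d) =
   16 * (d%:R * (6 / @quarter_mean R d) * ball_osc u z' (irad z')).
  by rewrite oscE; field; rewrite !gt_eqF ?quarter_mean_gt0.
apply: (@le_trans _ _ (16 * (enorm (grad u y) * irad z'))); last by rewrite ler_pM2l.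
have yz16 : bdist y <= 16 * irad z' by rewrite iradE; lra.
by rewrite mulrCA mulrC ler_wpM2l.
Qed.

Lemma grad_bound y : D y -> chain_start_const * (bdist y * enorm (grad u y)) <= 2 * M.
Proof.
move=> Dy; apply: le_trans (reach_self Dy (reach_osc Dy)) _.
by have /andP[] := osc_bounds Dy.
Qed.

Section Ladder.
Variables (e : V) (t q c5 : R).
Hypotheses (e1 : enorm e = 1) (t0 : 0 < t) (q0 : 0 < q) (qc : 128 * q <= c5).

(** Height of the [n]-th point of the chain above its foot. The step from it is [q] times
    [t (1 + q)^n], the scale of the depth at that height, so a constant proportion of the depth is
    used each time. *)
Definition rung n : R := t * ((1 + q) ^+ n - 1).

Lemma rung_step n : rung n.+1 - rung n = q * (t * (1 + q) ^+ n).
Proof. by rewrite /rung exprS; ring. Qed.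

Lemma lam_ge0 : 0 <= lam. Proof. exact/ltW/walk_lower_const_gt0. Qed.

Lemma rung_bound x n : c5 * (t * (1 + q) ^+ n) <= bdist (x + rung n *: e) ->
  q * (t * (1 + q) ^+ n) <= bdist (x + rung n *: e) / 128.
Proof.
have p : 0 < t * (1 + q) ^+ n by rewrite mulr_gt0// exprn_gt0// addr_gt0.
move: (t * _) p (bdist _) => P P0 B h; rewrite ler_pdivlMr//; apply: le_trans h.
by rewrite mulrAC ler_wpM2r ?(ltW P0)// mulrC; exact: qc.
Qed.

Lemma rung_dist x n : enorm (x + rung n.+1 *: e - (x + rung n *: e)) = q * (t * (1 + q) ^+ n).
Proof.
rewrite opprD addrACA subrr add0r -scalerBl rung_step enormZ e1 mulr1 ger0_norm//.
by rewrite !mulr_ge0 ?exprn_ge0 ?addr_ge0// ltW.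
Qed.

Lemma ladder_D x n : c5 * (t * (1 + q) ^+ n) <= bdist (x + rung n *: e) -> D (x + rung n *: e).
Proof.
move=> h; apply: contrapT => nx; move: h; rewrite (bdist_out nD nx) leNgt => /negP; apply.
have c5p : 0 < c5 by apply: lt_le_trans qc; rewrite mulr_gt0.
by apply: mulr_gt0 => //; apply: mulr_gt0 => //; rewrite exprn_gt0// addr_gt0.
Qed.

Lemma ladder_up b f x a n : 0 <= b -> bounded_on b f -> nonneg_on f -> 0 <= a ->
  (forall i, (i <= n)%N -> c5 * (t * (1 + q) ^+ i) <= bdist (x + rung i *: e)) ->
  reach f (x + rung n *: e) a -> reach (iter n walk f) x (lam ^+ n * a).
Proof.
move=> b0; elim: n f a => [|n IH] f a fb f0 a0 hb rf.
  by move: rf; rewrite /rung expr0 subrr mulr0 scale0r addr0 expr0 mul1r.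
rewrite iterSr exprSr -mulrA; apply: IH.
- exact: walk_bounded_on.
- exact: (walk_nonneg_on b0).
- by rewrite mulr_ge0 ?lam_ge0.
- by move=> i ni; apply: hb; exact: leqW.
have hn := hb n (leqnSn n).
apply: (reach_step b0 fb f0 (ladder_D hn) a0 _ rf).
by rewrite rung_dist; exact: rung_bound.
Qed.

Lemma ladder_down b f x a n : 0 <= b -> bounded_on b f -> nonneg_on f -> 0 <= a ->
  (forall i, (i <= n)%N -> c5 * (t * (1 + q) ^+ i) <= bdist (x + rung i *: e)) ->
  reach f x a -> reach (iter n walk f) (x + rung n *: e) (lam ^+ n * a).
Proof.
move=> b0 fb f0 a0; elim: n => [|n IH] hb rf.
  by rewrite /rung expr0 subrr mulr0 scale0r addr0 expr0 mul1r.
rewrite iterS exprS -mulrA.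
have hn := hb n.+1 (leqnn _).
apply: (reach_step b0 _ _ (ladder_D hn) _ _ (IH _ rf)).
- exact: iter_bounded_on.
- exact: (iter_nonneg_on n b0).
- by rewrite mulr_ge0 ?exprn_ge0 ?lam_ge0.
- rewrite enormB rung_dist; apply: le_trans (rung_bound hn).
  rewrite ler_wpM2l ?(ltW q0)// ler_wpM2l ?(ltW t0)// exprS.
  by apply: ler_peMl; [rewrite exprn_ge0// addr_ge0// ltW|rewrite lerDl ltW].
- by move=> i ni; apply: hb; exact: leqW.
Qed.

Lemma ladder_chain b f x y a n : 0 <= b -> bounded_on b f -> nonneg_on f -> 0 <= a ->
  (forall i, (i <= n)%N -> c5 * (t * (1 + q) ^+ i) <= bdist (x + rung i *: e)) ->
  (forall i, (i <= n)%N -> c5 * (t * (1 + q) ^+ i) <= bdist (y + rung i *: e)) ->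
  enorm (x - y) <= q * (t * (1 + q) ^+ n) ->
  reach f y a -> reach (iter (n + n.+1) walk f) x (lam ^+ (n + n.+1) * a).
Proof.
move=> b0 fb f0 a0 hx hy xy rf.
have top := ladder_down b0 fb f0 a0 hy rf.
have fnb := iter_bounded_on n b0 fb; have fn0 := iter_nonneg_on n b0 fb f0.
have hn := hx n (leqnn n).
have an0 : 0 <= lam ^+ n * a by rewrite mulr_ge0 ?exprn_ge0 ?lam_ge0.
have across : reach (iter n.+1 walk f) (x + rung n *: e) (lam ^+ n.+1 * a).
  rewrite iterS exprS -mulrA; apply: (reach_step b0 fnb fn0 (ladder_D hn) an0 _ top).
  rewrite opprD addrACA subrr addr0 enormB; apply: le_trans xy _.
  exact: rung_bound.
rewrite iterD exprD -mulrA; apply: (ladder_up b0 _ _ _ hx across).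
- exact: iter_bounded_on.
- exact: (iter_nonneg_on n.+1 b0).
- by rewrite mulr_ge0 ?exprn_ge0 ?lam_ge0.
Qed.

End Ladder.

Definition bpart n z : R := \sum_(i < n) (2^-1) ^+ i * iter i walk u z.
Definition bpot z : R := sup [set bpart n z | n in setT].

Lemma bpart_le n k z : D z -> (n <= k)%N -> bpart n z <= bpart k z.
Proof.
move=> Dz nm; rewrite /bpart -(subnKC nm) big_split_ord /= lerDl.
apply: sumr_ge0 => i _; rewrite mulr_ge0 ?exprn_ge0 ?invr_ge0//.
exact: (iter_nonneg_on _ M0).
Qed.

Lemma bpart_tail n k z : D z -> (n <= k)%N -> bpart k z <= bpart n z + 2 * M * (2^-1) ^+ n.
Proof.
move=> Dz nm; suff H : bpart k z - bpart n z <= 2 * M * ((2^-1) ^+ n - (2^-1) ^+ k).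
  have : 0 <= 2 * M * (2^-1) ^+ k by rewrite !mulr_ge0// exprn_ge0 ?invr_ge0.
  by move: H; rewrite mulrBr; lra.
elim: k nm => [|k IH]; first by rewrite leqn0 => /eqP ->; rewrite !subrr mulr0.
rewrite leq_eqVlt => /orP[/eqP ->|]; first by rewrite !subrr mulr0.
rewrite ltnS => /IH h; rewrite [bpart k.+1 z]/bpart big_ord_recr /= -/(bpart k z).
have um : iter k walk u z <= M.
  by have := iter_bounded_on k M0 uM Dz; rewrite ler_norml => /andP[].
have p0 : 0 <= (2^-1) ^+ k :> R by rewrite exprn_ge0 ?invr_ge0.
have := ler_wpM2l p0 um; rewrite exprS; move: h; move: ((2^-1) ^+ k) p0 => P p0.
by move: ((2^-1) ^+ n) => Q; lra.
Qed.

Lemma bpart_has_sup z : D z -> has_sup [set bpart n z | n in setT].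
Proof.
move=> Dz; split; first by exists (bpart 0 z), 0%N.
exists (2 * M) => _ [n _ <-]; have := @bpart_tail 0 n z Dz (leq0n n).
by rewrite {2}/bpart big_ord0 add0r expr0 mulr1.
Qed.

Lemma bpart_le_bpot n z : D z -> bpart n z <= bpot z.
Proof. by move=> Dz; apply: sup_upper_bound; [exact: bpart_has_sup|exists n]. Qed.

Lemma bpot_tail n z : D z -> bpot z <= bpart n z + 2 * M * (2^-1) ^+ n.
Proof.
move=> Dz; apply: ge_sup; first exact: (bpart_has_sup Dz).1.
move=> _ [k _ <-]; have [nm|mn] := leqP n k; first exact: bpart_tail.
apply: le_trans (bpart_le Dz (ltnW mn)) _; rewrite lerDl.
by rewrite !mulr_ge0// exprn_ge0 ?invr_ge0.
Qed.

Lemma bpot_bounds z : D z -> 0 <= bpot z <= 2 * M.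
Proof.
move=> Dz; apply/andP; split.
  by apply: le_trans (bpart_le_bpot 0 Dz); rewrite /bpart big_ord0.
by have := bpot_tail 0 Dz; rewrite {1}/bpart big_ord0 add0r expr0 mulr1.
Qed.

Lemma bpot_bounded_on : bounded_on (2 * M) bpot.
Proof. by move=> z Dz; have /andP[b1 b2] := bpot_bounds Dz; rewrite ger0_norm. Qed.

(** The case [n = 0] is [walk_harmonic]; each further application of the monotone operator [walk]
    preserves the inequality. *)
Lemma iter_drop n z : D z -> eps / 2 * iter n walk osc z <= iter n walk u z - iter n.+1 walk u z.
Proof.
elim: n z => [|n IH] z Dz; first by have := walk_harmonic oD nD hu eps01 Dz; rewrite /=; lra.
have M2 : 0 <= 2 * M by rewrite mulr_ge0.
have ob := bounded_on_loc M2 (iter_bounded_on n M2 osc_bounded_on) Dz.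
have ub k := bounded_on_loc M0 (iter_bounded_on k M0 uM) Dz.
rewrite !iterS -(walkZ u nD eps01 _ ob) lerBrDr -(walkD u nD eps01 (loc_boundedZ _ ob) (ub n.+1)).
apply: (walk_le u nD eps01 (loc_boundedD (loc_boundedZ _ ob) (ub n.+1)) (ub n)).
by move=> y yB; have := IH y (irad_sub1 oD nD Dz yB); rewrite iterS; lra.
Qed.

Lemma walk_bpart n z : D z ->
  loc_bounded D (bpart n) z /\ walk (bpart n) z = \sum_(i < n) (2^-1) ^+ i * iter i.+1 walk u z.
Proof.
move=> Dz; elim: n => [|n [IH1 IH2]].
  have -> : bpart 0 = fun=> 0 by apply/funext => y; rewrite /bpart big_ord0.
  by rewrite big_ord0 walk_const//; split => //; exact: loc_bounded_const.
have E : bpart n.+1 = fun y => bpart n y + (2^-1) ^+ n * iter n walk u y.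
  by apply/funext => y; rewrite /bpart big_ord_recr.
have ub := bounded_on_loc M0 (iter_bounded_on n M0 uM) Dz.
rewrite E (walkD u nD eps01 IH1 (loc_boundedZ _ ub)) (walkZ u nD eps01 _ ub) IH2 big_ord_recr.
by split=> //; exact: (loc_boundedD IH1 (loc_boundedZ _ ub)).
Qed.

(** The decrement of the series is a sum of nonnegative drops, of which only the [n]-th is kept. The
    operator is only finitely additive, so the series is cut at [N], with a uniform tail
    [2 M 2^-N]. *)
Lemma bpot_decay n z : D z ->
  eps / 2 * ((2^-1) ^+ n * iter n walk osc z) <= bpot z - walk bpot z.
Proof.
move=> Dz; apply/ler_addgt0Pr => eta eta0; have [ep0 ep1] := andP eps01.
have M2 : 0 <= 2 * M by rewrite mulr_ge0.
have [N [nN Neta]] : exists N, (n < N)%N /\ 2 * M * (2^-1) ^+ N <= eta.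
  pose N := (n.+1 + Num.trunc (2 * M / eta))%N; exists N; split; first by rewrite /N addSn ltnS leq_addr.
  have h : N%:R <= 2 ^+ N :> R by rewrite -natrX ler_nat ltnW// ltn_expl.
  have h2 : 2 * M / eta <= N%:R.
    apply: le_trans (ltW (truncnS_gt _)) _; by rewrite ler_nat /N addSn ltnS leq_addl.
  rewrite exprVn ler_pdivrMr ?exprn_gt0//.
  rewrite ler_pdivrMr// in h2; apply: (le_trans h2).
  by rewrite [_%:R * _]mulrC ler_wpM2l// ltW.
have [bl be] := walk_bpart N Dz.
have W : walk bpot z <= walk (bpart N) z + 2 * M * (2^-1) ^+ N.
  rewrite -[X in _ + X](walk_const D u eps01 _ z) -(walkD u nD eps01 bl (loc_bounded_const _ _ _)).
  apply: (walk_le u nD eps01).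
  - exact: bounded_on_loc M2 bpot_bounded_on Dz.
  - exact: (loc_boundedD bl (loc_bounded_const _ _ _)).
  - by move=> y yB; apply: bpot_tail; exact: (irad_sub1 oD nD Dz).
have B := bpart_le_bpot N Dz.
have S : eps / 2 * ((2^-1) ^+ n * iter n walk osc z) <= bpart N z - walk (bpart N) z.
  rewrite be /bpart -sumrB (bigD1 (Ordinal nN))//= -mulrBr mulrCA.
  rewrite -[leLHS]addr0 lerD//.
    by rewrite ler_wpM2l ?exprn_ge0 ?invr_ge0//; exact: iter_drop.
  apply: sumr_ge0 => i _; rewrite -mulrBr mulr_ge0 ?exprn_ge0 ?invr_ge0//.
  apply: le_trans (iter_drop i Dz); rewrite mulr_ge0//; first by lra.
  exact: (iter_nonneg_on i M2 osc_bounded_on osc_nonneg_on).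
by lra.
Qed.

End HarnackChain.

(** * Gradients at all scales: Harnack chains, Lipschitz envelopes, and payment when a scale is
    entered *)

Section GradientPotential.
Context {R : realType} {d : nat}.
Local Notation V := 'rV[R]_d.
Implicit Types (f phi h : V -> R) (x y z w p : V) (a b s t r eta tau : R) (n m k : nat).

Variables (D : set V) (u : V -> R) (eps M : R).
Hypotheses (oD : open D) (hu : harmonic_on D u) (eps01 : 0 < eps <= 2^-1).
Hypotheses (uM : forall y, D y -> `|u y| <= M) (u0 : forall y, D y -> 0 <= u y) (d0 : (0 < d)%N) (M0 : 0 <= M).
Variables (x0 e : V) (r1 c4 c7 S : R).
Hypotheses (x0D : ~ D x0) (r10 : 0 < r1) (e1 : enorm e = 1).
Hypotheses (c401 : 0 < c4 <= 1) (c701 : 0 < c7 <= 1).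

Local Notation bdist := (bdist D).
Local Notation irad := (irad D).
Local Notation walk := (walk D u eps).
Local Notation osc := (osc D u).
Local Notation lam := (@walk_lower_const R d eps).
Local Notation inside := (inside D x0 r1).
Local Notation kap := (@chain_start_const R d).
Local Notation bpot := (bpot D u eps).

Let nD : exists p, ~ D p. Proof. by exists x0. Qed.

Hypothesis Hup : forall x, inside x -> forall s, 0 <= s <= S -> c4 * (bdist x + s) <= bdist (x + s *: e).

Definition chain_ratio : R := c4 * c7 / 128.
Local Notation q := chain_ratio.
Hypothesis qS : 10 * r1 <= q * S.

Lemma chain_ratio_bounds : 0 < q <= 128^-1.
Proof.
have /andP[a1 a2] := c401; have /andP[b1 b2] := c701.
rewrite /chain_ratio divr_gt0 ?mulr_gt0//= ler_piMl ?invr_ge0//.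
by rewrite mulr_ile1// ltW.
Qed.

(* The chain climbs from [y] along [e] by geometrically growing steps until its depth exceeds [|z - y|], crosses over, and comes down to [z]. *)
Lemma harnack_chain t y z : 0 < t -> inside z -> inside y -> t <= bdist z -> c7 * t <= bdist y ->
  exists n, lam ^+ (n + n.+1) * (kap * (bdist y * enorm (grad u y))) <= iter (n + n.+1) walk osc z /\
     (1 + q) ^+ n <= 1 + (1 + q) / q * (enorm (z - y) / t).
Proof.
move=> t0 iz iy tz ty; have /andP[q0 q1] := chain_ratio_bounds.
have /andP[a1 a2] := c401; have /andP[b1 b2] := c701; have r1p := r10.
set ell := enorm (z - y).
have bern n : 1 + n%:R * q <= (1 + q) ^+ n.
  elim: n => [|n IH]; first by rewrite mul0r addr0 expr0.
  rewrite exprS; apply: (@le_trans _ _ ((1 + q) * (1 + n%:R * q))); last by rewrite ler_wpM2l//; lra.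
  have : 0 <= n%:R * q * q by rewrite !mulr_ge0// ltW.
  by rewrite -natr1; lra.
(* The least height at which one horizontal step covers the distance [ell]. Minimality bounds
   [(1 + q)^n] linearly in [ell / t], so [n] is logarithmic and a loss exponential in [n] is
   polynomial in [ell / t]. *)
have exn : exists n, ell <= q * (t * (1 + q) ^+ n).
  have tq : 0 < q * t * q by rewrite !mulr_gt0.
  exists (Num.trunc (ell / (q * t * q))).+1; set n := _.+1.
  have h := truncnS_gt (ell / (q * t * q)); rewrite -/n ltr_pdivrMr// in h.
  apply: le_trans (ltW h) _.
  have -> : n%:R * (q * t * q) = q * (t * (n%:R * q)) by ring.
  rewrite ler_wpM2l ?(ltW q0)// ler_wpM2l ?(ltW t0)//.
  by apply: le_trans (bern n); rewrite lerDr.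
have [n [hn nmin]] : exists n, ell <= q * (t * (1 + q) ^+ n) /\
    forall m, ell <= q * (t * (1 + q) ^+ m) -> (n <= m)%N.
  by exists (ex_minn exn); case: ex_minnP.
exists n.
have lt4 : ell < 4 * r1.
  have [_ zx] := iz; have [_ yx] := iy.
  apply: le_lt_trans (enorm_triB z x0 y) _; rewrite (enormB x0 y).
  have -> : 4 * r1 = 2 * r1 + 2 * r1 by ring.
  exact: ltrD.
have tr : t < 2 * r1 by apply: le_lt_trans tz _; exact: (inside_bdist x0D iz).
have ell0 : 0 <= ell by exact: enorm_ge0.
have grow : (1 + q) ^+ n <= 1 + (1 + q) / q * (ell / t).
  move: (nmin n.-1); case: (n) => [|m] /= hm.
    by rewrite expr0 lerDl mulr_ge0// divr_ge0 ?(ltW q0) ?(ltW t0)//; lra.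
  have lt : q * (t * (1 + q) ^+ m) < ell.
    by rewrite ltNge; apply/negP => /hm; rewrite ltnn.
  have -> : (1 + q) / q * (ell / t) = (1 + q) * (ell / (q * t)) by field; rewrite !gt_eqF.
  rewrite exprS -[leLHS]add0r lerD// ler_wpM2l//; first by lra.
  by rewrite ler_pdivlMr ?mulr_gt0// mulrC -mulrA ltW.
split=> //.
(* The chain stays where depth grows along [e]: from [t < 2 r1] and [ell < 4 r1], its height is at
   most [(t + 2 ell) / q], and [t + 2 ell <= 10 r1 <= q S]. *)
have top m : (m <= n)%N -> 0 <= rung t q m <= S.
  move=> mn; have pm : 1 <= (1 + q) ^+ m by apply: exprn_ege1; lra.
  rewrite /rung mulr_ge0 ?(ltW t0) ?subr_ge0//=.
  have : t * (1 + q) ^+ m <= t * (1 + q) ^+ n by rewrite ler_wpM2l ?(ltW t0)// ler_weXn2l//; lra.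
  have : t * (1 + q) ^+ n <= t * (1 + (1 + q) / q * (ell / t)) by rewrite ler_wpM2l ?(ltW t0).
  have -> : t * (1 + (1 + q) / q * (ell / t)) = (q * t + (1 + q) * ell) / q by field; rewrite !gt_eqF.
  have : (q * t + (1 + q) * ell) / q <= S.
    rewrite ler_pdivrMr// [S * _]mulrC; apply: le_trans qS.
    have : q * t <= 1 * t by rewrite ler_wpM2r ?(ltW t0)//; lra.
    have : q * ell <= 1 * ell by rewrite ler_wpM2r//; lra.
    lra.
  by lra.
have rungs x : inside x -> c7 * t <= bdist x -> forall i, (i <= n)%N ->
    c4 * c7 * (t * (1 + q) ^+ i) <= bdist (x + rung t q i *: e).
  move=> ix cx i inn; apply: le_trans (Hup ix (top i inn)).
  rewrite -mulrA ler_wpM2l ?(ltW a1)//.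
  have /andP[rg0 _] := top i inn.
  have : c7 * rung t q i <= rung t q i by apply: ler_piMl.
  have -> : c7 * (t * (1 + q) ^+ i) = c7 * t + c7 * rung t q i by rewrite /rung; ring.
  by move=> h; exact: lerD.
have ka : 0 <= kap * (bdist y * enorm (grad u y)).
  have kp := @chain_start_const_gt0 R d d0.
  by apply: mulr_ge0; [exact: ltW|apply: mulr_ge0 => //; exact: bdist_ge0].
have M2 : 0 <= 2 * M by rewrite mulr_ge0.
have qc : 128 * q <= c4 * c7 by rewrite /chain_ratio mulrC divfK.
have czt : c7 * t <= bdist z by apply: le_trans tz; rewrite ler_piMl// ltW.
have R1 := reach_osc oD nD hu d0 iy.1.
have R2 := ladder_chain u oD nD eps01 e1 t0 q0 qc M2 (osc_bounded_on oD nD uM M0)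
  (osc_nonneg_on oD nD uM M0) ka (rungs z iz czt) (rungs y iy ty) hn R1.
exact: (reach_self oD nD iz.1 R2).
Qed.

Variables (c6 : R) (k0 : nat).
Hypotheses (c601 : 0 < c6 <= 1) (k0P : (2 / lam) ^+ 2 <= (1 + q) ^+ k0).

(* The weight makes [fhat t] Lipschitz at scale [t] (see [fhat_lip]); it decays fast enough to absorb the loss [lam ^ n] of a Harnack chain. *)
Definition fterm t y z : R := t * enorm (grad u y) * ((1 + c6 * (enorm (z - y) / t)) ^+ k0)^-1.
Definition fset t : set V := [set y | inside y /\ c7 * t <= bdist y].
Definition fhat t z : R := sup [set fterm t y z | y in fset t].

Lemma weight_ge1 t y z : 0 < t -> 1 <= 1 + c6 * (enorm (z - y) / t).
Proof.
by move=> t0; have /andP[a1 a2] := c601; rewrite lerDl mulr_ge0 ?divr_ge0 ?(ltW a1) ?(ltW t0).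
Qed.

Lemma fterm_ge0 t y z : 0 < t -> 0 <= fterm t y z.
Proof.
move=> t0; rewrite /fterm !mulr_ge0 ?(ltW t0)// invr_ge0 exprn_ge0//.
by apply: le_trans (weight_ge1 y z t0).
Qed.

Lemma fterm_le t y z : 0 < t -> fset t y -> fterm t y z <= 2 * M / (kap * c7).
Proof.
move=> t0 [iy ty]; have /andP[b1 b2] := c701; have kp := @chain_start_const_gt0 R d d0.
apply: (@le_trans _ _ (t * enorm (grad u y))).
  have W1 : 1 <= (1 + c6 * (enorm (z - y) / t)) ^+ k0 by apply: exprn_ege1; exact: weight_ge1.
  rewrite ler_piMr ?mulr_ge0 ?(ltW t0)// invf_le1//; exact: lt_le_trans W1.
rewrite ler_pdivlMr ?mulr_gt0//; apply: le_trans (grad_bound oD nD hu uM d0 M0 iy.1).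
have -> : t * enorm (grad u y) * (kap * c7) = kap * (c7 * t * enorm (grad u y)) by ring.
by rewrite ler_pM2l// ler_wpM2r.
Qed.

Lemma fterm_has_sup t z : 0 < t -> fset t !=set0 -> has_sup [set fterm t y z | y in fset t].
Proof.
move=> t0 [y fy]; split; first by exists (fterm t y z), y.
by exists (2 * M / (kap * c7)) => _ [y' fy' <-]; exact: fterm_le.
Qed.

Lemma fterm_le_fhat t y z : 0 < t -> fset t y -> fterm t y z <= fhat t z.
Proof.
by move=> t0 fy; apply: sup_upper_bound; [apply: fterm_has_sup => //; exists y|exists y].
Qed.

Lemma fhat_le t z b : 0 <= b -> (forall y, fset t y -> fterm t y z <= b) -> fhat t z <= b.
Proof.
move=> b0 hb; have [[y fy]|/set0P/negP/negPn/eqP E] := pselect (fset t !=set0); last first.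
  by rewrite /fhat E image_set0 sup0.
apply: ge_sup; first by exists (fterm t y z), y.
by move=> _ [y' fy' <-]; exact: hb.
Qed.

Lemma fhat_ge0 t z : 0 < t -> 0 <= fhat t z.
Proof.
move=> t0; have [[y fy]|/set0P/negP/negPn/eqP E] := pselect (fset t !=set0); last first.
  by rewrite /fhat E image_set0 sup0.
exact: le_trans (fterm_ge0 y z t0) (fterm_le_fhat z t0 fy).
Qed.

Definition drop_const : R :=
  2 / eps * (2 / lam * ((1 + q) / (q * c6)) ^+ k0 / (kap * c7)).

Lemma drop_const_gt0 : 0 < drop_const.
Proof.
have /andP[q0 q1] := chain_ratio_bounds; have /andP[a1 a2] := c601; have /andP[b1 b2] := c701.
have kp := @chain_start_const_gt0 R d d0; have lp := @walk_lower_const_gt0 R d eps eps01.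
have /andP[ep0 ep1] := eps01.
apply: mulr_gt0; first by rewrite divr_gt0.
apply: divr_gt0; last exact: mulr_gt0.
apply: mulr_gt0; first by rewrite divr_gt0.
apply: exprn_gt0; apply: divr_gt0; [by rewrite addr_gt0|exact: mulr_gt0].
Qed.

(** A chain with [n] rungs compares the gradient with the drop of [bpot] at the cost
    [(2 / lam)^(2 n + 1)], the 2 being the weight of the series. By the choice of [k0] this is at
    most [(2 / lam) ((1 + q)^n)^k0], and [(1 + q)^n] is at most a multiple of the base of the weight
    in [fterm], so the weight cancels the loss. *)
Lemma fhat_le_drop t z : 0 < t -> inside z -> t <= bdist z ->
  fhat t z <= drop_const * (bpot z - walk bpot z).
Proof.
move=> t0 iz tz; have /andP[q0 q1] := chain_ratio_bounds; have /andP[a1 a2] := c601.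
have /andP[b1 b2] := c701; have /andP[ep0 ep1] := eps01.
have kp := @chain_start_const_gt0 R d d0; have lp := @walk_lower_const_gt0 R d eps eps01.
have dec m : eps / 2 * ((2^-1) ^+ m * iter m walk osc z) <= bpot z - walk bpot z.
  exact: (bpot_decay oD nD hu eps01 uM u0 M0 m iz.1).
have drop0 : 0 <= bpot z - walk bpot z.
  apply: le_trans (dec 0%N); rewrite expr0 mul1r mulr_ge0//; first by lra.
  exact: (osc_nonneg_on oD nD uM M0 iz.1).
have dc := drop_const_gt0.
apply: fhat_le; first by rewrite mulr_ge0// ltW.
move=> y [iy ty]; have [n [Hn grow]] := harnack_chain t0 iz iy tz ty.
have := dec (n + n.+1)%N; set drop := bpot z - _ => dn.
set ell := enorm (z - y) in grow; set gr := enorm (grad u y) in Hn.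
pose W := 1 + c6 * (ell / t).
have W1 : 1 <= W by exact: weight_ge1.
have gW : (1 + q) ^+ n <= (1 + q) / (q * c6) * W.
  apply: (le_trans grow).
  have -> : (1 + q) / (q * c6) * W = (1 + q) / (q * c6) + (1 + q) / q * (ell / t).
    by rewrite /W; field; rewrite !gt_eqF.
  rewrite lerD2r ler_pdivlMr ?(mulr_gt0 q0 a1)// mul1r.
  by apply: (@le_trans _ _ (q * 1)); [rewrite ler_wpM2l// ltW|lra].
have W0 : 0 < W by apply: lt_le_trans W1.
have key : (2 / lam) ^+ (n + n.+1) <= 2 / lam * ((1 + q) / (q * c6)) ^+ k0 * W ^+ k0.
  have T0 : 0 <= 2 / lam by rewrite divr_ge0// ltW.
  move: k0P; set T := 2 / lam in T0 * => kP.
  rewrite addnS exprS -[leRHS]mulrA ler_wpM2l// -exprMn addnn -mul2n exprM.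
  apply: (@le_trans _ _ (((1 + q) ^+ k0) ^+ n)).
    by apply: lerXn2r => //; rewrite nnegrE ?exprn_ge0// addr_ge0// ltW.
  rewrite -exprM mulnC exprM; apply: lerXn2r => //; rewrite nnegrE.
    by rewrite exprn_ge0//; lra.
  by rewrite mulr_ge0 ?(ltW W0)// divr_ge0 ?(ltW (mulr_gt0 q0 a1))//; lra.
have X0 : kap * (bdist y * gr) <= (2 / lam) ^+ (n + n.+1) * (2 / eps * drop).
  have lm : 0 < lam ^+ (n + n.+1) by rewrite exprn_gt0.
  rewrite -(ler_pM2l lm) [leRHS]mulrA -exprMn.
  have -> : lam * (2 / lam) = 2 by rewrite mulrCA divff ?mulr1// gt_eqF.
  apply: (le_trans Hn); rewrite exprVn in dn.
  have p2 : 0 < 2 ^+ (n + n.+1) :> R by rewrite exprn_gt0.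
  have -> : 2 ^+ (n + n.+1) * (2 / eps * drop) = drop / (eps / 2 / 2 ^+ (n + n.+1)).
    by field; rewrite !gt_eqF.
  rewrite ler_pdivlMr; last by rewrite !divr_gt0.
  by move: dn; rewrite mulrA mulrC.
have gr0 : 0 <= gr by exact: enorm_ge0.
rewrite /fterm -/gr -/ell -/W ler_pdivrMr ?exprn_gt0//.
apply: (@le_trans _ _ (kap * (bdist y * gr) / (kap * c7))).
  rewrite ler_pdivlMr ?mulr_gt0//.
  have -> : t * gr * (kap * c7) = kap * (c7 * t * gr) by ring.
  by rewrite ler_pM2l// ler_wpM2r.
apply: (@le_trans _ _ ((2 / lam) ^+ (n + n.+1) * (2 / eps * drop) / (kap * c7))).
  by rewrite ler_wpM2r// invr_ge0 ltW// mulr_gt0.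
have ed : 0 <= 2 / eps * drop by rewrite mulr_ge0// divr_ge0// ltW.
apply: (@le_trans _ _ (2 / lam * ((1 + q) / (q * c6)) ^+ k0 * W ^+ k0 * (2 / eps * drop) / (kap * c7))).
  by rewrite ler_wpM2r ?invr_ge0 ?(ltW (mulr_gt0 kp b1))// ler_wpM2r.
by rewrite /drop_const le_eqVlt; apply/orP; left; apply/eqP; ring.
Qed.

(** Moving from [z] to [y] changes the base of each weight by at most the factor
    [1 + c6 |y - z| / t], by the triangle inequality and [1 + a + b <= (1 + a)(1 + b)]; then
    [expD1_le] handles the power. *)
Lemma fhat_lip t y z : 0 < t -> c6 * (enorm (y - z) / t) <= 1 ->
  fhat t y <= fhat t z * (1 + 2 ^+ k0 * (c6 * (enorm (y - z) / t))).
Proof.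
move=> t0 h; have /andP[a1 a2] := c601.
have x1 : 0 <= c6 * (enorm (y - z) / t) by rewrite mulr_ge0 ?divr_ge0 ?(ltW a1) ?(ltW t0).
have p0 : 0 <= 1 + 2 ^+ k0 * (c6 * (enorm (y - z) / t)).
  by rewrite addr_ge0// mulr_ge0// exprn_ge0.
apply: fhat_le; first by rewrite mulr_ge0// fhat_ge0.
move=> y' fy'; apply: (@le_trans _ _ (fterm t y' z * (1 + 2 ^+ k0 * (c6 * (enorm (y - z) / t))))); last first.
  by rewrite ler_wpM2r// fterm_le_fhat.
have E : (1 + c6 * (enorm (y - z) / t)) ^+ k0 <= 1 + 2 ^+ k0 * (c6 * (enorm (y - z) / t)).
  by apply: expD1_le; rewrite x1.
apply: le_trans (ler_wpM2l (fterm_ge0 y' z t0) E).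
have w1 := weight_ge1 y' z t0; have w2 := weight_ge1 y' y t0.
have wz0 : 0 < (1 + c6 * (enorm (z - y') / t)) ^+ k0 by rewrite exprn_gt0//; lra.
have wy0 : 0 < (1 + c6 * (enorm (y - y') / t)) ^+ k0 by rewrite exprn_gt0//; lra.
rewrite /fterm -[leRHS]mulrA ler_wpM2l ?(mulr_ge0 (ltW t0))//.
rewrite [leRHS]mulrC ler_pdivlMr// mulrC ler_pdivrMr//.
rewrite -exprMn; apply: lerXn2r; rewrite ?nnegrE; [lra|by rewrite mulr_ge0//; lra|].
have tri : enorm (z - y') / t <= enorm (y - z) / t + enorm (y - y') / t.
  by rewrite -mulrDl ler_wpM2r ?invr_ge0 ?(ltW t0)// (enormB y z) enorm_triB.
have q2 : 0 <= enorm (y - y') / t by rewrite divr_ge0// ltW.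
have q3 : 0 <= enorm (y - z) / t by rewrite divr_ge0// ltW.
have := ler_wpM2l (ltW a1) tri.
have : 0 <= c6 * (enorm (y - z) / t) * (c6 * (enorm (y - y') / t)).
  exact: (mulr_ge0 x1 (mulr_ge0 (ltW a1) q2)).
lra.
Qed.

Variables (g : V -> R) (beta A gd : R).
Hypotheses (beta01 : 0 < beta <= 2^-1) (gd01 : 0 < gd <= 1) (A0 : 0 <= A).
Hypothesis g_ge : forall y, D y -> enorm (y - x0) < 10 * r1 -> bdist y `^ beta <= g y.
Hypothesis g_le : forall y, D y -> enorm (y - x0) < 3 * r1 -> g y <= A * bdist y `^ beta.
Hypothesis g_bdd : forall z, inside z -> loc_bounded D g z.
Hypothesis g_decay : forall z, inside z -> walk g z <= (1 - gd) * g z.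
Hypothesis c6_small : 2 ^+ k0 * c6 <= gd / 2.

(* The factor [1 + g / t^beta] compensates, through the decay of [g], the variation of [fhat t] over one step of the walk. *)
Definition ftil t z : R := fhat t z * (1 + g z / t `^ beta).

Let g0 y : D y -> enorm (y - x0) < 3 * r1 -> 0 <= g y.
Proof.
move=> Dy yx; apply: le_trans (g_ge Dy _); first exact: powR_ge0.
by have r1p := r10; lra.
Qed.

Lemma ftil_ge0 t y : 0 < t -> D y -> enorm (y - x0) < 3 * r1 -> 0 <= ftil t y.
Proof.
by move=> t0 Dy yx; rewrite mulr_ge0 ?fhat_ge0// addr_ge0// divr_ge0 ?powR_ge0 ?g0.
Qed.

Let fhat_ball t z y : 0 < t -> inside z -> bdist z < 2 * t -> cball z (irad z) y ->
  fhat t y <= fhat t z * (1 + gd / 2 * (bdist z / t / 8)).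
Proof.
move=> t0 iz zt yB; have /andP[a1 a2] := c601.
have yz : enorm (y - z) / t <= bdist z / t / 8.
  by rewrite mulrAC ler_wpM2r ?invr_ge0 ?(ltW t0).
have bt : bdist z / t < 2 by rewrite ltr_pdivrMr.
have bt0 : 0 <= bdist z / t by rewrite divr_ge0 ?(ltW t0) ?bdist_ge0.
have yz0 : 0 <= enorm (y - z) / t by rewrite divr_ge0// ltW.
have h1 : c6 * (enorm (y - z) / t) <= 1.
  by apply: (@le_trans _ _ (1 * (1 / 4))); [rewrite ler_pM// ?(ltW a1)//; lra|lra].
apply: le_trans (fhat_lip t0 h1) _; rewrite ler_wpM2l ?fhat_ge0// lerD2l mulrA.
by apply: ler_pM => //; rewrite mulr_ge0 ?exprn_ge0 ?(ltW a1).
Qed.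

Let gpart_bdd t z : inside z -> loc_bounded D (fun y => 1 + g y / t `^ beta) z.
Proof.
move=> iz; apply: loc_boundedD; first exact: loc_bounded_const.
by apply: loc_boundedM; [exact: g_bdd|exact: loc_bounded_const].
Qed.

Lemma fhat_bdd t z : 0 < t -> loc_bounded D (fhat t) z.
Proof.
move=> t0; have b0 : 0 <= 2 * M / (kap * c7).
  have /andP[b1 b2] := c701; have kp := @chain_start_const_gt0 R d d0.
  by rewrite divr_ge0 ?mulr_ge0// ltW.
exists (2 * M / (kap * c7)) => // y _; rewrite ger0_norm ?fhat_ge0//.
by apply: fhat_le => // y' fy'; exact: fterm_le.
Qed.

Lemma ftil_bdd t z : 0 < t -> inside z -> loc_bounded D (ftil t) z.
Proof. by move=> t0 iz; apply: loc_boundedM; [exact: fhat_bdd|exact: gpart_bdd]. Qed.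

(** Over one step [fhat t] grows by at most the fraction [gd / 16 * (bdist z / t)]. Below the scale,
    [bdist z / t <= (bdist z / t)^beta <= g z / t^beta], so the loss [gd * g z / t^beta] of the
    second factor outweighs it. *)
Lemma ftil_decay t z : 0 < t -> inside z -> bdist z < t -> walk (ftil t) z <= ftil t z.
Proof.
move=> t0 iz zt; have /andP[gd1 gd2] := gd01; have [bt0 bt1] := andP beta01.
pose ell := 1 + gd / 2 * (bdist z / t / 8).
have zt0 : 0 <= bdist z / t by rewrite divr_ge0 ?(ltW t0) ?bdist_ge0.
have zt1 : bdist z / t <= 1 by rewrite ler_pdivrMr// mul1r ltW.
have el0 : 0 <= ell by rewrite /ell addr_ge0// mulr_ge0//; lra.
have f0 := fhat_ge0 z t0.
have zx3 : enorm (z - x0) < 3 * r1 by have [] := iz; have r1p := r10; lra.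
have gb : loc_bounded D (fun y => (t `^ beta)^-1 * g y) z by apply: loc_boundedZ; exact: g_bdd.
have gb' : loc_bounded D (fun y => 1 + (t `^ beta)^-1 * g y) z.
  by apply: loc_boundedD => //; exact: loc_bounded_const.
have B := loc_boundedZ (fhat t z * ell) gb'.
apply: le_trans (walk_le u nD eps01 (ftil_bdd t0 iz) B _) _.
  move=> y yB; have [Dy yx] := inside_ball oD x0D iz yB.
  rewrite /ftil [(t `^ beta)^-1 * _]mulrC ler_wpM2r//.
    by rewrite addr_ge0// divr_ge0 ?powR_ge0 ?g0.
  by apply: fhat_ball => //; lra.
rewrite (walkZ u nD eps01 _ gb') (walkD u nD eps01 (loc_bounded_const _ _ _) gb) walk_const//.
rewrite (walkZ u nD eps01 _ (g_bdd iz)) /ftil -mulrA ler_wpM2l//.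
pose G := g z / t `^ beta.
have GE : (t `^ beta)^-1 * walk g z <= (1 - gd) * G.
  by rewrite /G [leRHS]mulrA [leLHS]mulrC ler_wpM2r ?invr_ge0 ?powR_ge0// g_decay.
have tb : 0 < t `^ beta by rewrite powR_gt0.
have Gr : bdist z / t <= G.
  rewrite /G ler_pdivlMr//; apply: le_trans (g_ge iz.1 _); last by have r1p := r10; lra.
  have dz := bdist_gt0 oD nD iz.1.
  rewrite -{2}[bdist z](divfK (lt0r_neq0 t0)) powRM ?(ltW t0)// ler_wpM2r ?powR_ge0//.
  rewrite -{1}[bdist z / t]powRr1//; apply: ger_powR; last by lra.
  by rewrite divr_gt0.
have G0 : 0 <= G by exact: le_trans Gr.
apply: (@le_trans _ _ (ell * (1 + (1 - gd) * G))); first by rewrite ler_wpM2l// lerD2l.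
rewrite -/G /ell.
have h1 : gd / 2 * (bdist z / t / 8) <= gd / 2 * (G / 8) by rewrite ler_wpM2l//; lra.
have h2 : gd / 2 * (bdist z / t / 8) * ((1 - gd) * G) <= gd / 2 * (1 / 8) * ((1 - gd) * G).
  have m0 : 0 <= (1 - gd) * G by apply: mulr_ge0 => //; lra.
  by rewrite (ler_wpM2r m0)// ler_wpM2l//; lra.
have h3 : 0 <= gd * (gd * G) by exact: (mulr_ge0 (ltW gd1) (mulr_ge0 (ltW gd1) G0)).
have h4 : 0 <= gd * G := mulr_ge0 (ltW gd1) G0.
move: h1 h2; set H := gd / 2 * (bdist z / t / 8) => h1 h2.
rewrite mulrDl mul1r mulrDr mulr1; clearbody H.
have -> : (1 - gd) * G = G - gd * G by ring.
have E1 : gd / 2 * (G / 8) = gd * G / 16 by field.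
have E2 : gd / 2 * (1 / 8) * ((1 - gd) * G) = (gd * G - gd * (gd * G)) / 16 by field.
have E3 : H * ((1 - gd) * G) = H * (G - gd * G) by ring.
rewrite E1 in h1; rewrite E2 E3 in h2.
move: (H * _) h2 => HG h2; move: (gd * (gd * G)) h3 h2 => P2 h3 h2; move: (gd * G) h4 h1 h2 => P1 h4 h1 h2.
by lra.
Qed.

Definition tscale k : R := (2^-1) ^+ k.

Lemma tscale_gt0 k : 0 < tscale k. Proof. by rewrite exprn_gt0// invr_gt0. Qed.

Definition active t z : R := if bdist z < t then ftil t z else 0.

(** On entry [fhat t] at most doubles, and [g / t^beta <= 4 A] since the depth is below [4 t]. *)
Definition entry_const : R := 2 * (1 + 4 * A).

Lemma active_ge0 t y : 0 < t -> D y -> enorm (y - x0) < 3 * r1 -> 0 <= active t y.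
Proof. by move=> t0 Dy yx; rewrite /active; case: ifP => // _; exact: ftil_ge0. Qed.

Lemma active_bdd t z : 0 < t -> inside z -> loc_bounded D (active t) z.
Proof.
move=> t0 iz; have [b b0 hb] := ftil_bdd t0 iz.
by exists b => // y yB; rewrite /active; case: ifP => _; [exact: hb|rewrite normr0].
Qed.

(** Three regimes. Below the scale [ftil_decay] applies. Between [t] and [2 t] the step may switch
    the scale on, and [fhat_le_drop] pays for it, as [z] is still deep enough for a chain. Above
    [2 t] the scale is out of reach, since depth shrinks by at most the factor 7/8. *)
Lemma active_decay t z : 0 < t -> inside z ->
  walk (active t) z <= active t z +
    (if t <= bdist z < 2 * t then entry_const * drop_const * (bpot z - walk bpot z) else 0).
Proof.
move=> t0 iz; have ab := active_bdd t0 iz; have /andP[gd1 gd2] := gd01; have [bt0 bt1] := andP beta01.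
have [zt|zt] := ltP (bdist z) t.
  rewrite /= addr0 [leRHS]/active zt; apply: le_trans (ftil_decay t0 iz zt).
  apply: (walk_le u nD eps01 ab (ftil_bdd t0 iz)) => y yB; rewrite /active.
  case: ifP => // _; have [Dy yx] := inside_ball oD x0D iz yB; exact: ftil_ge0.
rewrite [active t z]/active ltNge zt /= add0r; case: ifP => zt2; last first.
  apply: (walk_le_const u nD eps01 ab) => y yB; rewrite /active.
  have /andP[yb _] := bdist_ball x0D yB.
  by move/negbT: zt2; rewrite -leNgt => zt2; rewrite ltNge (_ : t <= _)//=; lra.
have Dr := fhat_le_drop t0 iz zt.
have A0' := A0.
have C0 : 0 <= entry_const by rewrite /entry_const; lra.
rewrite -mulrA; apply: le_trans (ler_wpM2l C0 Dr).
apply: (walk_le_const u nD eps01 ab) => y yB; have [Dy yx] := inside_ball oD x0D iz yB.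
have f0 := fhat_ge0 z t0.
rewrite /active; case: ifP => _; last by rewrite mulr_ge0.
rewrite /ftil mulrC /entry_const.
have F := fhat_ball t0 iz zt2 yB.
have zt3 : bdist z / t < 2 by rewrite ltr_pdivrMr.
have zt4 : 0 <= bdist z / t by rewrite divr_ge0 ?(ltW t0) ?bdist_ge0.
have F2 : fhat t y <= fhat t z * 2.
  apply: (le_trans F); rewrite ler_wpM2l//.
  have : gd / 2 * (bdist z / t / 8) <= 1 * 1 by rewrite ler_pM//; lra.
  lra.
have tb : 0 < t `^ beta by rewrite powR_gt0.
have G4 : g y / t `^ beta <= 4 * A.
  rewrite ler_pdivrMr//; apply: (le_trans (g_le Dy yx)).
  rewrite [4 * A]mulrC -mulrA ler_wpM2l//.
  have /andP[_ yb] := bdist_ball x0D yB.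
  apply: (@le_trans _ _ ((4 * t) `^ beta)).
    by apply: ge0_ler_powR; rewrite ?nnegrE ?(ltW bt0) ?bdist_ge0 ?mulr_ge0 ?(ltW t0)//; lra.
  by rewrite powRM ?(ltW t0)// ler_wpM2r ?powR_ge0//; apply: ler1_powR; lra.
apply: (@le_trans _ _ ((1 + 4 * A) * (fhat t z * 2))).
  apply: ler_pM => //; [by rewrite addr_ge0// divr_ge0 ?powR_ge0 ?g0|exact: fhat_ge0|by rewrite lerD2l].
by rewrite le_eqVlt; apply/orP; left; apply/eqP; ring.
Qed.

Variable kst : nat.

Definition tpart n z : R := \sum_(i < n) active (tscale (kst + i)) z.

Lemma tpart_ge0 n y : D y -> enorm (y - x0) < 3 * r1 -> 0 <= tpart n y.
Proof. by move=> Dy yx; apply: sumr_ge0 => i _; apply: active_ge0 => //; exact: tscale_gt0. Qed.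

Lemma tpart_stable n m z : tscale (kst + n) <= bdist z -> (n <= m)%N -> tpart m z = tpart n z.
Proof.
move=> h nm; rewrite /tpart -(subnKC nm) big_split_ord /= [X in _ + X]big1 ?addr0// => i _.
suff h' : tscale (kst + (n + i)) <= bdist z by rewrite /active ltNge h'.
have ni : (kst + n <= kst + (n + i))%N by rewrite leq_add2l leq_addr.
by apply: le_trans h; apply: ler_wiXn2l ni; rewrite ?invr_ge0// invf_le1// ler1n.
Qed.

Lemma walk_tpart n z : inside z -> loc_bounded D (tpart n) z /\
  walk (tpart n) z <= tpart n z + entry_const * drop_const * (bpot z - walk bpot z).
Proof.
move=> iz; set X := entry_const * drop_const * (bpot z - walk bpot z).
have X0 : 0 <= X.
  have A0' := A0; have /andP[ep0 ep1] := eps01.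
  have en0 : 0 <= entry_const by rewrite /entry_const; lra.
  apply: (mulr_ge0 (mulr_ge0 en0 (ltW drop_const_gt0))).
  apply: le_trans (bpot_decay oD nD hu eps01 uM u0 M0 0%N iz.1); rewrite expr0 mul1r.
  by apply: mulr_ge0; [lra|exact: (osc_nonneg_on oD nD uM M0 iz.1)].
pose chi k := tscale (kst + k) <= bdist z < 2 * tscale (kst + k).
have H m : loc_bounded D (tpart m) z /\ walk (tpart m) z <= tpart m z + \sum_(i < m) (if chi i then X else 0).
  elim: m => [|m [IH1 IH2]].
    have -> : tpart 0 = fun=> 0 by apply/funext => y; rewrite /tpart big_ord0.
    by rewrite big_ord0 addr0 walk_const//; split => //; exact: loc_bounded_const.
  have E : tpart m.+1 = fun y => tpart m y + active (tscale (kst + m)) y.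
    by apply/funext => y; rewrite /tpart big_ord_recr.
  have ab := active_bdd (tscale_gt0 (kst + m)) iz.
  rewrite E; split; first exact: loc_boundedD.
  rewrite (walkD u nD eps01 IH1 ab) big_ord_recr /= [leRHS]addrACA lerD//.
  exact: (active_decay (tscale_gt0 _) iz).
have [H1 H2] := H n; split=> //; apply: (le_trans H2); rewrite lerD2l.
(* The windows [[t, 2 t)] of distinct dyadic scales are disjoint, so each step pays for at most one
   scale and the bound does not grow with [n]. *)
have uniq_chi i j : chi i -> chi j -> (i <= j)%N.
  move=> /andP[i1 i2] /andP[j1 j2]; rewrite leqNgt; apply/negP => ij.
  have : 2 * tscale (kst + i) <= tscale (kst + j).
    have E : (kst + i = (kst + j) + (i - j).-1.+1)%N.
      by rewrite prednK ?subn_gt0// -addnA subnKC// ltnW.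
    rewrite /tscale E exprD exprS [leLHS]mulrA [2 * _]mulrC -!mulrA [2 * _]mulrA mulfV// mul1r.
    by rewrite ler_piMr ?exprn_ge0 ?invr_ge0// exprn_ile1 ?invr_ge0// invf_le1 ?ler1n.
  have := tscale_gt0 (kst + i).
  by lra.
have [/existsP[i ci]|/existsPn nc] := boolP [exists i : 'I_n, chi i].
  rewrite (bigD1 i)//= ci big1 ?addr0// => j ji.
  case: ifP => // cj; have := uniq_chi _ _ ci cj; have := uniq_chi _ _ cj ci => l1 l2.
  by move: ji; rewrite -val_eqE /= eqn_leq l1 l2.
by rewrite big1// => i _; rewrite (negPf (nc i)).
Qed.

(** Scales from this index on are at most [bdist z], hence inactive at [z]. The sum [tpot] is thus
    finite at each point, with a length bounded on the ball of one step, as finite additivity of the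
    mean requires. *)
Definition tlen z : nat := (Num.trunc (bdist z)^-1).+1.
Definition tpot z : R := tpart (tlen z) z.

Lemma tscale_small (b : R) n : 0 < b -> (Num.trunc b^-1 < n)%N -> tscale (kst + n) <= b.
Proof.
move=> b0 h; have n0 : (0 < n)%N by apply: leq_ltn_trans h.
have h1 : b^-1 <= n%:R by apply: le_trans (ltW (truncnS_gt _)) _; rewrite ler_nat.
rewrite /tscale exprVn -[b]invrK lef_pV2 ?posrE ?exprn_gt0 ?invr_gt0//.
apply: (le_trans h1); rewrite -natrX ler_nat.
by apply: leq_trans (ltnW (ltn_expl n (isT : (1 < 2)%N))) _; rewrite leq_exp2l// leq_addl.
Qed.

Lemma tpotE z n : D z -> (tlen z <= n)%N -> tpot z = tpart n z.
Proof.
move=> Dz zn; have dz := bdist_gt0 oD nD Dz; rewrite /tpot; apply/esym/tpart_stable => //.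
exact: tscale_small.
Qed.

Lemma tpot_decay z : inside z -> loc_bounded D tpot z /\
  walk tpot z <= tpot z + entry_const * drop_const * (bpot z - walk bpot z).
Proof.
move=> iz; have dz := bdist_gt0 oD nD iz.1.
pose n := (Num.trunc (bdist z / 2)^-1).+1.
have len y : cball z (irad z) y -> (tlen y <= n)%N.
  move=> yB; have /andP[yb _] := bdist_ball x0D yB; rewrite /tlen /n ltnS; apply: le_truncn.
  by rewrite lef_pV2 ?posrE; lra.
have zz : cball z (irad z) z by rewrite /cball /= subrr enorm0 irad_ge0.
have [tb td] := walk_tpart n iz.
have E y : cball z (irad z) y -> tpot y = tpart n y.
  by move=> yB; apply: tpotE (len y yB); exact: (irad_sub1 oD nD iz.1).
have tb' : loc_bounded D tpot z.
  by have [b b0 hb] := tb; exists b => // y yB; rewrite E//; exact: hb.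
split=> //; rewrite (E z zz); apply: le_trans td.
by apply: (walk_le u nD eps01 tb' tb) => y yB; rewrite E.
Qed.

Lemma fhat_le_tpot z n : inside z -> \sum_(i < n) (if bdist z < tscale (kst + i) then fhat (tscale (kst + i)) z else 0) <= tpot z.
Proof.
move=> iz; have zx3 : enorm (z - x0) < 3 * r1 by have [] := iz; have r1p := r10; lra.
rewrite (@tpotE z (n + tlen z) iz.1) ?leq_addl//.
rewrite /tpart big_split_ord /= -[leLHS]addr0 lerD//; last first.
  by apply: sumr_ge0 => i _; apply: active_ge0 => //; [exact: tscale_gt0|exact: iz.1].
apply: ler_sum => i _; rewrite /active; case: ifP => // _.
rewrite /ftil ler_peMr ?fhat_ge0 ?tscale_gt0// lerDl divr_ge0 ?powR_ge0//.
exact: (g0 iz.1).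
Qed.

End GradientPotential.

(** * The greedy path *)

Section FrostmanSum.
Context {R : realType} {d : nat}.
Local Notation V := 'rV[R]_d.
Implicit Types (f : V -> R) (x y z p : V) (b t r eta : R) (n m k : nat).

Lemma ler_powRN (a b s : R) : 0 < a -> a <= b -> 0 <= s -> b `^ (- s) <= a `^ (- s).
Proof.
move=> a0 ab s0; have b0 := lt_le_trans a0 ab.
rewrite !powRN lef_pV2 ?posrE ?powR_gt0//.
by apply: ge0_ler_powR; rewrite ?nnegrE ?(ltW a0) ?(ltW b0).
Qed.

Variables (D : set V) (u : V -> R) (eps : R) (x0 : V) (r1 : R).
Hypotheses (oD : open D) (eps01 : 0 < eps <= 2^-1) (x0D : ~ D x0) (r10 : 0 < r1).
Local Notation bdist := (bdist D).
Local Notation irad := (irad D).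
Local Notation walk := (walk D u eps).
Local Notation inside := (inside D x0 r1).

Let nD : exists p, ~ D p. Proof. by exists x0. Qed.

Definition around z : Prop := D z /\ enorm (z - x0) < 3 * r1.

Lemma inside_around z y : inside z -> cball z (irad z) y -> around y.
Proof. exact: inside_ball. Qed.

Lemma inside_self z : inside z -> around z.
Proof. by move=> [Dz zx]; split=> //; have r1p := r10; lra. Qed.

Variables (w : nat -> V -> R) (a : nat -> R) (s C eta : R).
Hypotheses (a0 : forall k, 0 <= a k) (s0 : 0 <= s) (C0 : 0 <= C).
Hypothesis w_ge0 : forall k y, around y -> 0 <= w k y.
Hypothesis w_le : forall k y, around y -> w k y <= C * bdist y `^ (- s).
Hypothesis w_bdd : forall k z, inside z -> loc_bounded D (w k) z.
Hypothesis w_decay : forall k z, inside z -> walk (w k) z <= w k z.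
Hypothesis a_sum : forall n, \sum_(k < n) a k <= eta.

Definition spart n y : R := \sum_(k < n) a k * w k y.
Definition spot y : R := sup [set spart n y | n in setT].

Lemma spart_mono n m y : around y -> (n <= m)%N -> spart n y <= spart m y.
Proof.
move=> Dy nm; rewrite /spart -(subnKC nm) big_split_ord /= lerDl.
by apply: sumr_ge0 => k _; rewrite mulr_ge0// w_ge0.
Qed.

Lemma spart_tail n m y : around y -> (n <= m)%N ->
  spart m y <= spart n y + C * bdist y `^ (- s) * (\sum_(k < m) a k - \sum_(k < n) a k).
Proof.
move=> Dy nm; rewrite /spart -(subnKC nm) !big_split_ord /= lerD2l [_ + _ - _]addrAC subrr add0r.
rewrite mulr_sumr; apply: ler_sum => k _; rewrite mulrC ler_wpM2r//.
exact: w_le.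
Qed.

Let W y : R := C * bdist y `^ (- s).
Let W0 y : 0 <= W y. Proof. by rewrite /W mulr_ge0// powR_ge0. Qed.

Let asum_has_sup : has_sup [set \sum_(k < n) a k | n in setT].
Proof.
split; first by exists (\sum_(k < 0) a k), 0%N.
by exists eta => _ [n _ <-].
Qed.

Lemma spart_has_sup y : around y -> has_sup [set spart n y | n in setT].
Proof.
move=> Dy; split; first by exists (spart 0 y), 0%N.
exists (W y * eta) => _ [n _ <-]; have := spart_tail Dy (leq0n n).
rewrite /spart !big_ord0 add0r subr0 => h; apply: le_trans h _.
by rewrite ler_wpM2l ?W0.
Qed.

Lemma spart_le_spot n y : around y -> spart n y <= spot y.
Proof. by move=> Dy; apply: sup_upper_bound; [exact: spart_has_sup|exists n]. Qed.

Lemma spot_ge0 y : around y -> 0 <= spot y.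
Proof. by move=> Dy; apply: le_trans (spart_le_spot 0 Dy); rewrite /spart big_ord0. Qed.

Lemma spot_le_tail n y : around y ->
  spot y <= spart n y + W y * (sup [set \sum_(k < n) a k | n in setT] - \sum_(k < n) a k).
Proof.
move=> Dy; apply: ge_sup; first exact: (spart_has_sup Dy).1.
move=> _ [m _ <-]; have S m' : \sum_(k < m') a k <= sup [set \sum_(k < n) a k | n in setT].
  by apply: sup_upper_bound; [exact: asum_has_sup|exists m'].
have [nm|mn] := leqP n m.
  by apply: le_trans (spart_tail Dy nm) _; rewrite lerD2l ler_wpM2l ?W0// lerD2r.
by apply: le_trans (spart_mono Dy (ltnW mn)) _; rewrite lerDl mulr_ge0 ?W0// subr_ge0.
Qed.

Lemma spot_le y : around y -> spot y <= C * bdist y `^ (- s) * eta.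
Proof.
move=> Dy; apply: ge_sup; first exact: (spart_has_sup Dy).1.
move=> _ [n _ <-]; have := spart_tail Dy (leq0n n).
rewrite /spart !big_ord0 add0r subr0 => h; apply: le_trans h _.
by rewrite ler_wpM2l ?W0.
Qed.

Let W_ball z y : inside z -> cball z (irad z) y -> W y <= C * (7 / 8 * bdist z) `^ (- s).
Proof.
move=> iz yB; have /andP[b1 b2] := bdist_ball x0D yB; rewrite ler_wpM2l//.
by apply: ler_powRN => //; rewrite mulr_gt0// (bdist_gt0 oD nD iz.1).
Qed.

Let eta0 : 0 <= eta. Proof. by have := a_sum 0; rewrite big_ord0. Qed.

Lemma spot_bdd z : inside z -> loc_bounded D spot z.
Proof.
move=> iz; exists (C * (7 / 8 * bdist z) `^ (- s) * eta); first by rewrite !mulr_ge0// powR_ge0.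
move=> y yB; have Dy := inside_around iz yB; rewrite ger0_norm ?spot_ge0//.
by apply: le_trans (spot_le Dy) _; rewrite ler_wpM2r//; exact: W_ball.
Qed.

Lemma walk_spart n z : inside z -> loc_bounded D (spart n) z /\ walk (spart n) z <= spart n z.
Proof.
move=> iz; elim: n => [|n [IH1 IH2]].
  have -> : spart 0 = fun=> 0 by apply/funext => y; rewrite /spart big_ord0.
  by rewrite walk_const//; split => //; exact: loc_bounded_const.
have -> : spart n.+1 = fun y => spart n y + a n * w n y.
  by apply/funext => y; rewrite /spart big_ord_recr.
have wb := loc_boundedZ (a n) (w_bdd n iz).
split; first exact: loc_boundedD.
rewrite (walkD u nD eps01 IH1 wb) (walkZ u nD eps01 _ (w_bdd n iz)) lerD//.
by rewrite ler_wpM2l// w_decay.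
Qed.

(** The mean does not commute with the infinite sum, but the [w_k] share one bound on the ball of
    the step, so the tail there is at most that bound times the tail of the convergent series of the
    [a k]. *)
Lemma spot_decay z : inside z -> walk spot z <= spot z.
Proof.
move=> iz; set B := C * (7 / 8 * bdist z) `^ (- s).
have B0 : 0 <= B by rewrite mulr_ge0// powR_ge0.
apply/ler_addgt0Pr => tau tau0.
have B1 : 0 < B + 1 by lra.
have [_ [n _ <-] hn] := sup_adherent (divr_gt0 tau0 B1) asum_has_sup.
set sg := sup _ in hn; have [wb wd] := walk_spart n iz.
have tl : B * (sg - \sum_(k < n) a k) <= tau.
  have h : sg - \sum_(k < n) a k <= tau / (B + 1) by lra.
  apply: le_trans (ler_wpM2l B0 h) _.
  by rewrite mulrCA ger_pMr// ler_pdivrMr// mul1r; lra.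
have sg0 : 0 <= sg - \sum_(k < n) a k.
  by rewrite subr_ge0; apply: sup_upper_bound; [exact: asum_has_sup|exists n].
have step : walk spot z <= walk (spart n) z + tau.
  rewrite -[X in _ + X](walk_const D u eps01 _ z) -(walkD u nD eps01 wb (loc_bounded_const _ _ _)).
  apply: (walk_le u nD eps01 (spot_bdd iz) (loc_boundedD wb (loc_bounded_const _ _ _))).
  move=> y yB; have Dy := inside_around iz yB; apply: le_trans (spot_le_tail n Dy) _.
  rewrite lerD2l; apply: le_trans tl; rewrite ler_wpM2r//; exact: W_ball.
apply: (le_trans step); rewrite lerD2r; apply: (le_trans wd); apply: spart_le_spot.
exact: inside_self.
Qed.

End FrostmanSum.

Section GreedyPath.
Context {R : realType} {d : nat}.
Local Notation V := 'rV[R]_d.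
Implicit Types (f : V -> R) (x y z : V) (b t r : R) (n m k : nat).

Variables (D : set V) (u : V -> R) (eps : R) (x0 : V) (r1 : R).
Hypotheses (oD : open D) (eps01 : 0 < eps <= 2^-1) (x0D : ~ D x0) (r10 : 0 < r1) (r11 : r1 <= 4^-1).
Local Notation bdist := (bdist D).
Local Notation irad := (irad D).
Local Notation walk := (walk D u eps).
Local Notation inside := (inside D x0 r1).
Local Notation around := (around D x0 r1).

Let nD : exists p, ~ D p. Proof. by exists x0. Qed.

Variables (T g S : V -> R) (beta gd K mu : R).
Hypotheses (beta01 : 0 < beta <= 2^-1) (gd01 : 0 < gd <= 1) (K0 : 0 < K).
Hypothesis T_ge0 : forall y, around y -> 0 <= T y.
Hypothesis T_bdd : forall z, inside z -> loc_bounded D T z.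
Hypothesis T_decay : forall z, inside z -> walk T z <= T z.
Hypothesis g_ge : forall y, around y -> bdist y `^ beta <= g y.
Hypothesis g_bdd : forall z, inside z -> loc_bounded D g z.
Hypothesis g_decay : forall z, inside z -> walk g z <= (1 - gd) * g z.
Hypothesis S_ge0 : forall y, around y -> 0 <= S y.
Hypothesis S_bdd : forall z, inside z -> loc_bounded D S z.
Hypothesis S_decay : forall z, inside z -> walk S z <= S z.

Definition total_pot z : R := T z + K * g z + K * S z.
Local Notation Phi := total_pot.

Let g_gt0 y : around y -> 0 < g y.
Proof. by move=> ay; apply: lt_le_trans (g_ge ay); rewrite powR_gt0// (bdist_gt0 oD nD ay.1). Qed.

Lemma total_pot_ge0 y : around y -> 0 <= Phi y.
Proof.
move=> ay; rewrite /Phi !addr_ge0 ?T_ge0//.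
  exact: (mulr_ge0 (ltW K0) (ltW (g_gt0 ay))).
exact: (mulr_ge0 (ltW K0) (S_ge0 ay)).
Qed.

(** Here [r1 <= 1/4] matters: [bdist z < 2 r1 <= 1/2], so lowering the exponent from 1 to [beta]
    increases the power. *)
Lemma bdist_le_g z : inside z -> bdist z <= g z.
Proof.
move=> iz; have r1p := r10; have r1q := r11; have [bt0 bt1] := andP beta01.
have dz := bdist_gt0 oD nD iz.1; have dz2 := inside_bdist x0D iz.
apply: le_trans (g_ge (inside_self r10 iz)); rewrite -{1}[bdist z]powRr1 ?(ltW dz)//.
by apply: ger_powR; [rewrite dz/=; lra|lra].
Qed.

(** The walk gains [K gd g z]; asking for half of it leaves a strict inequality, so some point of
    the ball does at least as well. *)
Lemma greedy_next z : inside z ->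
  exists2 y, cball z (irad z) y & Phi y < Phi z - K * (gd / 2) * g z.
Proof.
move=> iz; have gz := g_gt0 (inside_self r10 iz); have /andP[gd0 gd1] := gd01.
have b1 := T_bdd iz; have b2 := loc_boundedZ K (g_bdd iz); have b3 := loc_boundedZ K (S_bdd iz).
have b12 := loc_boundedD b1 b2; have b := loc_boundedD b12 b3.
have E : walk Phi z = walk T z + K * walk g z + K * walk S z.
  rewrite -(walkZ u nD eps01 K (g_bdd iz)) -(walkZ u nD eps01 K (S_bdd iz)).
  by rewrite -(walkD u nD eps01 b1 b2) -(walkD u nD eps01 b12 b3).
apply: (walk_exists (u := u) (f := Phi) nD eps01 b); rewrite E /Phi.
have h1 := T_decay iz; have h2 := ler_wpM2l (ltW K0) (g_decay iz); have h3 := ler_wpM2l (ltW K0) (S_decay iz).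
have h4 : 0 < K * gd * g z by rewrite mulr_gt0// mulr_gt0.
have E1 : K * ((1 - gd) * g z) = K * g z - K * gd * g z by ring.
have E2 : K * (gd / 2) * g z = K * gd * g z / 2 by field.
by rewrite E2; rewrite E1 in h2; lra.
Qed.

Variable z0 : V.
Hypotheses (Dz0 : D z0) (z0x : enorm (z0 - x0) < r1 / 2).
Hypotheses (start : Phi z0 <= K * mu) (mu_small : mu <= 2 * gd * r1).

Definition travel (z : nat -> V) n : R := \sum_(i < n) g (z i) / 8.

Lemma greedy_path : exists z : nat -> V, forall n,
  [/\ inside (z n), enorm (z n - x0) <= enorm (z0 - x0) + travel z n,
      enorm (z n.+1 - z n) <= g (z n) / 8 &
      Phi (z n) + 4 * K * gd * travel z n <= Phi z0].
Proof.
have /andP[gd0 gd1] := gd01.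
have nx z : exists y, inside z -> cball z (irad z) y /\ Phi y < Phi z - K * (gd / 2) * g z.
  have [iz|niz] := pselect (inside z); last by exists z.
  by have [y y1 y2] := greedy_next iz; exists y.
have [f hf] := choice nx; pose z n := iter n f z0.
have trS n : travel z n.+1 = travel z n + g (z n) / 8 by rewrite /travel big_ord_recr.
have step n : inside (z n) -> enorm (z n.+1 - z n) <= g (z n) / 8.
  move=> iz; have [yB _] := hf _ iz; apply: le_trans yB _.
  by rewrite iradE ler_pM2r ?invr_gt0//; exact: bdist_le_g.
(* Each step spends [K gd g / 2 = 4 K gd * (g / 8)]. The initial budget [K mu <= 2 K gd r1]
   therefore limits the total length to [r1 / 2], and the path never leaves the region where its
   hypotheses hold. *)
have tr_small n : 0 <= Phi (z n) -> Phi (z n) + 4 * K * gd * travel z n <= Phi z0 ->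
    travel z n <= r1 / 2.
  move=> p0 h; have h1 : 4 * K * gd * travel z n <= K * (2 * gd * r1).
    by have := ler_wpM2l (ltW K0) mu_small; have := start; lra.
  have Kg : 0 < 4 * K * gd by rewrite !mulr_gt0.
  rewrite -(ler_pM2l Kg); apply: (le_trans h1).
  by rewrite le_eqVlt; apply/orP; left; apply/eqP; field.
have H n : [/\ inside (z n), enorm (z n - x0) <= enorm (z0 - x0) + travel z n &
      Phi (z n) + 4 * K * gd * travel z n <= Phi z0].
  have r1p := r10; elim: n => [|n [i1 i2 i3]].
    rewrite /travel big_ord0 mulr0 !addr0; split=> //; split=> //.
    by have := z0x; rewrite /=; lra.
  have [yB yP] := hf _ i1; rewrite -/(z n.+1) in yB yP.
  have ay : around (z n.+1) by exact: (inside_around oD x0D i1 yB).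
  have P3 : Phi (z n.+1) + 4 * K * gd * travel z n.+1 <= Phi z0.
    rewrite trS; have E2 : K * (gd / 2) * g (z n) = 4 * K * gd * (g (z n) / 8) by field.
    by rewrite E2 in yP; rewrite mulrDr; lra.
  have P2 : enorm (z n.+1 - x0) <= enorm (z0 - x0) + travel z n.+1.
    rewrite trS; have := enorm_triB (z n.+1) (z n) x0; have := step n i1; lra.
  split=> //; split; first exact: ay.1.
  have := tr_small n.+1 (total_pot_ge0 ay) P3; have := z0x; lra.
by exists z => n; have [i1 i2 i3] := H n; split=> //; exact: step.
Qed.

Lemma travel_mono (z : nat -> V) n m : (forall k, inside (z k)) -> (n <= m)%N -> travel z n <= travel z m.
Proof.
move=> iz nm; rewrite /travel -(subnKC nm) big_split_ord /= lerDl.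
apply: sumr_ge0 => i _; rewrite divr_ge0// ltW// g_gt0//.
exact: (inside_self r10).
Qed.

(** A cluster point exists by compactness, and the path converges to it because later displacements
    are bounded by the tail of [travel]. The terms [g (z n)], hence the depths, tend to 0, so the
    limit is not in [D]. *)
Lemma greedy_limit : exists (z : nat -> V) (x : V),
  [/\ forall n, inside (z n) /\ Phi (z n) <= Phi z0,
      forall b, 0 < b -> exists n0, forall n, (n0 <= n)%N -> enorm (z n - x) <= b /\ bdist (z n) <= b,
      boundary D x & enorm (x - x0) <= r1].
Proof.
have /andP[gd0 gd1] := gd01; have r1p := r10; have Kg : 0 < 4 * K * gd by rewrite !mulr_gt0.
have [z hz] := greedy_path.
have iz n : inside (z n) by have [] := hz n.
have mono n m : (n <= m)%N -> travel z n <= travel z m by exact: travel_mono.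
have tr0 n : 0 <= travel z n by have := mono 0%N n (leq0n n); rewrite {1}/travel big_ord0.
have tr_le n : travel z n <= r1 / 2.
  have [i1 _ _ h] := hz n; have p0 := total_pot_ge0 (inside_self r10 i1).
  have h1 : 4 * K * gd * travel z n <= K * (2 * gd * r1).
    by have := ler_wpM2l (ltW K0) mu_small; have := start; lra.
  rewrite -(ler_pM2l Kg); apply: (le_trans h1).
  by rewrite le_eqVlt; apply/orP; left; apply/eqP; field.
have hs : has_sup [set travel z n | n in setT].
  by split; [exists (travel z 0), 0%N|exists (r1 / 2) => _ [n _ <-]].
pose sg := sup [set travel z n | n in setT].
have le_sg n : travel z n <= sg by apply: sup_upper_bound => //; exists n.
have dist n m : (n <= m)%N -> enorm (z m - z n) <= travel z m - travel z n.
  move=> nm; rewrite -(subnKC nm); elim: (m - n)%N => [|k IH]; first by rewrite addn0 !subrr enorm0.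
  have E : travel z (n + k).+1 = travel z (n + k) + g (z (n + k)%N) / 8 by rewrite /travel big_ord_recr.
  rewrite addnS E; have [_ _ h _] := hz (n + k)%N; have := enorm_triB (z (n + k).+1) (z (n + k)%N) (z n); lra.
have inB n : cball x0 r1 (z n).
  have [_ h _ _] := hz n; have := tr_le n; have := z0x; rewrite /cball /=; lra.
have [x [xB xc]] : cball x0 r1 `&` cluster (z n @[n --> \oo]) !=set0.
  by apply: (@cball_compact _ _ x0 r1 (z n @[n --> \oo])); exists 0%N => // n _; exact: inB.
have near_x n b : 0 < b -> enorm (z n - x) <= sg - travel z n + b.
  move=> b0; have A1 : (z n @[n --> \oo]) [set z m | m in [set m | (n <= m)%N]].
    by exists n => // m nm; exists m.
  have A2 : nbhs x [set y | enorm (y - x) < b] by apply/nbhs_enorm; exists b.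
  have [_ [[m nm <-] mx]] := xc _ _ A1 A2.
  have := dist n m nm; have := le_sg m; have := enorm_triB (z n) (z m) x.
  by rewrite (enormB (z n) (z m)); move: mx => /=; lra.
have near_x' n : enorm (z n - x) <= sg - travel z n by apply/ler_addgt0Pr => b; exact: near_x.
have lim b : 0 < b -> exists n0, forall n, (n0 <= n)%N -> enorm (z n - x) <= b /\ bdist (z n) <= b.
  move=> b0; have b8 : 0 < b / 8 by rewrite divr_gt0.
  have [_ [n0 _ <-] hn] := sup_adherent b8 hs; exists n0 => n nn.
  rewrite -/sg in hn; have m1 := mono _ _ nn; have := near_x' n; split; first by lra.
  have E : travel z n.+1 = travel z n + g (z n) / 8 by rewrite /travel big_ord_recr.
  have := le_sg n.+1; have := bdist_le_g (iz n); rewrite E; lra.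
exists z, x; split=> //.
- by move=> n; have [i1 _ _ h] := hz n; split=> //; have := mulr_ge0 (ltW Kg) (tr0 n); lra.
- split.
    move=> A /nbhs_enorm[b b0 bA]; have b2 : 0 < b / 2 by rewrite divr_gt0.
    have [n0 /(_ n0 (leqnn _))[zx _]] := lim _ b2; exists (z n0); split; first exact: (iz n0).1.
    by apply: bA; apply: le_lt_trans zx _; rewrite ltr_pdivrMr// ltr_pMr// ltr1n.
  rewrite (interior_id _).1// => Dx; have dx := bdist_gt0 oD nD Dx.
  have dx4 : 0 < bdist x / 4 by rewrite divr_gt0.
  have [n0 /(_ n0 (leqnn _))[zx zb]] := lim _ dx4.
  by have := bdist_lip nD x (z n0); rewrite (enormB x); lra.
Qed.

End GreedyPath.

(** * The path in a domain with an exterior cone condition, and the choice of the constants *)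

Section ConePath.
Context {R : realType} {d : nat}.
Local Notation V := 'rV[R]_d.
Implicit Types (f : V -> R) (x y z p : V) (b t r : R) (n m k : nat).

Variables (D : set V) (u : V -> R) (M : R) (x0 e : V) (c R0 : R).
Hypotheses (oD : open D) (hu : harmonic_on D u) (uM : forall y, D y -> `|u y| <= M) (M0 : 0 <= M).
Hypotheses (u0 : forall y, D y -> 0 <= u y) (d2 : (1 < d)%N).
Hypotheses (e1 : dot e e = 1) (c01 : 0 < c <= 1) (R00 : 0 < R0) (x0D : ~ D x0) (x0cl : closure D x0).
Hypothesis Hcone : forall p z, ~ D p -> enorm (p - x0) < R0 -> D z ->
  enorm (z - x0) < R0 -> in_cone e c (z - p).

Local Notation bdist := (bdist D).
Local Notation irad := (irad D).

Let nD : exists p, ~ D p. Proof. by exists x0. Qed.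
Let d0 : (0 < d)%N. Proof. exact: ltnW. Qed.
Let ee1 : enorm e = 1. Proof. by rewrite enormE e1 sqrtr1. Qed.

Lemma enorm_add_dir w s : 0 <= s -> in_cone e c w -> c / 2 * (enorm w + s) <= enorm (w + s *: e).
Proof.
move=> s0 [w0]; rewrite /tilt => wc; have /andP[c0 c1] := c01.
have W0 := enorm_ge0 w; rewrite -ler_sqr ?nnegrE ?enorm_ge0//; last first.
  by apply: mulr_ge0; lra.
rewrite sqr_enorm dotDl !dotDr !dotZl !dotZr e1 -sqr_enorm [dot e w]dotC mulr1 -!expr2.
move: (dot w e) wc => P; move: (enorm w) W0 w0 => W W0 w0 wc.
have h1 : 2 * s * (- ((1 - c) * W)) <= 2 * s * P by rewrite ler_wpM2l ?mulr_ge0//; lra.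
have h2 : 0 <= (1 - c) * (W - s) ^+ 2 by rewrite mulr_ge0 ?sqr_ge0//; lra.
have h3 : 0 <= c * (1 - c) * (W ^+ 2 + s ^+ 2) by rewrite mulr_ge0 ?addr_ge0 ?sqr_ge0// mulr_ge0//; lra.
have h4 : 0 <= c ^+ 2 * (W - s) ^+ 2 by rewrite mulr_ge0 ?sqr_ge0.
have h5 : 0 <= c * (W ^+ 2 + s ^+ 2) by rewrite mulr_ge0 ?addr_ge0 ?sqr_ge0//; lra.
have h6 : 0 <= c * c * (W ^+ 2 + s ^+ 2) by rewrite mulr_ge0 ?addr_ge0 ?sqr_ge0// mulr_ge0//; lra.
by nra.
Qed.

(** For exterior points near [x0] the cone condition makes the distance grow along [e]; the others
    are too far away to matter for [s <= R0 / 4]. *)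
Lemma bdist_add_dir r1 z s : 0 < r1 -> 10 * r1 <= R0 -> inside D x0 r1 z -> 0 <= s <= R0 / 4 ->
  c / 2 * (bdist z + s) <= bdist (z + s *: e).
Proof.
move=> r10 r1R [Dz zx] /andP[s0 sR]; have /andP[c0 c1] := c01.
apply: bdist_ge => // p np; have [pn|pf] := ltP (enorm (p - x0)) R0.
  have zc : in_cone e c (z - p) by apply: Hcone => //; lra.
  have -> : z + s *: e - p = z - p + s *: e by rewrite addrAC.
  apply: le_trans (enorm_add_dir s0 zc); rewrite ler_wpM2l//; first by lra.
  by rewrite lerD2r; exact: bdist_le.
have b1 := bdist_le nD z x0D.
have b0 := bdist_ge0 nD z.
have h : c / 2 * (bdist z + s) <= 1 / 2 * (bdist z + s) by rewrite ler_wpM2r; lra.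
have t1 := enorm_triB p (z + s *: e) x0.
have t2 : enorm (z + s *: e - x0) <= enorm (z - x0) + s.
  have -> : z + s *: e - x0 = z - x0 + s *: e by rewrite addrAC.
  by apply: le_trans (enormD _ _) _; rewrite enormZ ee1 mulr1 ger0_norm.
rewrite (enormB p (z + s *: e)) in t1; lra.
Qed.

Lemma short_step (a t b r : R) : 0 < t -> t <= a -> a < b / 2 -> 10 * b <= r -> 0 <= t <= r / 4.
Proof. by move=> *; apply/andP; split; lra. Qed.

Lemma le_of_lip (a b B B' l m : R) : 0 <= a -> a + b <= B -> B <= B' + l -> l <= m -> b <= B' + m.
Proof. by move=> *; lra. Qed.

Lemma half_lt (a : R) : 0 < a -> ~ a <= a / 2.
Proof. by move=> *; lra. Qed.

Lemma sum_lt2 (a t b r : R) : 0 < r -> a <= r -> t <= b -> b < r / 2 -> a + t < 2 * r.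
Proof. by move=> *; lra. Qed.

Lemma sum_le3 (a : R) : a <= 1 * 2 -> 1 + a <= 3.
Proof. by move=> *; lra. Qed.

Lemma le_add3 (a1 a2 a3 m : R) : 0 <= a1 -> 0 <= a2 -> 0 <= a3 -> a1 + a2 + a3 <= m -> a1 <= m /\ a3 <= m.
Proof.
move=> h1 h2 h3 H0; split; apply: le_trans H0; last by rewrite lerDr addr_ge0.
by rewrite -addrA lerDl addr_ge0.
Qed.

Lemma exprD1_unbounded (a b : R) : 0 < a -> exists n, b <= (1 + a) ^+ n.
Proof.
move=> a0; have bern n : n%:R * a <= (1 + a) ^+ n.
  elim: n => [|n IH]; first by rewrite mul0r expr0.
  have p1 : 1 <= (1 + a) ^+ n by rewrite exprn_ege1// lerDl ltW.
  by rewrite exprS mulrDl mul1r -natr1 mulrDl mul1r lerD// ler_peMr// ltW.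
exists (Num.trunc (b / a)).+1; apply: le_trans (bern _).
by rewrite -ler_pdivrMr// ltW// truncnS_gt.
Qed.

Lemma tscale_le b : 0 < b -> exists k', @tscale R k' <= b.
Proof.
move=> b0; exists (Num.trunc b^-1).+1.
by have := @tscale_small R 0 b _ b0 (ltnSn (Num.trunc b^-1)).
Qed.

Lemma tscaleD m n : @tscale R (m + n) = @tscale R m * (2^-1) ^+ n.
Proof. by rewrite /tscale exprD. Qed.

Section GreedySelection.
Variables (beta A s gd eps r1 Cw : R) (g : V -> R) (fpot : V -> V -> R).
Hypotheses (beta01 : 0 < beta <= 2^-1) (gd01 : 0 < gd <= 1) (eps01 : 0 < eps <= 2^-1) (A1 : 1 <= A) (s0 : 0 < s).
Hypotheses (r10 : 0 < r1) (r11 : r1 <= 4^-1) (r1R : 10 * r1 <= R0) (Cw0 : 0 < Cw).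
Hypothesis r1S : 10 * r1 <= chain_ratio (c / 2) (c / 4) * (R0 / 4).

Local Notation around := (around D x0 r1).
Local Notation inside := (inside D x0 r1).
Local Notation walk := (walk D u eps).

Hypothesis g_ge10 : forall y, D y -> enorm (y - x0) < 10 * r1 -> bdist y `^ beta <= g y.
Hypothesis g_le : forall y, D y -> enorm (y - x0) < 3 * r1 -> g y <= 2 * A * bdist y `^ beta.
Hypothesis g_bdd : forall z, inside z -> loc_bounded D g z.
Hypothesis g_decay : forall z, inside z -> walk g z <= (1 - gd) * g z.
Hypothesis fpot_ge : forall p y, ~ D p -> enorm (p - x0) < 10 * r1 -> around y -> enorm (y - p) `^ (- s) <= fpot p y.
Hypothesis fpot_le : forall p y, ~ D p -> enorm (p - x0) < 10 * r1 -> around y -> fpot p y <= Cw * bdist y `^ (- s).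
Hypothesis fpot_bdd : forall p z, ~ D p -> enorm (p - x0) < 10 * r1 -> inside z -> loc_bounded D (fpot p) z.
Hypothesis fpot_decay : forall p z, ~ D p -> enorm (p - x0) < 10 * r1 -> inside z -> walk (fpot p) z <= fpot p z.

Let around10 y : around y -> enorm (y - x0) < 10 * r1.
Proof. by move=> [_ yx]; have r1p := r10; lra. Qed.

Let g_ge y : around y -> bdist y `^ beta <= g y.
Proof. by move=> ay; apply: g_ge10; [exact: ay.1|exact: around10]. Qed.

Let g_gt0 y : around y -> 0 < g y.
Proof. by move=> ay; apply: lt_le_trans (g_ge ay); rewrite powR_gt0// (bdist_gt0 oD nD ay.1). Qed.

Let c401 : 0 < c / 2 <= 1. Proof. by have /andP[c0 c1] := c01; apply/andP; split; lra. Qed.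
Let c701 : 0 < c / 4 <= 1. Proof. by have /andP[c0 c1] := c01; apply/andP; split; lra. Qed.
Local Notation q := (chain_ratio (c / 2) (c / 4)).
Local Notation lam := (@walk_lower_const R d eps).

Let Hup z : inside z -> forall t, 0 <= t <= R0 / 4 -> c / 2 * (bdist z + t) <= bdist (z + t *: e).
Proof. by move=> iz t ht; exact: (bdist_add_dir r10 r1R iz ht). Qed.

Lemma greedy_start mu : 0 < mu -> exists z0, [/\ D z0, enorm (z0 - x0) < r1 / 2 & g z0 <= mu].
Proof.
move=> mu0; have A1' := A1; have [bt0 bt1] := andP beta01; have r1p := r10.
have m0 : 0 < mu / (2 * A) by rewrite divr_gt0//; lra.
have t0 : 0 < Num.min (r1 / 2) ((mu / (2 * A)) `^ beta^-1) by rewrite lt_min divr_gt0//= powR_gt0.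
have nb : nbhs x0 [set y | enorm (y - x0) < Num.min (r1 / 2) ((mu / (2 * A)) `^ beta^-1)].
  by apply/nbhs_enorm; eexists; first exact: t0.
have [z [Dz]] := x0cl nb; rewrite /= lt_min => /andP[zr zm].
exists z; split=> //; apply: le_trans (g_le Dz _) _; first by lra.
have h : bdist z `^ beta <= mu / (2 * A).
  have -> : mu / (2 * A) = ((mu / (2 * A)) `^ beta^-1) `^ beta.
    by rewrite -powRrM mulVf ?gt_eqF// powRr1// ltW.
  apply: ge0_ler_powR; rewrite ?nnegrE ?powR_ge0 ?(bdist_ge0 nD)//; first exact: ltW.
  by apply: le_trans (bdist_le nD z x0D) (ltW zm).
by rewrite mulrC -ler_pdivlMr//; lra.
Qed.

Lemma greedy_selection : exists eta ts, [/\ 0 < eta, 0 < ts &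
  forall (p : nat -> V) (rho : nat -> R),
  (forall k, [/\ ~ D (p k), enorm (p k - x0) < 10 * r1 & 0 < rho k]) ->
  (forall n, \sum_(k < n) rho k `^ s <= eta) ->
  exists x, [/\ boundary D x, enorm (x - x0) <= r1,
    forall k, rho k < enorm (x - p k),
    forall t, 0 < t <= ts -> D (x + t *: e) &
    exists B, forall n (t : nat -> R),
      (forall i, ts * (2^-1) ^+ i / 2 <= t i <= ts * (2^-1) ^+ i) ->
      \sum_(i < n) ts * (2^-1) ^+ i * enorm (grad u (x + t i *: e)) <= B]].
Proof.
have /andP[c0 c1] := c01; have /andP[gd0 gd1] := gd01; have A1' := A1; have r1p := r10; have r1q := r11.
have [q0 q1] := andP (chain_ratio_bounds c401 c701).
have [k0 k0P] := exprD1_unbounded ((2 / lam) ^+ 2) q0.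
have p2 : 1 <= 2 ^+ k0 :> R by rewrite exprn_ege1// ler1n.
have p20 : 0 < 2 ^+ k0 :> R := lt_le_trans ltr01 p2.
pose c6 := gd / 2 / 2 ^+ k0.
have c601 : 0 < c6 <= 1.
  rewrite /c6 (divr_gt0 _ p20) ?divr_gt0//= ler_pdivrMr// mul1r.
  by apply: le_trans p2; lra.
have c6s : 2 ^+ k0 * c6 <= gd / 2 by rewrite /c6 mulrC divfK// gt_eqF.
clearbody c6.
have A0 : 0 <= 2 * A by lra.
pose C1 := entry_const (2 * A) * @drop_const R d eps (c / 2) (c / 4) c6 k0.
have C10 : 0 <= C1.
  apply: mulr_ge0; first by rewrite /entry_const; lra.
  exact: (ltW (drop_const_gt0 eps01 d0 c401 c701 k0 c601)).
(* The first bound keeps the path within [r1] of [x0]; the second makes entering one of the balls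
   unaffordable. *)
pose mu := Num.min (2 * gd * r1) (2 `^ (- s) / 2).
have mu0 : 0 < mu.
  rewrite /mu lt_min !divr_gt0 ?powR_gt0// andbT; exact: (mulr_gt0 (mulr_gt0 _ gd0) r10).
have mu1 : mu <= 2 * gd * r1 by rewrite /mu ge_min lexx.
have mu2 : mu <= 2 `^ (- s) / 2 by rewrite /mu ge_min lexx orbT.
clearbody mu.
have mu3 : 0 < mu / 3 by rewrite divr_gt0.
have [z0 [Dz0 z0x gz0]] := greedy_start mu3.
have bz0 := bdist_gt0 oD nD Dz0.
have az0 : around z0 by split=> //; lra.
(* No scale above the depth of [z0] is used, so the gradient part of the potential vanishes at the
   start. *)
have [kst hkst] := tscale_le bz0.
(* The potentials [T], [K g] and [K S] each take at most a third of [K mu] at [z0]. [K] settles the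
   first; [z0] was chosen with [g z0 <= mu / 3]; [eta] below settles the third and is fixed before
   the balls are given. *)
pose K := C1 * (2 * M) / (mu / 3) + 1.
have M20 : 0 <= 2 * M by rewrite mulr_ge0.
have K0 : 0 < K by rewrite /K ltr_wpDl// divr_ge0 ?(ltW mu3)// mulr_ge0.
have KC : C1 * (2 * M) <= K * (mu / 3).
  by rewrite -ler_pdivrMr// /K lerDl.
clearbody K.
pose eta := mu / 3 / (Cw * bdist z0 `^ (- s)).
have fb0 := Cw0.
have ft0 : 0 < Cw * bdist z0 `^ (- s) by rewrite mulr_gt0// powR_gt0.
have eta0 : 0 < eta by rewrite divr_gt0.
have ts0 := @tscale_gt0 R kst.
exists eta, (@tscale R kst); split=> // p rho hp hsum.
have a0 k' : 0 <= rho k' `^ s by exact: powR_ge0.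
pose w (k' : nat) : V -> R := fpot (p k').
have np k' : ~ D (p k') by have [] := hp k'.
have px k' : enorm (p k' - x0) < 10 * r1 by have [] := hp k'.
have w_le k' y : around y -> w k' y <= Cw * bdist y `^ (- s) by move=> ay; exact: fpot_le.
have w_ge0 k' y : around y -> 0 <= w k' y.
  by move=> ay; apply: le_trans (fpot_ge (np k') (px k') ay); exact: powR_ge0.
have w_bdd k' z : inside z -> loc_bounded D (w k') z by move=> iz; exact: fpot_bdd.
have w_decay k' z : inside z -> walk (w k') z <= w k' z by move=> iz; exact: fpot_decay.
pose S := spot w (fun k' => rho k' `^ s).
pose tp := tpot D u x0 r1 (c / 4) c6 k0 g beta kst.
pose T y := C1 * bpot D u eps y + tp y.
have tpd z : inside z -> loc_bounded D tp z /\
    walk tp z <= tp z + C1 * (bpot D u eps z - walk (bpot D u eps) z).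
  exact: (tpot_decay oD hu eps01 uM u0 d0 M0 x0D r10 ee1 c401 c701 Hup r1S c601 k0P beta01 gd01 A0
    g_ge10 g_le g_bdd g_decay c6s kst).
have bb z : inside z -> loc_bounded D (bpot D u eps) z.
  by move=> iz; exact: (bounded_on_loc oD nD M20 (bpot_bounded_on oD nD eps01 uM u0 M0) iz.1).
have T_bdd z : inside z -> loc_bounded D T z.
  by move=> iz; exact: (loc_boundedD (loc_boundedZ C1 (bb z iz)) (tpd z iz).1).
have T_decay z : inside z -> walk T z <= T z.
  move=> iz; rewrite /T (walkD u nD eps01 (loc_boundedZ C1 (bb z iz)) (tpd z iz).1).
  by rewrite (walkZ u nD eps01 _ (bb z iz)); have := (tpd z iz).2; rewrite mulrBr; lra.
have tp_ge0 y : around y -> 0 <= tp y.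
  by move=> ay; exact: (tpart_ge0 oD hu uM d0 M0 x0D r10 c701 k0 c601 g_ge10 kst _ ay.1 ay.2).
have b_ge0 y : D y -> 0 <= bpot D u eps y <= 2 * M by exact: (bpot_bounds oD nD eps01 uM u0 M0).
have T_ge0 y : around y -> 0 <= T y.
  by move=> ay; have /andP[h _] := b_ge0 y ay.1; rewrite /T addr_ge0 ?tp_ge0// mulr_ge0.
have tp_T y : D y -> tp y <= T y.
  by move=> Dy; rewrite /T lerDr mulr_ge0//; have /andP[] := b_ge0 y Dy.
have tp_sum n z : inside z -> \sum_(i < n) (if bdist z < @tscale R (kst + i) then
    fhat D u x0 r1 (c / 4) c6 k0 (@tscale R (kst + i)) z else 0) <= tp z.
  by move=> iz; exact: (fhat_le_tpot oD hu uM d0 M0 x0D r10 c701 k0 c601 g_ge10 kst n iz).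
have S_ge0 y : around y -> 0 <= S y by exact: (spot_ge0 a0 (ltW fb0) w_le hsum).
have S_bdd z : inside z -> loc_bounded D S z.
  exact: (spot_bdd oD x0D a0 (ltW s0) (ltW fb0) w_le hsum).
have S_decay z : inside z -> walk S z <= S z.
  exact: (spot_decay oD eps01 x0D r10 a0 (ltW s0) (ltW fb0) w_ge0 w_le w_bdd w_decay hsum).
have S_term k' y : around y -> rho k' `^ s * w k' y <= S y.
  move=> ay; apply: le_trans (spart_le_spot a0 (ltW Cw0) w_le hsum k'.+1 ay).
  rewrite /spart big_ord_recr /= lerDr; apply: sumr_ge0 => i _.
  by rewrite mulr_ge0 ?w_ge0.
have tp0 : tp z0 = 0.
  rewrite /tp /tpot /tpart big1// => i _; rewrite /active ltNge (le_trans _ hkst)//.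
  by rewrite tscaleD ler_piMr ?(ltW ts0)// exprn_ile1 ?invr_ge0// invf_le1 ?ler1n.
have Tz0 : T z0 <= C1 * (2 * M).
  rewrite /T tp0 addr0 ler_wpM2l//; by have /andP[] := b_ge0 z0 Dz0.
have Sz0 : S z0 <= mu / 3.
  apply: le_trans (spot_le a0 (ltW fb0) w_le hsum az0) _.
  by rewrite /eta mulrC divfK// gt_eqF.
clearbody eta T S tp C1.
have start : total_pot T g S K z0 <= K * mu.
  have -> : K * mu = K * (mu / 3) + K * (mu / 3) + K * (mu / 3) by field.
  rewrite /total_pot lerD//; last by rewrite ler_pM2l.
  by rewrite lerD//; [exact: le_trans KC|rewrite ler_pM2l].
have [z [x [zin zlim bx xx]]] := greedy_limit oD eps01 x0D r10 r11 beta01 gd01 K0 T_ge0 T_bdd T_decay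
  g_ge g_bdd g_decay S_ge0 S_bdd S_decay Dz0 z0x start mu1.
have ts_r1 : @tscale R kst < r1 / 2.
  by apply: le_lt_trans hkst _; apply: le_lt_trans z0x; exact: bdist_le.
have ch0 : 0 < c / 2 := divr_gt0 c0 (ltr0n R 2).
have xdist t : 0 < t <= @tscale R kst -> c / 2 * t <= bdist (x + t *: e).
  move=> /andP[t0 t1]; apply/ler_addgt0Pr => b b0.
  have [n1 /(_ n1 (leqnn _))[zx _]] := zlim _ b0.
  have h1 := Hup (zin n1).1 (short_step t0 t1 ts_r1 r1R).
  have h2 := bdist_lip nD (z n1 + t *: e) (x + t *: e).
  rewrite opprD addrACA subrr addr0 in h2.
  have h3 : 0 <= c / 2 * bdist (z n1) by rewrite (mulr_ge0 (ltW ch0)) ?bdist_ge0.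
  by rewrite mulrDr in h1; exact: (le_of_lip h3 h1 h2 zx).
have xD t : 0 < t <= @tscale R kst -> D (x + t *: e).
  move=> ht; apply: contrapT => nx; have := xdist t ht; rewrite (bdist_out nD nx) leNgt => /negP; apply.
  by case/andP: ht => t0 _; exact: mulr_gt0.
have Phi_ge n : [/\ T (z n) <= K * mu & S (z n) <= mu].
  have [iz h] := zin n; have ay := inside_self r10 iz.
  have h1 : total_pot T g S K (z n) <= K * mu by exact: le_trans start.
  have gz := g_gt0 ay; have p1 := mulr_ge0 (ltW K0) (ltW gz); have p3 := T_ge0 _ ay.
  have p4 := mulr_ge0 (ltW K0) (S_ge0 _ ay); rewrite /total_pot in h1.
  have [q1' q2'] := le_add3 p3 p1 p4 h1; split; first exact: q1'.
  by rewrite -(ler_pM2l K0); exact: q2'.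
exists x; split=> //.
(* Otherwise a late point of the path is within [2 rho_k] of [p_k], so that [rho_k^s w_k >= 2^(-s)]
   there, although [S <= mu <= 2^(-s) / 2] all along the path. *)
- move=> k'; rewrite ltNge; apply/negP => xp; have [_ _ rho0] := hp k'.
  have [n1 /(_ n1 (leqnn _))[zx _]] := zlim _ rho0; have [iz _] := zin n1.
  have ay := inside_self r10 iz; have [_ Sz] := Phi_ge n1.
  have zp : enorm (z n1 - p k') <= 2 * rho k'.
    have -> : 2 * rho k' = rho k' + rho k' by ring.
    by apply: le_trans (enorm_triB _ x _) _; exact: lerD.
  have zp0 : 0 < enorm (z n1 - p k').
    by apply: lt_le_trans (bdist_le nD _ (np k')); exact: (bdist_gt0 oD nD iz.1).
  have h1 : (2 * rho k') `^ (- s) <= w k' (z n1).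
    by apply: le_trans (fpot_ge (np k') (px k') ay); apply: ler_powRN => //; exact: ltW.
  have h2 : 2 `^ (- s) <= rho k' `^ s * w k' (z n1).
    apply: le_trans (ler_wpM2l (a0 k') h1); rewrite powRM ?(ltW rho0)// mulrCA.
    by rewrite -powRD ?subrr ?powRr0 ?mulr1//; apply/implyP => _; rewrite gt_eqF.
  have h5 : 0 < 2 `^ (- s) :> R by rewrite powR_gt0.
  exact: (half_lt h5 (le_trans (le_trans h2 (le_trans (S_term k' _ ay) Sz)) mu2)).
(* One late point of the path serves all [n] terms: it is nearer to [x] and shallower than the [n]
   scales in question, so all of these are active there. It lies within [2 t] of the sample point at
   scale [t], so with [c6 <= 1] the weight in [fterm] is at most [3^k0]. *)
exists (3 ^+ k0 * (K * mu)) => n t ht.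
have [n1 /(_ n1 (leqnn _))[zx zb]] := zlim _ (@tscale_gt0 R (kst + n)); have [iz _] := zin n1.
have ay := inside_self r10 iz; have [Tz _] := Phi_ge n1.
have tpz : tp (z n1) <= K * mu.
  by apply: le_trans Tz; exact: (tp_T _ iz.1).
have F := tp_sum n _ iz.
have p3 : 0 < 3 ^+ k0 :> R by rewrite exprn_gt0.
apply: le_trans (ler_wpM2l (ltW p3) (le_trans F tpz)); rewrite mulr_sumr; apply: ler_sum => i _.
have ti0 := @tscale_gt0 R (kst + i).
have tin : @tscale R (kst + n) < @tscale R (kst + i).
  have ni : (kst + i < kst + n)%N by rewrite ltn_add2l.
  by rewrite /tscale ltr_iXn2l ?invr_gt0// invf_lt1 ?ltr1n.
have tik : @tscale R (kst + i) <= @tscale R kst.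
  by rewrite tscaleD ler_piMr ?(ltW ts0)// exprn_ile1 ?invr_ge0// invf_le1 ?ler1n.
rewrite (le_lt_trans zb tin) -tscaleD; have := ht i; rewrite -tscaleD => /andP[t1 t2].
set ti := @tscale R (kst + i) in ti0 tin tik t1 t2 *.
have tpos : 0 < t i <= @tscale R kst.
  by rewrite (lt_le_trans (divr_gt0 ti0 (ltr0n R 2)) t1) (le_trans t2 tik).
set y := x + t i *: e.
have yx : enorm (y - x0) < 2 * r1.
  have -> : y - x0 = x - x0 + t i *: e by rewrite /y addrAC.
  apply: le_lt_trans (enormD _ _) _; rewrite enormZ ee1 mulr1 gtr0_norm; last by case/andP: tpos.
  by case/andP: tpos => _ h; exact: (sum_lt2 r10 xx h ts_r1).
have fy : fset D x0 r1 (c / 4) ti y.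
  split; first by split=> //; exact: xD.
  apply: le_trans (xdist _ tpos).
  have -> : c / 4 * ti = c / 2 * (ti / 2) by field.
  by rewrite (ler_wpM2l (ltW ch0)).
have ff := fterm_le_fhat oD hu uM d0 M0 x0D c701 k0 c601 (z n1) ti0 fy.
apply: le_trans (ler_wpM2l (ltW p3) ff); rewrite /fterm.
have W0 : 0 < 1 + c6 * (enorm (z n1 - y) / ti).
  have h := mulr_ge0 (ltW (andP c601).1) (divr_ge0 (enorm_ge0 (z n1 - y)) (ltW ti0)).
  exact: ltr_pwDl.
have W3 : 1 + c6 * (enorm (z n1 - y) / ti) <= 3.
  have zy : enorm (z n1 - y) <= 2 * ti.
    apply: le_trans (enorm_triB _ x _) _.
    have -> : x - y = - (t i *: e) by rewrite /y opprD addNKr.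
    rewrite enormN enormZ ee1 mulr1 gtr0_norm; last by case/andP: tpos.
    have -> : 2 * ti = ti + ti by ring.
    exact: (lerD (le_trans zx (ltW tin)) t2).
  have h : enorm (z n1 - y) / ti <= 2 by rewrite ler_pdivrMr.
  have h0 : 0 <= enorm (z n1 - y) / ti by rewrite divr_ge0 ?enorm_ge0 ?(ltW ti0).
  have /andP[c60 c61] := c601; apply: sum_le3.
  by rewrite ler_pM// ltW.
rewrite mulrCA ler_peMr//; first by rewrite mulr_ge0 ?enorm_ge0 ?(ltW ti0).
rewrite ler_pdivlMr ?exprn_gt0// mul1r; apply: lerXn2r => //; rewrite nnegrE// ltW//.
Qed.

End GreedySelection.

Section Assembly.
Variables (beta A k sigma k1 k2 : R) (G H : V -> R) (G1 G2 H1 H2 : 'I_d -> V -> R).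
Hypotheses (beta01 : 0 < beta <= 2^-1) (k_gt0 : 0 < k) (GC2 : C2_with [set w | in_cone e c w] G G1 G2).
Hypothesis Gb : forall w, in_cone e c w -> enorm w `^ beta <= G w <= A * enorm w `^ beta.
Hypothesis GL : forall w, in_cone e c w -> \sum_(i < d) G2 i w <= - (k * enorm w `^ (beta - 2)).
Hypotheses (sg0 : 0 < sigma) (k10 : 0 < k1) (HC2 : C2_with [set w | in_cone e c w] H H1 H2).
Hypothesis Hb : forall w, in_cone e c w -> k1 * enorm w `^ (- sigma) <= H w <= k2 * enorm w `^ (- sigma).
Hypothesis HL : forall w, in_cone e c w -> \sum_(i < d) H2 i w <= 0.
Variables (gam s r1 : R) (n0 : nat).
Hypotheses (gam01 : 0 < gam <= 1) (s0 : 0 < s) (sE : s = sigma * (1 - gam) - beta * gam) (sn : s <= n0%:R).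
Hypotheses (r10 : 0 < r1) (r11 : r1 <= 4^-1) (r1R : 10 * r1 <= R0).
Hypothesis r1S : 10 * r1 <= chain_ratio (c / 2) (c / 4) * (R0 / 4).

Local Notation around := (around D x0 r1).
Local Notation inside := (inside D x0 r1).

Let gdc : R := @gdecay R d beta A k.
Let gd : R := Num.min 1 gdc.
Let eps : R := Num.min 2^-1 (Num.min (gdc / 4) (gam * gd / 8)).
Local Notation walk := (walk D u eps).
Let g : V -> R := gpot D x0 r1 G.

Let gdc0 : 0 < gdc. Proof. exact: (gdecay_gt0 e1 c01 k_gt0 Gb). Qed.

Let gd01 : 0 < gd <= 1.
Proof. by rewrite /gd lt_min ltr01 gdc0 ge_min lexx. Qed.

Let eps01 : 0 < eps <= 2^-1.
Proof.
have /andP[gm0 _] := gam01; have /andP[gd0 _] := gd01.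
apply/andP; split; last by rewrite /eps ge_min lexx.
by rewrite /eps !lt_min invr_gt0 ltr0n (divr_gt0 gdc0)// (divr_gt0 (mulr_gt0 gm0 gd0)).
Qed.

Let eps_g : eps <= gdc / 4.
Proof. by rewrite /eps !ge_min lexx orbT. Qed.

Let eps_w : 4 * eps <= gam * gd / 2.
Proof.
have : eps <= gam * gd / 8 by rewrite /eps !ge_min lexx !orbT.
by move: (gam * gd) => X; lra.
Qed.

Let HR p z : ~ D p -> enorm (p - x0) < 10 * r1 -> D z -> enorm (z - x0) < 10 * r1 -> in_cone e c (z - p).
Proof. by move=> np px Dz zx; apply: Hcone => //; [exact: lt_le_trans px r1R|exact: lt_le_trans zx r1R]. Qed.

Let g_ge10 y : D y -> enorm (y - x0) < 10 * r1 -> bdist y `^ beta <= g y.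
Proof. exact: (gpot_ge r10 x0D HR beta01 Gb). Qed.

Let around10 y : around y -> enorm (y - x0) < 10 * r1.
Proof. by move=> [_ yx]; have r1p := r10; lra. Qed.

Let g_ge y : around y -> bdist y `^ beta <= g y.
Proof. by move=> ay; apply: g_ge10; [exact: ay.1|exact: around10]. Qed.

Let g_gt0 y : around y -> 0 < g y.
Proof. by move=> ay; apply: lt_le_trans (g_ge ay); rewrite powR_gt0// (bdist_gt0 oD nD ay.1). Qed.

Let g_le y : D y -> enorm (y - x0) < 3 * r1 -> g y <= 2 * A * bdist y `^ beta.
Proof. exact: (gpot_le oD e1 c01 r10 x0D HR beta01 Gb). Qed.

Let g_bdd z : inside z -> loc_bounded D g z.
Proof. exact: (gpot_loc_bounded oD r10 x0D HR beta01 GC2 Gb). Qed.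

Let g_decay z : inside z -> walk g z <= (1 - gd) * g z.
Proof.
move=> iz; apply: le_trans (gpot_decay u oD eps01 e1 c01 r10 x0D HR beta01 k_gt0 GC2 Gb GL eps_g iz) _.
by rewrite ler_wpM2r ?(ltW (g_gt0 (inside_self r10 iz)))// lerD2l lerN2 /gd ge_min lexx orbT.
Qed.

Let A1 : 1 <= A. Proof. exact: (A_ge1 e1 c01 Gb). Qed.

Let FC : R := frostman_const gam gd k1 n0.
Let FC0 : 0 <= FC.
Proof.
have /andP[gm0 _] := gam01; have /andP[gd0 _] := gd01.
apply: divr_ge0; first exact: exprn_ge0.
apply: mulr_ge0; last exact: powR_ge0.
exact: (mulr_ge0 (mulr_ge0 (ler0n _ 4) (ltW gm0)) (ltW gd0)).
Qed.

Let fpot p : V -> R := frostman_pot g (fun y => H (y - p)) p gam s FC.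

Section Pole.
Variable p : V.
Hypotheses (np : ~ D p) (px : enorm (p - x0) < 10 * r1).

Let conep y : around y -> in_cone e c (y - p).
Proof. by move=> ay; apply: HR => //; [exact: ay.1|exact: around10]. Qed.

Let v_ge y : around y -> k1 * enorm (y - p) `^ (- sigma) <= H (y - p).
Proof. by move=> ay; have /andP[] := Hb (conep ay). Qed.

Let v_gt0 y : around y -> 0 < H (y - p).
Proof. by move=> ay; apply: lt_le_trans (v_ge ay); rewrite mulr_gt0// powR_gt0; have [] := conep ay. Qed.

Lemma fpot_ge y : around y -> enorm (y - p) `^ (- s) <= fpot p y.
Proof. by move=> ay; rewrite /fpot /frostman_pot lerDl (mulr_ge0 FC0)// mulr_ge0 ?powR_ge0. Qed.

Definition fpot_bound : R := 1 + FC * (k2 `^ (1 - gam) * (2 * A) `^ gam).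

Lemma fpot_bound_gt0 : 0 < fpot_bound.
Proof. by rewrite ltr_pwDl// (mulr_ge0 FC0)// mulr_ge0 ?powR_ge0. Qed.

(** Every exterior pole is at distance at least [bdist y], and [sE] makes the powers of [bdist y] in
    the mixed term combine to [- s]; the bound is uniform in [p]. *)
Lemma fpot_le y : around y -> fpot p y <= fpot_bound * bdist y `^ (- s).
Proof.
move=> ay; have by0 := bdist_gt0 oD nD ay.1; have byp := bdist_le nD y np.
have yp0 : 0 < enorm (y - p) by exact: lt_le_trans byp.
have /andP[gm0 gm1] := gam01; have [bt0 bt1] := andP beta01; have A1' := A1.
rewrite /fpot /frostman_pot /fpot_bound mulrDl mul1r lerD//.
  by apply: ler_powRN => //; exact: ltW.
rewrite -[leRHS]mulrA ler_wpM2l//.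
have k20 : 0 <= k2.
  have /andP[_ h] := Hb (conep ay); have h2 := lt_le_trans (v_gt0 ay) h.
  by rewrite -(pmulr_lge0 _ (powR_gt0 (- sigma) yp0)) mulrC ltW// mulrC.
have vle : H (y - p) `^ (1 - gam) <= (k2 * bdist y `^ (- sigma)) `^ (1 - gam).
  apply: ge0_ler_powR; rewrite ?nnegrE ?(ltW (v_gt0 ay)) ?mulr_ge0 ?powR_ge0//; first by lra.
  have /andP[_ h] := Hb (conep ay); apply: (le_trans h); rewrite ler_wpM2l//.
  by apply: ler_powRN => //; exact: ltW.
have gle : g y `^ gam <= (2 * A * bdist y `^ beta) `^ gam.
  apply: ge0_ler_powR; rewrite ?nnegrE ?(ltW gm0) ?(ltW (g_gt0 ay))//; last first.
    by apply: g_le; [exact: ay.1|exact: ay.2].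
  exact: (mulr_ge0 (mulr_ge0 (ler0n _ 2) (le_trans ler01 A1)) (powR_ge0 _ _)).
apply: le_trans (ler_pM (powR_ge0 _ _) (powR_ge0 _ _) vle gle) _.
have A20 : 0 <= 2 * A by exact: (mulr_ge0 (ler0n _ 2) (le_trans ler01 A1)).
rewrite (powRM _ k20 (powR_ge0 _ _)) (powRM _ A20 (powR_ge0 _ _)).
rewrite -!powRrM.
have E : bdist y `^ (- s) = bdist y `^ (- sigma * (1 - gam)) * bdist y `^ (beta * gam).
  rewrite -powRD; last by apply/implyP => _; rewrite gt_eqF.
  by rewrite sE; congr (_ `^ _); ring.
by rewrite E le_eqVlt; apply/orP; left; apply/eqP; ring.
Qed.

Let hyps_ball z y : inside z -> cball z (irad z) y -> around y.
Proof. exact: (inside_around oD x0D). Qed.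

Let v_bdd z : inside z -> loc_bounded D (fun y => H (y - p)) z.
Proof. by move=> iz; exact: (barrier_loc_bounded oD x0D HR HC2 iz np px). Qed.

Lemma fpot_bdd z : inside z -> loc_bounded D (fpot p) z.
Proof.
move=> iz; have [bt0 bt1] := andP beta01; have /andP[gd0 gd1] := gd01.
apply: (@frostman_pot_bdd R d D oD nD g _ p z beta gam gd s sigma k1 iz.1 np gam01 s0 k10 _ _ _ _ n0 sn).
- by move=> y yB; apply: g_ge; exact: hyps_ball yB.
- exact: g_bdd.
- by move=> y yB; apply: v_ge; exact: hyps_ball yB.
- exact: v_bdd.
Qed.

Lemma fpot_decay z : inside z -> walk (fpot p) z <= fpot p z.
Proof.
move=> iz.
apply: (@frostman_pot_decay R d D u eps oD nD eps01 g _ p z beta gam gd s sigma k1 iz.1 np beta01 gam01 gd01 s0 sE k10 _ _ _ _ _ _ eps_w n0 sn).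
- by move=> y yB; apply: g_ge; exact: hyps_ball yB.
- exact: g_bdd.
- exact: g_decay.
- by move=> y yB; apply: v_ge; exact: hyps_ball yB.
- exact: v_bdd.
- apply: (walk_superharmonic u oD eps01 r10 x0D HR HC2 iz np px _ HL) => w wc.
  have /andP[h _] := Hb wc; apply: le_trans h.
  by rewrite mulr_ge0 ?powR_ge0 ?(ltW k10).
Qed.

End Pole.

Lemma cone_path_core : exists eta ts, [/\ 0 < eta, 0 < ts &
  forall (p : nat -> V) (rho : nat -> R),
  (forall k, [/\ ~ D (p k), enorm (p k - x0) < 10 * r1 & 0 < rho k]) ->
  (forall n, \sum_(k < n) rho k `^ s <= eta) ->
  exists x, [/\ boundary D x, enorm (x - x0) <= r1,
    forall k, rho k < enorm (x - p k),
    forall t, 0 < t <= ts -> D (x + t *: e) &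
    exists B, forall n (t : nat -> R),
      (forall i, ts * (2^-1) ^+ i / 2 <= t i <= ts * (2^-1) ^+ i) ->
      \sum_(i < n) ts * (2^-1) ^+ i * enorm (grad u (x + t i *: e)) <= B]].
Proof.
apply: (greedy_selection (fpot := fpot) beta01 gd01 eps01 A1 s0 r10 r11 r1R fpot_bound_gt0 r1S
  g_ge10 g_le g_bdd g_decay).
- by move=> p y _ _; exact: fpot_ge.
- by move=> p y np px; exact: fpot_le.
- by move=> p z np px; exact: fpot_bdd.
- by move=> p z np px; exact: fpot_decay.
Qed.

End Assembly.

End ConePath.

Section ConeParameters.
Context {R : realType} {d : nat}.
Local Notation V := 'rV[R]_d.

Variables (D : set V) (u : V -> R) (M : R) (x0 e : V) (c R0 : R).
Hypotheses (oD : open D) (hu : harmonic_on D u) (uM : forall y, D y -> `|u y| <= M) (M0 : 0 <= M).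
Hypotheses (u0 : forall y, D y -> 0 <= u y) (d2 : (1 < d)%N).
Hypotheses (e1 : dot e e = 1) (c01 : 0 < c <= 1) (R00 : 0 < R0) (x0D : ~ D x0) (x0cl : closure D x0).
Hypothesis Hcone : forall p z, ~ D p -> enorm (p - x0) < R0 -> D z ->
  enorm (z - x0) < R0 -> in_cone e c (z - p).

(** Arbitrary sample points, one in each dyadic piece, stand for the supremum of [|grad u|] over the
    piece. *)
Definition ray_sums_bounded (ts : R) (x : V) : Prop :=
  (forall t, 0 < t <= ts -> D (x + t *: e)) /\
  exists B, forall n (t : nat -> R),
    (forall i, ts * (2^-1) ^+ i / 2 <= t i <= ts * (2^-1) ^+ i) ->
    \sum_(i < n) ts * (2^-1) ^+ i * enorm (grad u (x + t i *: e)) <= B.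

Lemma frostman_exponent (sigma beta : R) : (d%:R - 1) / 2 < sigma -> 0 < beta <= 2^-1 ->
  exists2 gam, 0 < gam <= 1 & (d%:R - 1) / 2 < sigma * (1 - gam) - beta * gam.
Proof.
have dR : 2 <= d%:R :> R by rewrite ler_nat.
have b0 : 2^-1 <= (d%:R - 1) / 2 :> R by lra.
move: (_ / 2) b0 => b b0 bs /andP[bt0 bt1].
have s1 : 0 < 2 * (sigma + 1) by lra.
(* Since [beta < 1], the loss [gam (sigma + beta)] is below [gam (sigma + 1)], half of the room
   between [b] and [sigma]. *)
exists ((sigma - b) / (2 * (sigma + 1))).
  rewrite divr_gt0//=; last by lra.
  by rewrite ler_pdivrMr//; lra.
set gam := _ / _; have E : gam * (2 * (sigma + 1)) = sigma - b by rewrite /gam divfK// gt_eqF.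
have g0 : 0 < gam by rewrite /gam divr_gt0//; lra.
have h : gam * beta <= gam * 2^-1 by rewrite ler_pM2l.
by lra.
Qed.

Lemma cone_path r : 0 < r -> exists s r' eta ts : R,
  [/\ (d%:R - 1) / 2 < s, 0 < r' <= r, 0 < eta, 0 < ts &
  forall (p : nat -> V) (rho : nat -> R),
  (forall k, [/\ ~ D (p k), enorm (p k - x0) < r' & 0 < rho k]) ->
  (forall n, \sum_(k < n) rho k `^ s <= eta) ->
  exists x, [/\ boundary D x, enorm (x - x0) < r',
    forall k, rho k < enorm (x - p k) & ray_sums_bounded ts x]].
Proof.
move=> r0.
have [beta [A [k [G [G1 [G2 [beta01 k0 GC2 Gb GL]]]]]]] := subharmonic_power_barrier e1 c01 d2.
have [sigma [k1 [k2 [H [H1 [H2 [sgb k10 HC2 Hb HL]]]]]]] := superharmonic_power_barrier e1 c01 d2.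
have [gam gam01 sb] := frostman_exponent sgb beta01.
have dR : 2 <= d%:R :> R by rewrite ler_nat.
have b0 : 2^-1 <= (d%:R - 1) / 2 :> R by lra.
have sg0 : 0 < sigma by apply: lt_trans sgb; apply: lt_le_trans b0; rewrite invr_gt0.
pose s := sigma * (1 - gam) - beta * gam.
have s0 : 0 < s by apply: lt_trans sb; apply: lt_le_trans b0; rewrite invr_gt0.
have sn : s <= (Num.trunc s).+1%:R by rewrite ltW// truncnS_gt.
have [c4 c7] : 0 < c / 2 <= 1 /\ 0 < c / 4 <= 1.
  by have /andP[c0 c1] := c01; split; apply/andP; split; lra.
have [q0 _] := andP (chain_ratio_bounds c4 c7).
set q := chain_ratio _ _ in q0.
pose r1 := Num.min 4^-1 (Num.min (R0 / 10) (Num.min (r / 2) (q * (R0 / 4) / 10))).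
have r10 : 0 < r1 by rewrite /r1 !lt_min invr_gt0 ltr0n !divr_gt0 ?(mulr_gt0 q0) ?divr_gt0.
have r11 : r1 <= 4^-1 by rewrite /r1 ge_min lexx.
have r1R : r1 <= R0 / 10 by rewrite /r1 !ge_min lexx !orbT.
have r1r : r1 <= r / 2 by rewrite /r1 !ge_min lexx !orbT.
have r1q : r1 <= q * (R0 / 4) / 10 by rewrite /r1 !ge_min lexx !orbT.
have r1R' : 10 * r1 <= R0 by rewrite mulrC -ler_pdivlMr.
have r1q' : 10 * r1 <= q * (R0 / 4) by rewrite mulrC -ler_pdivlMr.
have [eta [ts [eta0 ts0 main]]] := cone_path_core oD hu uM M0 u0 d2 e1 c01 x0D x0cl Hcone
  beta01 k0 GC2 Gb GL sg0 k10 HC2 Hb HL gam01 s0 erefl sn r10 r11 r1R' r1q'.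
(* Doubling the radius turns [|x - x0| <= r1] into the strict inequality of an open ball. *)
exists s, (2 * r1), eta, ts; split=> //; first by apply/andP; split; lra.
move=> p rho hp hsum.
have [|x [bx xx xp xD xB]] := main p rho _ hsum.
  by move=> k'; have [h1 h2 h3] := hp k'; split=> //; lra.
by exists x; split=> //; lra.
Qed.

End ConeParameters.

(** * Lipschitz charts and Hausdorff dimension *)

Section Chart.
Context {R : realType} {d : nat}.
Local Notation V := 'rV[R]_d.
Local Notation W := 'rV[R]_(d.-1 + 1).

Lemma dot_mulmx (n : nat) (x y : 'rV[R]_n) : dot x y = (x *m y^T) ord0 ord0.
Proof. by rewrite mxE; apply: eq_bigr => i _; rewrite !mxE. Qed.

Lemma dot_orthogonal (Q : 'M[R]_(d, d.-1 + 1)) (v w : V) : Q *m Q^T = 1%:M ->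
  dot (v *m Q) (w *m Q) = dot v w.
Proof. by move=> QQ; rewrite !dot_mulmx trmx_mul mulmxA -(mulmxA v) QQ mulmx1. Qed.

Lemma sqr_enorm_base_height (w : W) : enorm w ^+ 2 = enorm (base w) ^+ 2 + height w ^+ 2.
Proof.
rewrite !sqr_enorm /dot big_split_ord /= big_ord1; congr (_ + _).
  by apply: eq_bigr => i _; rewrite /base !mxE.
by rewrite /height !mxE expr2.
Qed.

Lemma enorm_base_le (w : W) : enorm (base w) <= enorm w.
Proof.
rewrite -ler_sqr ?nnegrE ?enorm_ge0// [leRHS]sqr_enorm_base_height lerDl.
exact: sqr_ge0.
Qed.

Lemma height_le_enorm (w : W) : `|height w| <= enorm w.
Proof.
rewrite -ler_sqr ?nnegrE ?enorm_ge0// [leRHS]sqr_enorm_base_height real_normK ?num_real//.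
by rewrite lerDr sqr_ge0.
Qed.

Lemma baseB (w w' : W) : base (w - w') = base w - base w'.
Proof. by apply/rowP => i; rewrite /base !mxE. Qed.

Lemma heightB (w w' : W) : height (w - w') = height w - height w'.
Proof. by rewrite /height !mxE. Qed.

Definition vertical (Q : 'M[R]_(d, d.-1 + 1)) : V := row_mx 0 1%:M *m Q^T.

Lemma dot_vertical (Q : 'M[R]_(d, d.-1 + 1)) (v : V) : orthogonal_mx Q ->
  dot v (vertical Q) = height (v *m Q).
Proof.
move=> [QQ QQ']; rewrite -(dot_orthogonal _ _ QQ) /vertical -mulmxA QQ' mulmx1.
rewrite /dot big_split_ord /= big_ord1 big1 ?add0r => [|i _].
  by rewrite row_mxEr [1%:M _ _]mxE eqxx mulr1 /height [rsubmx _ _ _]mxE.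
by rewrite row_mxEl [X in _ * X]mxE mulr0.
Qed.

Lemma vertical_unit (Q : 'M[R]_(d, d.-1 + 1)) : orthogonal_mx Q -> dot (vertical Q) (vertical Q) = 1.
Proof.
move=> oQ; rewrite dot_vertical// /vertical -mulmxA oQ.2 mulmx1.
by rewrite /height row_mxKr mxE.
Qed.

(* With slope [L] the angle to the axis has sine at most [L / sqrt (1 + L^2)], and [1 - sin >= 1 / (2 (1 + L^2))]. *)
Lemma slope_cone (L b t n : R) : 0 <= L -> 0 <= b -> 0 <= n -> n ^+ 2 = b ^+ 2 + t ^+ 2 -> - (L * b) <= t ->
  (2 * (1 + L ^+ 2))^-1 * n <= n + t.
Proof.
move=> L0 b0 n0 nE bt; have L2 := sqr_ge0 L.
have p : 0 < 2 * (1 + L ^+ 2) by lra.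
set c := _^-1; have cE : c * (2 * (1 + L ^+ 2)) = 1 by rewrite /c mulVf// gt_eqF.
have c0 : 0 < c by rewrite /c invr_gt0.
have c1 : c <= 2^-1 by nra.
have [t0|t0] := leP 0 t; first by nra.
have h : (- t) ^+ 2 <= ((1 - c) * n) ^+ 2.
  have h1 : t ^+ 2 <= L ^+ 2 * b ^+ 2.
    have : (- t) ^+ 2 <= (L * b) ^+ 2 by rewrite ler_sqr ?nnegrE ?mulr_ge0//; lra.
    by rewrite sqrrN exprMn.
  have h2 : t ^+ 2 * (1 + L ^+ 2) <= L ^+ 2 * n ^+ 2 by rewrite nE; lra.
  have h3 : t ^+ 2 <= (1 - 2 * c) * n ^+ 2.
    have -> : t ^+ 2 = t ^+ 2 * (1 + L ^+ 2) * (2 * c) 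
      by transitivity (t ^+ 2 * (c * (2 * (1 + L ^+ 2)))); [rewrite cE mulr1|ring].
    have -> : (1 - 2 * c) * n ^+ 2 = L ^+ 2 * n ^+ 2 * (2 * c).
      have -> : L ^+ 2 * n ^+ 2 * (2 * c) = (c * (2 * (1 + L ^+ 2)) - 2 * c) * n ^+ 2 by ring.
      by rewrite cE.
    by rewrite ler_wpM2r// mulr_ge0// ltW.
  rewrite sqrrN exprMn; apply: (le_trans h3); rewrite ler_wpM2r ?sqr_ge0//.
  by have := sqr_ge0 c; rewrite expr2; nra.
move: h; rewrite ler_sqr ?nnegrE; [lra|lra|].
by rewrite mulr_ge0//; lra.
Qed.

(** In the chart [z] is above the graph and [p] on or below it, so the height of [z - p] is at least
    minus the Lipschitz constant times the length of its base; [slope_cone] turns this into an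
    angle. The rigid motion preserves norms, so a ball around [x0] fits in the cylinder. *)
Lemma lipschitz_cone (D : set V) (x0 : V) : lipschitz_domain D -> boundary D x0 ->
  exists (e : V) (c R0 : R), [/\ dot e e = 1, 0 < c <= 1, 0 < R0 &
    forall p z, ~ D p -> enorm (p - x0) < R0 -> D z -> enorm (z - x0) < R0 -> in_cone e c (z - p)].
Proof.
move=> [_ /(_ x0)] + bx => /(_ bx) [Q [r [h [phi [oQ [r0 h0] [[L0 phiL] _] DE _]]]]].
(* The constant in [lipschitz_on_ball] carries no sign condition. *)
pose L := Num.max 0 L0; have L0' : 0 <= L by rewrite /L le_max lexx.
exists (vertical Q), (2 * (1 + L ^+ 2))^-1, (Num.min r h); split.
- exact: vertical_unit.
- have L2 := sqr_ge0 L; rewrite invr_gt0 invf_le1; last by lra.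
  by apply/andP; split; lra.
- by rewrite lt_min r0.
move=> p z np px Dz zx; have [QQ QQ'] := oQ.
pose m y := rigid_motion x0 Q y.
have mn y : enorm (m y) = enorm (y - x0).
  by rewrite !enormE /m /rigid_motion dot_orthogonal.
have cyl y : enorm (y - x0) < Num.min r h -> enorm (base (m y)) < r /\ `|height (m y)| < h.
  rewrite -mn lt_min => /andP[yr yh]; split.
    exact: le_lt_trans (enorm_base_le _) yr.
  exact: le_lt_trans (height_le_enorm _) yh.
have [zb zh] := cyl z zx; have [pb ph] := cyl p px.
have : ((rigid_motion x0 Q @` D) `&` cylinder r h) (m z) by split=> //; exists z.
rewrite DE => -[_ /andP[zphi _]].
have pphi : height (m p) <= phi (base (m p)).
  rewrite leNgt; apply/negP => pphi.
  have : [set w : W | enorm (base w) < r /\ phi (base w) < height w < h] (m p).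
    by split=> //; rewrite pphi/=; exact: le_lt_trans (ler_norm _) ph.
  rewrite -DE => -[[y Dy yp] _]; apply: np.
  have : m y *m Q^T = m p *m Q^T by rewrite /m yp.
  by rewrite /m /rigid_motion -!mulmxA QQ !mulmx1 => /addIr <-.
have w0 : 0 < enorm (z - p).
  by apply: enorm_gt0; apply: contraPneq np => /subr0_eq <-.
split=> //; rewrite /tilt dot_vertical//.
have mB : (z - p) *m Q = m z - m p.
  by rewrite /m /rigid_motion -mulmxBl; congr (_ *m _); rewrite opprB addrA subrK.
have wn : enorm (z - p) = enorm (m z - m p) by rewrite -mB !enormE dot_orthogonal.
rewrite mB wn.
apply: (@slope_cone L (enorm (base (m z - m p)))) => //; rewrite ?enorm_ge0//.
  exact: sqr_enorm_base_height.
rewrite heightB baseB.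
have := phiL _ _ zb pb; rewrite ler_norml => /andP[ph1 _].
have : L0 * enorm (base (m z) - base (m p)) <= L * enorm (base (m z) - base (m p)).
  by rewrite ler_wpM2r ?enorm_ge0// /L le_max lexx orbT.
by lra.
Qed.

End Chart.

(** * From dyadic sums to the integral along a segment *)

Section DyadicIntegral.
Context {R : realType}.
Implicit Types (f : R -> R) (B t : R) (n m : nat).

Lemma trivIset_dyadic : trivIset setT (fun n => [set` `](2^-1) ^+ n.+1, (2^-1) ^+ n]%R] : set R).
Proof.
apply: ltn_trivIset => n m mn; apply/seteqP; split=> // x [] /=.
rewrite !in_itv /= => /andP[h _] /andP[_ h'].
have := lt_le_trans h h'; rewrite ltNge => /negP; apply.
by apply: ler_wiXn2l mn; rewrite ?invr_ge0// invf_le1// ler1n.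
Qed.

Lemma bigcup_dyadic : \bigcup_n ([set` `](2^-1) ^+ n.+1, (2^-1) ^+ n]%R] : set R) = [set` `]0, 1]%R].
Proof.
apply/seteqP; split=> x /=.
  move=> [n _] /=; rewrite !in_itv /= => /andP[h1 h2]; apply/andP; split.
    by apply: lt_trans h1; rewrite exprn_gt0// invr_gt0.
  by apply: le_trans h2 _; rewrite exprn_ile1 ?invr_ge0// invf_le1 ?ler1n.
rewrite in_itv /= => /andP[x0 x1].
have [k hk] := tscale_le (divr_gt0 x0 (ltr0n R 2)).
have ex : exists n, (2^-1) ^+ n < x.
  exists k; apply: le_lt_trans hk _; rewrite ltr_pdivrMr// ltr_pMr// ltr1n.
  by [].
have [n [hn nmin]] : exists n, (2^-1) ^+ n < x /\ forall m, (2^-1) ^+ m < x -> (n <= m)%N.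
  by exists (ex_minn ex); case: ex_minnP.
case: n hn nmin => [|n] hn nmin; first by move: hn; rewrite expr0 ltNge x1.
exists n => //=; rewrite in_itv /= hn /= leNgt; apply/negP => /nmin.
by rewrite ltnn.
Qed.

(** On each closed dyadic piece take the sample point where [f] is maximal: the integral over the
    piece is at most its length times this maximum, and the hypothesis bounds the sum of these. *)
Lemma dyadic_integral_fin (O : set R) f B : open O -> [set` `]0, 1]%R] `<=` O ->
  {in O, continuous f} -> (forall t, 0 <= f t) ->
  (forall n (t : nat -> R), (forall i, (2^-1) ^+ i / 2 <= t i <= (2^-1) ^+ i) ->
     \sum_(i < n) (2^-1) ^+ i * f (t i) <= B) ->
  (\int[@lebesgue_measure R]_(t in `]0%R, 1%R]) (f t)%:E < +oo)%E.
Proof.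
move=> oO sO cf f0 hB.
have p2 n : 0 < (2^-1) ^+ n :> R by rewrite exprn_gt0// invr_gt0.
have half n : (2^-1) ^+ n.+1 = (2^-1) ^+ n / 2 :> R by rewrite exprSr.
have ple n : (2^-1) ^+ n.+1 <= (2^-1) ^+ n :> R by rewrite half; have := p2 n; lra.
have /choice[t ht] n : exists t : R, (2^-1) ^+ n / 2 <= t <= (2^-1) ^+ n /\
    forall y, (2^-1) ^+ n.+1 <= y <= (2^-1) ^+ n -> f y <= f t.
  have cont : {within `[(2^-1) ^+ n.+1, (2^-1) ^+ n], continuous f}.
    apply: continuous_in_subspaceT => y; rewrite inE /= in_itv /= => /andP[y1 y2].
    apply: cf; rewrite inE; apply: sO; rewrite /= in_itv /=; apply/andP; split.
      exact: lt_le_trans y1.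
    by apply: le_trans y2 _; rewrite exprn_ile1 ?invr_ge0// invf_le1 ?ler1n.
  have [t + tmax] := EVT_max (ple n) cont; rewrite in_itv /= => tin; exists t; split.
    by rewrite -half.
  by move=> y hy; apply: tmax; rewrite in_itv.
have mf : measurable_fun O f by exact: measurable_realfun.open_continuous_measurable_fun.
have mO : measurable O by exact: measurable_realfun.open_measurable.
rewrite -bigcup_dyadic ge0_integral_bigcup; first last.
- exact: trivIset_dyadic.
- by move=> y _; rewrite lee_fin.
- rewrite bigcup_dyadic; apply/measurable_realfun.measurable_EFinP; exact: (measurable_funS mO sO mf).
- by move=> n; exact: measurable_itv.
apply: (@le_lt_trans _ _ B%:E); last exact: ltry.
have i0 n : (0 <= \int[@lebesgue_measure R]_(t in [set` `](2^-1) ^+ n.+1, (2^-1) ^+ n]%R]) (f t)%:E)%E.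
  by apply: integral_ge0 => y _; rewrite lee_fin.
apply: lime_le; first by apply: is_cvg_nneseries.
apply: nearW => n; apply: (@le_trans _ _ (\sum_(i < n) (2^-1) ^+ i * f (t i))%:E); last first.
  by rewrite lee_fin; apply: hB => i; have [] := ht i.
rewrite big_mkord -sumEFin; apply: lee_sum => i _.
set I := `](2^-1) ^+ i.+1, (2^-1) ^+ i]%R.
apply: (@le_trans _ _ (\int[@lebesgue_measure R]_(y in [set` I]) cst (f (t i))%:E y)%E).
  apply: ge0_le_integral; first exact: measurable_itv.
  - by move=> y _; rewrite lee_fin.
  - apply/measurable_realfun.measurable_EFinP; apply: (measurable_funS mO _ mf) => y yI; apply: sO.
    by rewrite -bigcup_dyadic; exists (i : nat).
  - exact: measurable_cst.
  - move=> y; rewrite /= in_itv /= => /andP[y1 y2]; rewrite lee_fin.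
    by apply: (ht i).2; rewrite (ltW y1).
rewrite integral_cst; last exact: measurable_itv.
rewrite -[X in (_ * X)%E]/(lebesgue_measure ([set` I] : set R)) lebesgue_measure_itv /= lte_fin; case: ifP => _; last first.
  by rewrite mule0 lee_fin mulr_ge0// ltW.
rewrite -EFinD -EFinM lee_fin mulrC ler_wpM2r// gerBl//.
Qed.

End DyadicIntegral.

Section BourgainRay.
Context {R : realType} {d : nat}.
Local Notation V := 'rV[R]_d.
Variables (D : set V) (u : V -> R) (e : V).
Hypotheses (oD : open D) (hu : harmonic_on D u).

Lemma continuous_enorm_grad z : D z -> {for z, continuous (fun y => enorm (grad u y))}.
Proof.
move=> Dz; have [hC _] := hu; have [_ hp _] := hC z Dz.
have H (r : seq 'I_d) : {for z, continuous (fun y => \sum_(i <- r) partial i u y ^+ 2)}.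
  elim: r => [|i r IH].
    have -> : (fun y => \sum_(i <- [::]) partial i u y ^+ 2) = cst 0.
      by apply/funext => y; rewrite big_nil.
    exact: cst_continuous.
  have -> : (fun y => \sum_(i <- i :: r) partial i u y ^+ 2) =
      (fun y => partial i u y * partial i u y + \sum_(i <- r) partial i u y ^+ 2).
    by apply/funext => y; rewrite big_cons expr2.
  exact: (cvgD (cvgM (hp i).2 (hp i).2) IH).
have -> : (fun y => enorm (grad u y)) = Num.sqrt \o (fun y => \sum_(i <- index_enum 'I_d) partial i u y ^+ 2).
  by apply/funext => y; rewrite /enorm /=; congr (Num.sqrt _); apply: eq_bigr => i _; rewrite mxE.
apply: continuous_comp; first exact: H.
exact: sqrt_continuous.
Qed.

Lemma ray_bourgain (ts : R) x : 0 < ts -> boundary D x -> ray_sums_bounded D u e ts x ->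
  bourgain_points D u x.
Proof.
(* The segment is rescaled to unit length, so sample points are multiplied by [ts] and the bound is
   divided by it. *)
move=> ts0 bx [xD [B hB]]; split=> //; exists (ts *: e).
have sD t : 0 < t <= 1 -> D (x + t *: (ts *: e)).
  move=> /andP[t0 t1]; rewrite scalerA; apply: xD; rewrite mulr_gt0//=.
  by rewrite ler_piMl// ltW.
split; first by move=> _ [t /= + <-]; rewrite in_itv /=; exact: sD.
pose line t := x + t *: (ts *: e).
have cl : continuous line.
  by move=> t; apply: cvgD; [exact: cvg_cst|exact: scalel_continuous].
apply: (@dyadic_integral_fin R (line @^-1` D) (fun t => enorm (grad u (line t))) (B / ts)).
- by apply: open_comp => // t _; exact: cl.
- by move=> t /=; rewrite in_itv /=; exact: sD.
- move=> t; rewrite inE /= => Dt; 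
  exact: (@continuous_comp _ _ _ line (fun y => enorm (grad u y)) t (cl t) (continuous_enorm_grad Dt)).
- by move=> t; exact: enorm_ge0.
move=> n t ht; rewrite ler_pdivlMr// mulrC mulr_sumr.
apply: le_trans (hB n (fun i => t i * ts) _); last first.
  move=> i; have /andP[h1 h2] := ht i; rewrite -mulrA [t i * ts]mulrC.
  by rewrite !ler_pM2l// h1.
by apply: ler_sum => i _; rewrite mulrA /line scalerA.
Qed.

End BourgainRay.

(** * Lower bounds for the Hausdorff dimension, and the conclusion *)

Section Hausdorff.
Context {R : realType} {d : nat}.
Local Notation V := 'rV[R]_d.
Implicit Types (U A E : set V) (x y : V) (s t : R).

Lemma ediam_fin U x : U x -> (ediam U <= 1%:E)%E ->
  ediam U = (fine (ediam U))%:E /\ 0 <= fine (ediam U) <= 1.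
Proof.
move=> Ux h; have h0 : (0%:E <= ediam U)%E.
  have <- : enorm (x - x) = 0 by rewrite subrr enorm0.
  by apply: ereal_sup_ubound; exists x => //; exists x.
have E : ediam U = (fine (ediam U))%:E.
  by rewrite fineK// fin_numE; apply/andP; split; apply/eqP => H; move: h0 h; rewrite H.
by split=> //; rewrite E !lee_fin in h0 h; rewrite h0.
Qed.

Lemma enorm_le_ediam U x y : U x -> U y -> (ediam U <= 1%:E)%E -> enorm (x - y) <= fine (ediam U).
Proof.
move=> Ux Uy h; have [E _] := ediam_fin Ux h.
rewrite -lee_fin -E; apply: ereal_sup_ubound; exists x => //; by exists y.
Qed.

Lemma ediam_pow_ge0 s U : (0 <= ediam_pow s U)%E.
Proof. by rewrite /ediam_pow; case: ifP => // _; exact: poweR_ge0. Qed.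

(** For diameters in (0, 1] a larger exponent gives a smaller power. As [t > 0], the left side
    vanishes on singletons, and on the empty set because [fine] sends [-oo] to 0. *)
Lemma ediam_pow_ge s t U : 0 <= s -> s < t -> (ediam U <= 1%:E)%E ->
  ((fine (ediam U) `^ t)%:E <= ediam_pow s U)%E.
Proof.
move=> s0 st h; have t0 : 0 < t by exact: le_lt_trans st.
rewrite /ediam_pow; case: ifPn => [/eqP ->|/set0P[x Ux]].
  have -> : ediam (set0 : set V) = -oo%E.
    rewrite /ediam (_ : [set _ | _ in _ & _ in _] = set0) ?ereal_sup0//.
    by apply/seteqP; split=> // z [].
  by rewrite /= powR0// gt_eqF.
have [E /andP[e0 e1]] := ediam_fin Ux h; rewrite [in leRHS]E poweR_EFin lee_fin.
have [->|e0'] := eqVneq (fine (ediam U)) 0.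
  by rewrite powR0 ?gt_eqF// powR_ge0.
apply: ger_powR; last exact: ltW.
by rewrite lt_def e0' e0.
Qed.

Lemma ler_powR_max (a b t : R) : Num.max a b `^ t <= a `^ t + b `^ t.
Proof.
have [_|_] := leP a b; first by rewrite lerDr powR_ge0.
by rewrite lerDl powR_ge0.
Qed.

Lemma sum_half_le1 n : \sum_(k < n) (2^-1) ^+ k.+1 <= 1 :> R.
Proof.
suff -> : \sum_(k < n) (2^-1) ^+ k.+1 = 1 - (2^-1) ^+ n :> R.
  by rewrite gerBl exprn_ge0 ?invr_ge0.
elim: n => [|n IH]; first by rewrite big_ord0 expr0 subrr.
by rewrite big_ord_recr /= IH exprS; field.
Qed.

Lemma null_cover s t A (eta : R) : 0 <= s -> s < t -> hausdorff_measure s A = 0%E -> 0 < eta ->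
  exists2 U : nat -> set V, A `<=` \bigcup_k U k &
    (forall k, (ediam (U k) <= 1%:E)%E) /\
    (forall n, \sum_(k < n) fine (ediam (U k)) `^ t <= eta).
Proof.
move=> s0 st H0 eta0.
have pm : (hausdorff_premeasure s 1 A <= 0)%E.
  by rewrite -H0; apply: ereal_sup_ubound; exists 1 => //=.
have : (hausdorff_premeasure s 1 A < eta%:E)%E by apply: le_lt_trans pm _; rewrite lte_fin.
move=> /ereal_inf_lt[_ [U [AU U1] <-] hU]; exists U => //; split=> // n.
rewrite -lee_fin; apply: le_trans (ltW hU); rewrite -sumEFin.
apply: (@le_trans _ _ (\sum_(k < n) ediam_pow s (U k))%E).
  by apply: lee_sum => k _; exact: ediam_pow_ge.
rewrite -(big_mkord xpredT (fun k => ediam_pow s (U k))).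
by apply: nneseries_lim_ge => k _ _; exact: ediam_pow_ge0.
Qed.

(* It suffices to avoid the closed balls [B(p k, rho k)], where [p k] is any point of [A] in [U k] and [rho k] slightly exceeds the diameter of [U k]. *)
Lemma hausdorff_dim_ge E A (x0 : V) t (eta r : R) : A `&` eball x0 r `<=` E -> 0 < t -> 0 < eta -> 0 < r ->
  (forall (p : nat -> V) (rho : nat -> R),
    (forall k, (p k = x0 \/ A (p k)) /\ enorm (p k - x0) < r /\ 0 < rho k) ->
    (forall n, \sum_(k < n) rho k `^ t <= eta) ->
    exists x, [/\ A x, enorm (x - x0) < r & forall k, rho k < enorm (x - p k)]) ->
  (t%:E <= hausdorff_dim E)%E /\ A `&` eball x0 r !=set0.
Proof.
move=> AE t0 eta0 r0 main.
(* Positive lower bounds for the radii, since a covering set may have diameter 0; their [t]-th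
   powers use half of the budget [eta], the diameters the other half. *)
pose tau k := (eta / 2 * (2^-1) ^+ k.+1) `^ t^-1.
have tp k : 0 < eta / 2 * (2^-1) ^+ k.+1 by rewrite mulr_gt0 ?divr_gt0// exprn_gt0// invr_gt0.
have tau0 k : 0 < tau k by rewrite powR_gt0.
have tauE k : tau k `^ t = eta / 2 * (2^-1) ^+ k.+1.
  by rewrite /tau -powRrM mulVf ?gt_eqF// powRr1// ltW.
have tsum n : \sum_(k < n) tau k `^ t <= eta / 2.
  under eq_bigr do rewrite tauE; rewrite -mulr_sumr.
  by rewrite ler_piMr ?divr_ge0 ?(ltW eta0)//; exact: sum_half_le1.
have x0r : enorm (x0 - x0) < r by rewrite subrr enorm0.
split; last first.
  have [|n|x [Ax xr _]] := main (fun=> x0) tau.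
  - by move=> k; split; [left|].
  - by apply: le_trans (tsum n) _; rewrite ler_pdivrMr// ler_peMr ?(ltW eta0)// ler1n.
  by exists x.
apply: le_ereal_inf_tmp => _ [s [s0 Hs] <-]; rewrite lee_fin leNgt; apply/negP => st.
have eta2 : 0 < eta / 2 by rewrite divr_gt0.
have [U EU [U1 Us]] := null_cover s0 st Hs eta2.
(* A covering set that misses the part of [A] in the ball receives the dummy centre [x0]. *)
have /choice[p hp] k : exists p, (p = x0 \/ A p) /\ enorm (p - x0) < r /\
    ((A `&` eball x0 r `&` U k) !=set0 -> U k p).
  have [[p [[Ap pr] Up]]|n] := pselect ((A `&` eball x0 r `&` U k) !=set0).
    by exists p; split; [right|].
  by exists x0; split; [left|split].
pose rho k := Num.max (fine (ediam (U k))) (tau k).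
have [||x [Ax xr xp]] := main p rho.
- move=> k; have [h1 [h2 _]] := hp k; split=> //; split=> //.
  by rewrite /rho lt_max tau0 orbT.
- move=> n; apply: (@le_trans _ _ (\sum_(k < n) fine (ediam (U k)) `^ t + \sum_(k < n) tau k `^ t)).
    by rewrite -big_split /=; apply: ler_sum => k _; exact: ler_powR_max.
  by rewrite [leRHS](_ : _ = eta / 2 + eta / 2) ?lerD//; field.
have Axr : (A `&` eball x0 r) x by [].
have [k _ Uk] := EU x (AE x Axr); have [_ [_ hpk]] := hp k.
have Up : U k (p k) by apply: hpk; exists x.
have := xp k; rewrite ltNge => /negP; apply.
by rewrite /rho le_max enorm_le_ediam.
Qed.

End Hausdorff.

Theorem mainTheorem1 (R : realType) (d : nat) (hd : (2 <= d)%N)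
    (D : set 'rV[R]_d) (hD : lipschitz_domain D)
    (u : 'rV[R]_d -> R)
    (u_harmonic : harmonic_on D u)
    (u_pos : forall y : 'rV[R]_d, D y -> 0 < u y)
    (u_bounded : exists M : R, forall y : 'rV[R]_d, D y -> `|u y| <= M)
    (x : 'rV[R]_d) (hx : boundary D x) (r : R) (hr : 0 < r) :
  (bourgain_points D u `&` eball x r) !=set0 /\
  (((d%:R - 1) / 2)%:E < hausdorff_dim (bourgain_points D u `&` eball x r))%E.
Proof.
have [[_ oD _] _] := hD; have [M uM] := u_bounded.
have uM' y : D y -> `|u y| <= `|M| by move=> Dy; apply: le_trans (uM y Dy) (ler_norm _).
have u0 y : D y -> 0 <= u y by move=> /u_pos/ltW.
have out p : boundary D p -> ~ D p by move=> [_]; rewrite (interior_id _).1.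
have [e [c [R0 [e1 c01 R00 Hcone]]]] := lipschitz_cone hD hx.
have [s [r' [eta [ts [sb /andP[r'0 r'r] eta0 ts0 main]]]]] :=
  cone_path oD u_harmonic uM' (normr_ge0 M) u0 hd e1 c01 R00 (out x hx) hx.1 Hcone hr.
have s0 : 0 < s.
  apply: le_lt_trans sb; rewrite divr_ge0// subr_ge0 ler1n; exact: ltnW.
have sub : bourgain_points D u `&` eball x r' `<=` bourgain_points D u `&` eball x r.
  by move=> y [By yx]; split=> //; exact: lt_le_trans yx r'r.
have [|dimE [y hy]] := hausdorff_dim_ge (t := s) sub s0 eta0 r'0 (eta := eta).
  move=> p rho hp hsum; have [|y [by' yx yp yB]] := main p rho _ hsum.
    move=> k; have [[->|[bp _]] [pr rk]] := hp k; split=> //; exact: out.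
  by exists y; split=> //; exact: ray_bourgain ts0 by' yB.
split; first by exists y; exact: sub.
(* The inequality is strict because [cone_path] provides an exponent [s] strictly above
   [(d - 1)/2]. *)
by apply: lt_le_trans dimE; rewrite lte_fin.
Qed.
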